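(* Consider the opinion dynamics on $V=(\mathbf{1}_{N_o}^{\perp})^{N_a}$ with homogeneous parameters and no inputs, $$\dot{\boldsymbol Z}_i=P_0\boldsymbol F_i(\boldsymbol Z),\qquad F_{ij}(\boldsymbol Z)=-d z_{ij}+u\Big(S_1\Big(\alpha z_{ij}+\gamma\sum_{k\ne i}a_{ik}z_{kj}\Big)+\sum_{l\neq j}S_2\Big(\beta z_{il}+\delta\sum_{k\neq i}a_{ik}z_{kl}\Big)\Big),$$ where $A=[a_{ik}]$ is the (unweighted, loop-free) adjacency matrix of a strongly connected graph. Let $\lambda_{max}>0$ be the eigenvalue of $A$ with largest real part, i.e. the Perron-Frobenius eigenvalue, with associated positive eigenvector $\mathbf v_{max}$. Let $\lambda_{min}<0$ be the eigenvalue of $A$ with smallest real part. Assume $\lambda_{min}$ is real, simple, and that $\operatorname{Re}[\xi]\neq\lambda_{min}$ for all eigenvalues $\xi\ne\lambda_{min}$ of $A$. A. (Cooperative agents.) Suppose that $\gamma-\delta>0$ and $\alpha-\beta+\lambda_{max}(\gamma-\delta)>0$. Then the critical value of the attention $u$ at which the opinion-forming steady-state bifurcation from $\boldsymbol Z=0$ happens is $$u^*=u_a:=\frac{d}{\alpha-\beta+\lambda_{max}(\gamma-\delta)},$$ and close to the bifurcation all the bifurcation branches are made of agreement solutions. B. (Competitive agents.) Suppose that $\gamma-\delta<0$ and $\alpha-\beta+\lambda_{min}(\gamma-\delta)>0$. Then the critical value of the attention $u$ at which the opinion-forming steady-state bifurcation from $\boldsymbol Z=0$ happens is $$u^*=u_d:=\frac{d}{\alpha-\beta+\lambda_{min}(\gamma-\delta)}.$$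 Moreover, whenever $\mathbf v_{min}$, the eigenvector of $A$ associated to $\lambda_{min}$, has mixed-sign entries, close to the bifurcation all the bifurcation branches are made of disagreement solutions.
   Context: There are $N_a$ agents and $N_o$ options. $\mathbf 1_{N_o}\in\mathbb R^{N_o}$ is the vector of ones and $P_0=\mathcal I_{N_o}-\frac1{N_o}\mathbf 1_{N_o}\mathbf 1_{N_o}^T$ the orthogonal projection onto $\mathbf 1_{N_o}^\perp$. The opinion of agent $i$ is $\boldsymbol Z_i=(z_{i1},\dots,z_{iN_o})\in\mathbf 1_{N_o}^\perp$; the state is $\boldsymbol Z=(\boldsymbol Z_1,\dots,\boldsymbol Z_{N_a})\in V$; $\boldsymbol F_i=(F_{i1},\dots,F_{iN_o})$. Parameters: $d>0$, $u\ge 0$, $\alpha,\beta,\gamma,\delta\in\mathbb R$, $a_{ik}\in\{0,1\}$, $a_{ii}=0$; $a_{ik}\neq0$ iff agent $k$ is a neighbor of agent $i$ (the graph may be directed). For $q\in\{1,2\}$, $S_q:\mathbb R\to[-k_{q1},k_{q2}]$ with $k_{q1},k_{q2}>0$ is a generic sigmoidal saturating function with $S_q(0)=0$, $S_q'(0)=1$, $S_q''(0)\neq0$, $S_q'''(0)\ne0$. The bifurcation parameter is $u$. The opinion-forming steady-state bifurcation is the one at the value $u=u^*$ such that the neutral equilibrium $\boldsymbol Z=0$ is locally exponentially stable for $0<u<u^*$ and unstable for $u>u^*$, and at which branches of nonzero equilibria emerge from $\boldsymbol Z=0$ along the kernel of the Jacobian there; this kernel has the form $\mathbb R\{\mathbf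 v^*\}\otimes\mathbf 1_{N_o}^\perp$, where $\mathbf v^*$ is the eigenvector of $(\gamma-\delta)A$ for its eigenvalue with largest real part, and generically each branch is tangent at $\boldsymbol Z=0$ to some line $\mathbb R\{\mathbf v^*\otimes\mathbf v_{ax}\}$ with $\mathbf v_{ax}\in\mathbf 1_{N_o}^\perp$. A state is an agreement state (solution) if $\operatorname{sign}(z_{ij})=\operatorname{sign}(z_{kj})$ for all agents $i,k$ and all options $j$. It is a disagreement state (solution) if $\operatorname{sign}(z_{ij})\ne\operatorname{sign}(z_{kj})$ for at least one pair of agents $i\neq k$ and at least one option $j$.
   Formalization: In A, agreement of all branches is proved if (α+γλ_max)²S1''(0) ≠ (β+δλ_max)²S2''(0); without this, only for branches tangent to a line R(v_max⊗v_ax) with no zero entry in v_ax. In degenerate cases the claim can fail. N_o ≥ 2 is assumed. *)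

(* Defs.v *)
From HB Require Import structures.
From mathcomp Require Import all_boot all_order all_algebra.
From mathcomp Require Import complex.
From mathcomp Require Import all_classical all_reals all_analysis.

Set Implicit Arguments.
Unset Strict Implicit.
Unset Printing Implicit Defensive.

Import Order.TTheory GRing.Theory Num.Theory.
Import numFieldNormedType.Exports.

Local Open Scope classical_set_scope.
Local Open Scope ring_scope.

(* A state is the Na x No matrix Z whose row i is the opinion Z_i of agent i. *)

(** * The opinion dynamics *)

Definition perp1 (R : realType) (No : nat) : set 'rV[R]_No :=
  [set x | \sum_j x ord0 j = 0].

Definition opinion_space (R : realType) (Na No : nat) : set 'M[R]_(Na, No) :=
  [set Z | forall i, perp1 (row i Z)].

Definition proj1perp (R : realType) (No : nat) : 'M[R]_No :=
  1%:M - No%:R^-1 *: (const_mx 1 *m (const_mx 1 : 'cV[R]_No)^T).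

Definition adjacency (R : realType) (Na : nat) (g : rel 'I_Na) : 'M[R]_Na :=
  \matrix_(i, k) (g i k)%:R.

(* [g i k] means that agent [k] is a neighbor of agent [i]. *)
Definition strongly_connected (Na : nat) (g : rel 'I_Na) : Prop :=
  forall i k, connect g i k.

(* A bounded nondecreasing function has limits at both infinities, so the
   saturation is implied by the last two fields.  The regularity is the least
   one for which the third derivative at 0 makes sense as that of a C^3 map. *)
Record sigmoidal (R : realType) (S : R -> R) : Prop := Sigmoidal {
  sigm_derivable : forall n, (n < 3)%N ->
    forall x, derivable (derive1n n S) x 1;
  sigm_continuous : continuous (derive1n 3 S);
  sigm_0 : S 0 = 0;
  sigm_d1 : derive1n 1 S 0 = 1;
  sigm_d2 : derive1n 2 S 0 != 0;
  sigm_d3 : derive1n 3 S 0 != 0;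
  sigm_homo : {homo S : x y / x <= y};
  sigm_bounded : exists k1 k2 : R,
    [/\ 0 < k1, 0 < k2 & forall x, - k1 <= S x <= k2] }.

Definition opinion_F (R : realType) (Na No : nat)
    (d alpha beta gamma delta : R) (S1 S2 : R -> R) (A : 'M[R]_Na)
    (u : R) (Z : 'M[R]_(Na, No)) : 'M[R]_(Na, No) :=
  \matrix_(i, j)
    (- d * Z i j +
     u * (S1 (alpha * Z i j + gamma * \sum_(k | k != i) A i k * Z k j) +
          \sum_(l | l != j)
            S2 (beta * Z i l + delta * \sum_(k | k != i) A i k * Z k l))).

(* States have opinions as rows, so the symmetric matrix P_0 acts on the
   right. *)
Definition opinion_field (R : realType) (Na No : nat)
    (d alpha beta gamma delta : R) (S1 S2 : R -> R) (A : 'M[R]_Na)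
    (u : R) (Z : 'M[R]_(Na, No)) : 'M[R]_(Na, No) :=
  opinion_F d alpha beta gamma delta S1 S2 A u Z *m proj1perp R No.

Definition agreement (R : realType) (Na No : nat) (Z : 'M[R]_(Na, No)) : Prop :=
  forall i k j, Num.sg (Z i j) = Num.sg (Z k j).

Definition disagreement (R : realType) (Na No : nat)
    (Z : 'M[R]_(Na, No)) : Prop :=
  exists i k j, i != k /\ Num.sg (Z i j) <> Num.sg (Z k j).

(** * Stability of the neutral equilibrium *)

(* Forward solutions in [opinion_space] of an autonomous equation; [f] is the
   vector field at a fixed value of the parameter. *)
Definition solution (R : realType) (Na No : nat)
    (f : 'M[R]_(Na, No) -> 'M[R]_(Na, No)) (Z : R -> 'M[R]_(Na, No)) : Prop :=
  [/\ forall t, 0 <= t -> opinion_space (Z t),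
      {within `[0, +oo[, continuous Z} &
      forall t : R, 0 < t -> is_derive t 1 Z (f (Z t))].

Definition locally_exponentially_stable (R : realType) (Na No : nat)
    (f : 'M[R]_(Na, No) -> 'M[R]_(Na, No)) : Prop :=
  exists r C mu : R, [/\ 0 < r, 0 < C, 0 < mu &
    forall Z, solution f Z -> `|Z 0| < r ->
      forall t, 0 <= t -> `|Z t| <= C * expR (- mu * t) * `|Z 0|].

Definition lyapunov_stable (R : realType) (Na No : nat)
    (f : 'M[R]_(Na, No) -> 'M[R]_(Na, No)) : Prop :=
  forall e : R, 0 < e -> exists2 r : R, 0 < r &
    forall Z, solution f Z -> `|Z 0| < r -> forall t, 0 <= t -> `|Z t| < e.

Definition unstable (R : realType) (Na No : nat)
    (f : 'M[R]_(Na, No) -> 'M[R]_(Na, No)) : Prop :=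
  ~ lyapunov_stable f.

(** * Bifurcation branches *)

(* Below, [f u] is the vector field at the value [u] of the bifurcation
   parameter.  A branch is a continuous curve s |-> (us s, Zs s), 0 <= s < 1,
   of equilibria that leaves (ustar, 0) through nonzero equilibria; the two
   sides of a curve through (ustar, 0) are two branches. *)
Definition bifurcation_branch (R : realType) (Na No : nat)
    (f : R -> 'M[R]_(Na, No) -> 'M[R]_(Na, No)) (ustar : R)
    (us : R -> R) (Zs : R -> 'M[R]_(Na, No)) : Prop :=
  [/\ {within `[0, 1[, continuous us} /\ {within `[0, 1[, continuous Zs},
      us 0 = ustar, Zs 0 = 0 &
      forall s, 0 < s < 1 ->
        [/\ opinion_space (Zs s), Zs s != 0 & f (us s) (Zs s) = 0]].

(* dist (Zs s, K) = o(|Zs s|) as s -> 0+, for a linear subspace K. *)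
Definition tangent_to (R : realType) (Na No : nat) (K : set 'M[R]_(Na, No))
    (Zs : R -> 'M[R]_(Na, No)) : Prop :=
  forall e : R, 0 < e ->
    \forall s \near 0^'+, exists2 k, K k & `|Zs s - k| <= e * `|Zs s|.

Definition line (R : realType) (Na No : nat) (W : 'M[R]_(Na, No)) :
    set 'M[R]_(Na, No) :=
  [set c *: W | c in [set: R]].

(* v (x) x is the matrix [v *m x] with entries v_i x_j. *)
Definition tensor_perp1 (R : realType) (Na No : nat) (v : 'cV[R]_Na) :
    set 'M[R]_(Na, No) :=
  [set v *m x | x in @perp1 R No].

Definition jacobian_kernel (R : realType) (Na No : nat)
    (f : 'M[R]_(Na, No) -> 'M[R]_(Na, No)) : set 'M[R]_(Na, No) :=
  [set Z | opinion_space Z /\ 'd f (0 : 'M[R]_(Na, No)) Z = 0].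

Definition opinion_forming_bifurcation (R : realType) (Na No : nat)
    (f : R -> 'M[R]_(Na, No) -> 'M[R]_(Na, No)) (vstar : 'cV[R]_Na)
    (ustar : R) : Prop :=
  [/\ forall u, 0 < u < ustar -> locally_exponentially_stable (f u),
      forall u, ustar < u -> unstable (f u),
      jacobian_kernel (f ustar) = tensor_perp1 vstar,
      forall us Zs, bifurcation_branch f ustar us Zs ->
        tangent_to (jacobian_kernel (f ustar)) Zs &
      exists us Zs vax,
        [/\ bifurcation_branch f ustar us Zs, perp1 vax, vax != 0 &
            tangent_to (line (vstar *m vax)) Zs]].

(* In one neighborhood of (ustar, 0), the points of all branches satisfy P. *)
Definition branches_made_of (R : realType) (Na No : nat)
    (f : R -> 'M[R]_(Na, No) -> 'M[R]_(Na, No)) (ustar : R)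
    (P : 'M[R]_(Na, No) -> Prop) : Prop :=
  exists2 r : R, 0 < r &
    forall us Zs, bifurcation_branch f ustar us Zs ->
      forall s, 0 < s < 1 -> `|us s - ustar| < r -> `|Zs s| < r -> P (Zs s).

(* If A v = lambda v and x is in 1^perp, the second-order part at 0 of agent
   i's component of the vector field, evaluated at v (x) x, is
     u/2 ((alpha + gamma lambda)^2 S1''(0) - (beta + delta lambda)^2 S2''(0))
       v_i^2 P_0 (x_1^2, ..., x_No^2).
   The condition says that it does not vanish identically on the kernel.  It
   is a genericity condition: it can fail although S1''(0) and S2''(0) are
   nonzero. *)
Definition quadratically_nondegenerate (R : realType)
    (alpha beta gamma delta : R) (S1 S2 : R -> R) (lambda : R) : Prop :=
  (alpha + gamma * lambda) ^+ 2 * derive1n 2 S1 0 !=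
  (beta + delta * lambda) ^+ 2 * derive1n 2 S2 0.

(** * Spectrum of the adjacency matrix *)

Definition complex_eigenvalue (R : realType) (n : nat) (A : 'M[R]_n)
    (xi : R[i]) : Prop :=
  eigenvalue (map_mx (real_complex R) A) xi.

Definition right_eigenvector (R : realType) (n : nat) (A : 'M[R]_n)
    (lambda : R) (v : 'cV[R]_n) : Prop :=
  v != 0 /\ A *m v = lambda *: v.

Definition largest_real_part (R : realType) (n : nat) (A : 'M[R]_n)
    (lambda : R) : Prop :=
  eigenvalue A lambda /\
  forall xi, complex_eigenvalue A xi -> complex.Re xi <= lambda.

Definition smallest_real_part (R : realType) (n : nat) (A : 'M[R]_n)
    (lambda : R) : Prop :=
  eigenvalue A lambda /\
  forall xi, complex_eigenvalue A xi -> lambda <= complex.Re xi.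

Definition simple_eigenvalue (R : realType) (n : nat) (A : 'M[R]_n)
    (lambda : R) : Prop :=
  mup lambda (char_poly A) = 1%N.

Definition mixed_sign (R : realType) (n : nat) (v : 'cV[R]_n) : Prop :=
  (exists i, 0 < v i ord0) /\ (exists k, v k ord0 < 0).

(* Main.v *)
Require Import Defs.
From HB Require Import structures.
From mathcomp Require Import all_boot all_order all_algebra.
From mathcomp Require Import complex.
From mathcomp Require Import all_classical all_reals all_analysis.
From mathcomp Require Import ring lra.

Set Implicit Arguments.
Unset Strict Implicit.
Unset Printing Implicit Defensive.

Import Order.TTheory GRing.Theory Num.Theory.
Import numFieldNormedType.Exports.

Local Open Scope classical_set_scope.
Local Open Scope ring_scope.

(** In F_ij the sum over the options other than j is the sum over all options
    minus the term of j, and the full sum does not depend on j, so P_0 kills it.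
    On V the field is therefore P_0 applied to - d Z + u Gam(Z), where one map
    Gam = [response] acts on every column of Z ([opinion_fieldE]), and its
    linearization at 0 multiplies Z from the left by - d + u (a + M), with
    a = alpha - beta and M = (gamma - delta) A.  If mu is the eigenvalue of M with
    largest real part, which is (gamma - delta) lmax for cooperative agents and
    (gamma - delta) lmin for competitive ones, then u* = d / (a + mu) is where the
    growth rate - d + u (a + mu) changes sign.

    The spectral information enters through [dominated]: right and left
    eigenvectors v, w of M for mu, and a quadratic form |T x|^2 along which M grows
    at a rate at most mu' < mu.  For cooperative agents v and w are positive, the
    quadratic form of M is, in suitable coordinates, mu |y|^2 minus a Dirichlet
    form of the graph, and strong connectedness bounds that form from below
    ([perron_dominated]).  For competitive agents the simple eigenvalue is removed
    by a deflation and the form comes from a rescaled Schur form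
    ([opposite_dominated]).

    The energies |w Z|^2 and |T Z|^2 then decide stability: their sum decays below
    u* ([neutral_stable]), and above u* their difference grows exponentially along
    a solution starting on the kernel ([neutral_unstable]).  At u* the kernel of
    the Jacobian consists of the v (x) x ([kernel_at_critical]), and every
    equilibrium near (u*, 0) is v (x) w Z up to o(|Z|) ([equilibria_near_kernel]).
    States in which one option is set against all others, which are treated alike,
    form an invariant problem whose kernel is a line; a blow-up and a contraction
    give a branch there ([bifurcation_branch_exists]).

    It remains to read off signs.  If v has entries of both signs, so has the
    column of Z in which |w Z| is largest ([disagreement_near_kernel]).  If v is
    positive, each column of Z has the sign of the corresponding x_j, x = w Z,
    unless |x_j| is small compared with |Z|.  This is clear when the branch is
    tangent to a line whose options all have nonzero weight
    ([tangent_line_agreement]).  In general, pairing the equation with w gives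
      D x_j + u q (x_j^2 - mean of the x_l^2) = o(|x|^2)
    with the same D for all j, and q nonzero by the nondegeneracy condition: the
    largest component shows that D = O(|x|), and then a small x_j would contradict
    mean >= |x|^2 / No ([components_comparable]). *)

(** * Auxiliary facts on real matrices with the sup norm *)

Lemma sgr_close (R : realDomainType) (y z : R) :
  `|z - y| < `|y| -> Num.sg z = Num.sg y.
Proof.
have [yp|yn|yE] := ltgtP 0 y.
- rewrite (gtr0_norm yp) ltr_norml => /andP[h _].
  by rewrite !gtr0_sg//; move: h; rewrite ltrBrDr addNr.
- rewrite (ltr0_norm yn) ltr_norml => /andP[_ h].
  by rewrite !ltr0_sg//; move: h; rewrite ltrBlDr addNr.
by rewrite -yE normr0 normr_lt0.
Qed.

Lemma pos_lower_bound (R : realFieldType) (I : finType) (f : I -> R) :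
  (forall i, 0 < f i) -> exists2 m, 0 < m & forall i, m <= f i.
Proof.
move=> f0; have s0 : 0 <= \sum_i (f i)^-1.
  by apply: sumr_ge0 => i _; rewrite invr_ge0 ltW.
exists (\sum_i (f i)^-1 + 1)^-1 => [|i]; first by rewrite invr_gt0 ltr_wpDl.
rewrite -[leRHS]invrK lef_pV2 ?posrE ?ltr_wpDl ?invr_gt0//.
rewrite (bigD1 i)//= -addrA lerDl addr_ge0//.
by apply: sumr_ge0 => j _; rewrite invr_ge0 ltW.
Qed.

Section MatrixNorm.
Context {R : realType}.

Lemma ler_mx_entry m n (X : 'M[R]_(m, n)) i j : `|X i j| <= `|X|.
Proof.
by rewrite [leRHS]/Num.Def.normr/= mx_normrE; exact: (le_bigmax _ _ (i, j)).
Qed.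

Lemma mx_norm_ler m n (X : 'M[R]_(m, n)) e :
  0 <= e -> (forall i j, `|X i j| <= e) -> `|X| <= e.
Proof.
move=> e0 Xe; rewrite [leLHS]/Num.Def.normr/= mx_normrE.
by apply: bigmax_le => // -[i j] _; exact: Xe.
Qed.

Lemma ler_mx_normM m n p (X : 'M[R]_(m, n)) (Y : 'M[R]_(n, p)) :
  `|X *m Y| <= n%:R * `|X| * `|Y|.
Proof.
apply: mx_norm_ler => [|i j]; first by rewrite !mulr_ge0.
rewrite mxE (le_trans (ler_norm_sum _ _ _))//.
rewrite (@le_trans _ _ (\sum_(k < n) `|X| * `|Y|))//.
  by apply: ler_sum => k _; rewrite normrM ler_pM// ler_mx_entry.
by rewrite sumr_const card_ord -mulrA mulr_natl.
Qed.

Lemma mx_norm_attained m n (X : 'M[R]_(m, n)) :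
  X != 0 -> exists ij, `|X| = `|X ij.1 ij.2|.
Proof.
move=> X0; apply: mx_norm_neq0; apply: contra_neq X0 => /mx_norm_eq0; exact.
Qed.

Lemma cts_mx m n (f : R -> 'M[R]_(m, n)) :
  (forall i j, continuous (fun t => f t i j)) -> continuous f.
Proof.
move=> fc t; apply/cvgrPdist_le => /= e e0; near=> s.
rewrite [leLHS]/Num.Def.normr/= mx_normrE (bigmax_le _ (ltW e0))// => ij _.
rewrite !mxE; move: ij; near: s; apply: filter_forall => /= ij.
exact: ((cvgrPdist_le _ _).1 (fc ij.1 ij.2 t)).
Unshelve. all: by end_near. Qed.

Lemma cts_entry (T : topologicalType) m n (f : T -> 'M[R]_(m, n)) i j :
  continuous f -> continuous (fun t => f t i j).
Proof.
move=> fc t; apply: (@continuous_comp _ _ _ f (fun M : 'M[R]_(m, n) => M i j)).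
  exact: fc.
exact: coord_continuous.
Qed.

Lemma is_derive_entry m n (Z : R -> 'M[R]_(m, n)) t D i j :
  is_derive t (1 : R) Z D -> is_derive t (1 : R) (fun s => Z s i j) (D i j).
Proof.
move=> dZ; have dv := @ex_derive _ _ _ _ _ _ _ dZ.
apply: DeriveDef; first by move/derivable_mxP : dv; exact.
by have := @derive_val _ _ _ _ _ _ _ dZ; rewrite derive_mx// => <-; rewrite mxE.
Qed.

Lemma is_derive_mx m n (Z : R -> 'M[R]_(m, n)) (t : R) (D : 'M[R]_(m, n)) :
  (forall i j, is_derive t (1 : R) (fun s => Z s i j) (D i j)) ->
  is_derive t (1 : R) Z D.
Proof.
move=> dZ; have dv : derivable Z t (1 : R).
  by apply/derivable_mxP => i j; exact: (@ex_derive _ _ _ _ _ _ _ (dZ i j)).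
apply: DeriveDef => //; rewrite derive_mx//; apply/matrixP => i j; rewrite mxE.
exact: (@derive_val _ _ _ _ _ _ _ (dZ i j)).
Qed.

End MatrixNorm.

Lemma is_derive_continuous (R : realType) (W : normedModType R)
    (f : R -> W) (x : R) (df : W) :
  is_derive x (1 : R) f df -> {for x, continuous f}.
Proof.
move=> dfx; have /derivable1_diffP := @ex_derive _ _ _ _ _ _ _ dfx.
exact: differentiable_continuous.
Qed.

(** * Differential inequalities *)

Section DifferentialInequalities.
Context {R : realType}.
Implicit Types (phi dphi : R -> R) (T t : R).

Lemma derive_le0_le phi dphi T : 0 <= T ->
  {within `[0, T], continuous phi} ->
  (forall t, 0 < t < T -> is_derive t (1 : R) phi (dphi t)) ->
  (forall t, 0 < t < T -> dphi t <= 0) -> phi T <= phi 0.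
Proof.
rewrite le_eqVlt => /predU1P[<- //|T0] cphi dphiE dphi0.
have dphi_itv t : t \in `]0, T[%R -> is_derive t (1 : R) phi (dphi t).
  by rewrite in_itv/=; exact: dphiE.
have [c] := MVT T0 dphi_itv cphi.
rewrite in_itv/= subr0 => /dphi0 dc eqT; rewrite -subr_le0 eqT.
by rewrite mulr_le0_ge0// ltW.
Qed.

(** The function phi(t) exp (- k t) is nonincreasing. *)
Lemma gronwall phi dphi k T : 0 <= T ->
  {within `[0, +oo[, continuous phi} ->
  (forall t, 0 < t -> is_derive t (1 : R) phi (dphi t)) ->
  (forall t, 0 < t < T -> dphi t <= k * phi t) ->
  phi T <= phi 0 * expR (k * T).
Proof.
move=> T0 cphi dphiE dphik.
pose psi t := phi t * expR (- k * t).
have dexp t : is_derive t (1 : R) (fun s => expR (- k * s))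
    (- k * expR (- k * t)).
  have d1 : is_derive t (1 : R) (fun s => - k * s) (- k).
    by apply: is_derive_eq; rewrite /GRing.scale/= mulr1.
  by have := is_derive1_comp (is_derive_expR (- k * t)) d1; rewrite mulrC.
suff : psi T <= psi 0.
  rewrite /psi mulr0 expR0 mulr1 mulNr expRN ler_pdivrMr ?expR_gt0//.
apply: (@derive_le0_le psi
  (fun t => dphi t * expR (- k * t) + phi t * (- k * expR (- k * t))) T T0).
- apply/subspace_continuousP => t t0T; apply: cvgM.
    have /subspace_continuousP : {within `[0, T], continuous phi}.
      apply: continuous_subspaceW cphi => s /=.
      by rewrite !in_itv/= => /andP[->].
    exact.
  by apply: cvg_within_filter; exact: (is_derive_continuous (dexp t)).
- move=> t /andP[t0 _]; have := dphiE t t0 => dphit.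
  have dt := dexp t.
  by apply: is_derive_eq; rewrite /GRing.scale/= mulrC addrC; congr (_ + _);
     rewrite mulrC.
- move=> t tT; rewrite mulrA -mulrDl mulr_le0_ge0 ?expR_ge0//.
  by rewrite mulrN [phi t * k]mulrC subr_le0; exact: dphik.
Qed.

(** The bad times are closed, so a first one, their infimum, would exist; the
    implication excludes it, and continuity keeps the bound a little beyond. *)
Lemma bootstrap_lt phi w : {within `[0, +oo[, continuous phi} ->
  (forall T, 0 <= T -> (forall t, 0 <= t < T -> phi t < w) -> phi T < w) ->
  forall t, 0 <= t -> phi t < w.
Proof.
move=> cphi step T T0; rewrite ltNge; apply/negP => wT.
pose B := [set t | 0 <= t <= T /\ w <= phi t].
have B0 : B !=set0 by exists T; rewrite /B/= T0 lexx.
have lB : has_lbound B by exists 0 => t [/andP[]].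
have hB : has_inf B by [].
have i0 : 0 <= inf B by apply: lb_le_inf => // t [/andP[]].
have iT : inf B <= T by apply: ge_inf => //; rewrite /B/= T0 lexx.
have below t : 0 <= t < inf B -> phi t < w.
  move=> /andP[t0 ti]; rewrite ltNge; apply/negP => wt.
  have : inf B <= t.
    by apply: ge_inf => //; split => //; rewrite t0/= (le_trans (ltW ti)).
  by rewrite leNgt ti.
have := step _ i0 below => phii.
(* By continuity the strict bound persists to the right of inf B, where bad
   times accumulate. *)
have /subspace_continuousP/(_ (inf B)) := cphi.
rewrite /= in_itv/= andbT => /(_ i0)/cvgrPdist_lt/(_ (w - phi (inf B))).
rewrite subr_gt0 => /(_ phii); rewrite near_withinE => -[e /= e0 He].
have [t [/andP[t0 tT] wt] ti] := inf_adherent e0 hB.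
have it : inf B <= t by apply: ge_inf => //; split => //; rewrite t0.
have := He t; rewrite /ball_/= in_itv/= t0 distrC ger0_norm ?subr_ge0//.
rewrite ltrBlDl => /(_ ti isT); rewrite ltr_norml => /andP[+ _].
by rewrite opprB ltrD2l ltrN2 ltNge wt.
Qed.

Lemma expR_ub_false (k c b : R) : 0 < k -> 0 < c ->
  (forall t, 0 <= t -> c * expR (k * t) <= b) -> False.
Proof.
move=> k0 c0 bd; have b0 : 0 < b.
  by have := bd 0 (lexx _); rewrite mulr0 expR0 mulr1; exact: lt_le_trans.
have := bd (b / (c * k)) (divr_ge0 (ltW b0) (mulr_ge0 (ltW c0) (ltW k0))).
apply/negP; rewrite -ltNge.
apply: (@lt_le_trans _ _ (c * (1 + k * (b / (c * k))))).
  have -> : c * (1 + k * (b / (c * k))) = c + b.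
    by field; rewrite !gt_eqF.
  by rewrite ltrDr.
by rewrite ler_pM2l// expR_ge1Dx.
Qed.

End DifferentialInequalities.

(** * Global solutions of Lipschitz differential equations *)

Section GeometricLimit.
Context {R : realType}.

Lemma half_pow_small (c e : R) : 0 < e -> exists n, c * 2^-1 ^+ n < e.
Proof.
move=> e0; have [c0|c0] := leP c 0.
  by exists 0; rewrite expr0 mulr1 (le_lt_trans c0).
have h : `|2^-1 : R| < 1 by rewrite ger0_norm ?invr_ge0// invf_lt1// ltr1n.
have /cvgrPdist_lt/(_ (e / c)) := cvg_expr h.
rewrite divr_gt0// => /(_ isT)[N _ /(_ N (leqnn N))]/=.
rewrite sub0r normrN ger0_norm ?exprn_ge0 ?invr_ge0// => H.
by exists N; rewrite mulrC -ltr_pdivlMr.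
Qed.

Lemma geometric_limit (T : Type) m n (h : nat -> T -> 'M[R]_(m, n))
    (K : T -> R) :
  (forall k t, `|h k.+1 t - h k t| <= K t * 2^-1 ^+ k) ->
  exists l, forall k t, `|l t - h k t| <= 2 * K t * 2^-1 ^+ k.
Proof.
move=> hK; suff H t : exists l, forall k, `|l - h k t| <= 2 * K t * 2^-1 ^+ k.
  by exists (fun t => sval (cid (H t))) => k t; exact: (svalP (cid (H t))).
have K0 : 0 <= K t by have := le_trans (normr_ge0 _) (hK 0%N t); rewrite expr0 mulr1.
have hp k p : `|h (k + p)%N t - h k t| <= 2 * K t * 2^-1 ^+ k.
  apply: (@le_trans _ _ (2 * K t * (2^-1 ^+ k - 2^-1 ^+ (k + p)%N))); last first.
    rewrite ler_wpM2l// ?mulr_ge0// gerBl exprn_ge0// invr_ge0//.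
  elim: p => [|p IH]; first by rewrite addn0 !subrr normr0 mulr0.
  rewrite addnS -(subrKA (h (k + p)%N t)) (le_trans (ler_normD _ _))//.
  apply: (le_trans (lerD (hK _ _) IH)); rewrite exprS le_eqVlt; apply/orP; left.
  by apply/eqP; field.
have cau : cauchy ((fun k => h k t) @ \oo).
  apply: cauchy_exP => e e0; have [N HN] := half_pow_small (2 * K t) e0.
  exists (h N t); exists N => // k /= Nk; rewrite -ball_normE/= distrC.
  by rewrite -(subnKC Nk) (le_lt_trans (hp _ _)).
have hl : (fun k => h k t) @ \oo --> lim ((fun k => h k t) @ \oo).
  exact/cauchy_cvgP.
exists (lim ((fun k => h k t) @ \oo)) => k; apply/ler_addgt0Pl => e e0.
have /cvgrPdist_lt/(_ e e0)[N _ HN] := hl.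
have := HN (k + N)%N (leq_addl _ _) => /= lN.
by rewrite -(subrKA (h (k + N)%N t)) (le_trans (ler_normD _ _))// lerD// ltW.
Qed.

End GeometricLimit.

Section Picard.
Context {R : realType}.

(** Integrating from -1 makes the derivative at 0, the initial time, two-sided. *)
Lemma continuous_primitive (g : R -> R) : continuous g ->
  exists2 G : R -> R, G 0 = 0 &
    forall t : R, -1 < t -> is_derive t (1 : R) G (g t).
Proof.
move=> cg; pose mu := @lebesgue_measure R.
pose F (x : R) := (\int[mu]_(t in [set` `[-1, x]]) g t)%R.
have dF (t : R) : -1 < t -> is_derive t (1 : R) F (g t).
  move=> t1; have tt : t < t + 1 by rewrite ltrDl.
  have intg : mu.-integrable `[-1, t + 1] (EFin \o g).
    apply: continuous_compact_integrable; first exact: segment_compact.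
    exact: continuous_subspaceT.
  have [dv dvE] := continuous_FTC1_closed tt intg t1 (cg t).
  by apply: (DeriveDef dv); rewrite -derive1E.
exists (fun t => F t - F 0); first by rewrite subrr.
move=> t t1; have dFt := dF t t1.
by apply: is_derive_eq; rewrite subr0.
Qed.

Lemma continuous_primitive_mx m n (g : R -> 'M[R]_(m, n)) (Z0 : 'M[R]_(m, n)) :
  continuous g -> exists2 G : R -> 'M[R]_(m, n), G 0 = Z0 &
    forall t : R, -1 < t -> is_derive t (1 : R) G (g t).
Proof.
move=> cg.
have H i j := continuous_primitive (cts_entry (i := i) (j := j) cg).
pose G i j := sval (cid2 (H i j)).
have G0 i j : G i j 0 = 0 by rewrite /G; case: cid2.
have dG i j (t : R) : -1 < t -> is_derive t (1 : R) (G i j) (g t i j).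
  by rewrite /G; case: cid2 => x /= _; exact.
exists (fun t => \matrix_(i, j) G i j t + Z0).
  by apply/matrixP => i j; rewrite !mxE G0 add0r.
move=> t t1; apply: is_derive_mx => i j; have dGt := dG i j t t1.
rewrite (_ : (fun s => _) = (fun s => G i j s + Z0 i j)); last first.
  by apply/funext => s; rewrite !mxE.
by apply: is_derive_eq; rewrite addr0.
Qed.

(** In the norm with weight exp (- k t) integration from 0 shrinks by 1 / k; this
    holds for all times at once. *)
Lemma expR_derive_bound m n (X D : R -> 'M[R]_(m, n)) (c k : R) :
  X 0 = 0 -> (forall t : R, 0 <= t -> is_derive t (1 : R) X (D t)) ->
  0 <= c -> 0 < k -> (forall t, 0 <= t -> `|D t| <= k * (c * expR (k * t))) ->
  forall t, 0 <= t -> `|X t| <= c * expR (k * t).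
Proof.
move=> X0 dX c0 k0 Dk t t0; apply: mx_norm_ler => [|i j].
  by rewrite mulr_ge0// expR_ge0.
have dE (s : R) : is_derive s (1 : R) (fun s => c * expR (k * s))
    (k * (c * expR (k * s))).
  have d1 : is_derive s (1 : R) (fun s => k * s) k.
    by apply: is_derive_eq; rewrite /GRing.scale/= mulr1.
  have d2 := is_derive1_comp (is_derive_expR (k * s)) d1.
  by apply: is_derive_eq; rewrite /GRing.scale/=; ring.
suff H (e : R) : `|e| = 1 -> e * X t i j <= c * expR (k * t).
  by rewrite ler_norml lerNl; apply/andP; split;
    [rewrite -mulN1r H// normrN1|rewrite -[leLHS]mul1r H// normr1].
move=> e1; pose psi (s : R) := e * X s i j - c * expR (k * s).
have dpsi (s : R) : 0 <= s ->
    is_derive s (1 : R) psi (e * D s i j - k * (c * expR (k * s))).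
  move=> s0; have d1 := is_derive_entry i j (dX s s0).
  have d2 := dE s.
  by apply: is_derive_eq.
have : psi t <= psi 0.
  apply: (derive_le0_le (phi := psi) t0
    (dphi := fun s => e * D s i j - k * (c * expR (k * s)))); last first.
  - move=> s /andP[/ltW s0 _]; rewrite subr_le0 (le_trans _ (Dk s s0))//.
    rewrite (le_trans (ler_norm _))// normrM e1 mul1r; exact: ler_mx_entry.
  - by move=> s /andP[/ltW s0 _]; exact: dpsi.
  apply: derivable_within_continuous => s; rewrite in_itv/= => /andP[s0 _].
  exact: (@ex_derive _ _ _ _ _ _ _ (dpsi s s0)).
rewrite /psi X0 mxE mulr0 sub0r mulr0 expR0 mulr1 lerBlDr => /le_trans; apply.
by rewrite gerDr oppr_le0.
Qed.

End Picard.

Section PicardLindelof.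
Context {R : realType}.

Lemma lipschitz_cts (V W : normedModType R) (F : V -> W) (L : R) :
  0 < L -> (forall X Y, `|F X - F Y| <= L * `|X - Y|) -> continuous F.
Proof.
move=> L0 FL X; apply/cvgrPdist_lt => e e0.
apply/nbhs_ballP; exists (e / L); first exact: divr_gt0.
move=> Y; rewrite -ball_normE/= => XY.
by rewrite (le_lt_trans (FL _ _))// mulrC -ltr_pdivlMr.
Qed.

Lemma locally_uniform_limit_cts (T : topologicalType) m n
    (h : nat -> T -> 'M[R]_(m, n)) (l : T -> 'M[R]_(m, n)) (K : T -> R) :
  continuous K -> (forall k, continuous (h k)) ->
  (forall k t, `|l t - h k t| <= K t * 2^-1 ^+ k) -> continuous l.
Proof.
move=> cK ch hl t; apply/cvgrPdist_lt => e e0.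
have e3 : 0 < e / 3 by rewrite divr_gt0.
have [N HN] := half_pow_small (K t + 1) e3.
have bound s : K s < K t + 1 -> `|l s - h N s| < e / 3.
  move=> Ks; apply: le_lt_trans HN; apply: (le_trans (hl N s)).
  by rewrite ler_wpM2r ?exprn_ge0 ?invr_ge0// ltW.
near=> s; rewrite -(subrKA (h N t)) (le_lt_trans (ler_normD _ _))//.
rewrite (_ : e = e / 3 + (e / 3 + e / 3)); last by field.
rewrite ltrD ?bound ?ltrDl//.
rewrite -(subrKA (h N s)) (le_lt_trans (ler_normD _ _))//.
rewrite ltrD//; last first.
  rewrite distrC bound// -ltrBlDl.
  apply: le_lt_trans (_ : `|K t - K s| < 1); first by rewrite distrC ler_norm.
  by near: s; exact: (cvgrPdist_lt _ _).1 (cK t) _ ltr01.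
by near: s; exact: (cvgrPdist_lt _ _).1 (ch N t) _ e3.
Unshelve. all: by end_near. Qed.

(** With the weight exp (- 2 L t) the Picard operator contracts by 1/2, so the
    iterates converge locally uniformly on the whole half-line and the solution is
    global.  Negative times are clamped to 0 by [pos], so that iterates are
    continuous functions on R. *)
Theorem picard_lindelof m n (F : 'M[R]_(m, n) -> 'M[R]_(m, n)) (L : R)
    (Z0 : 'M[R]_(m, n)) :
  0 < L -> (forall X Y, `|F X - F Y| <= L * `|X - Y|) ->
  exists2 Z : R -> 'M[R]_(m, n), Z 0 = Z0 &
    forall t : R, 0 <= t -> is_derive t (1 : R) Z (F (Z t)).
Proof.
move=> L0 FL; have cF := lipschitz_cts L0 FL.
pose pos (t : R) := Num.max t 0.
have cpos : continuous pos.
  by move=> t; apply: continuous_max; [exact: cvg_id|exact: cvg_cst].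
have pos_ge0 t : 0 <= pos t by rewrite /pos le_max lexx orbT.
have pos_id t : 0 <= t -> pos t = t by move=> t0; rewrite /pos max_l.
have prim (Y : {Y : R -> 'M[R]_(m, n) | continuous Y}) :
    exists2 X : R -> 'M[R]_(m, n), X 0 = Z0 &
      forall t : R, -1 < t -> is_derive t (1 : R) X (F (sval Y t)).
  apply: (continuous_primitive_mx (g := fun t => F (sval Y t)) Z0).
  by move=> t; apply: (@continuous_comp _ _ _ (sval Y) F); [exact: (svalP Y)|exact: cF].
have cX (X : R -> 'M[R]_(m, n)) (D : R -> 'M[R]_(m, n)) :
    (forall t : R, -1 < t -> is_derive t (1 : R) X (D t)) ->
    continuous (fun t => X (pos t)).
  move=> dX t; apply: (@continuous_comp _ _ _ pos X); first exact: cpos.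
  apply: is_derive_continuous (dX _ _).
  by rewrite (lt_le_trans _ (pos_ge0 t)).
pose X Y := sval (cid2 (prim Y)).
have X0 Y : X Y 0 = Z0 by rewrite /X; case: cid2.
have dX Y (t : R) : -1 < t -> is_derive t (1 : R) (X Y) (F (sval Y t)).
  by rewrite /X; case: cid2 => x /= _; exact.
pose next Y : {Y : R -> 'M[R]_(m, n) | continuous Y} :=
  exist _ (fun t => X Y (pos t)) (cX _ _ (dX Y)).
have cst_cts : continuous (fun _ : R => Z0) by move=> t; exact: cvg_cst.
pose Y0 : {Y : R -> 'M[R]_(m, n) | continuous Y} := exist _ _ cst_cts.
pose Ys k := iter k next Y0; pose h k := sval (Ys k).
pose k2 := 2 * L; pose c := `|F Z0| / k2; pose K t := c * expR (k2 * pos t).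
have k20 : 0 < k2 by rewrite mulr_gt0.
have c0 : 0 <= c by rewrite divr_ge0// ltW.
have K0 t : 0 <= K t by rewrite mulr_ge0// expR_ge0.
have ge0_gtN1 (t : R) : 0 <= t -> -1 < t by move=> t0; rewrite (lt_le_trans _ t0).
have hK k t : `|h k.+1 t - h k t| <= K t * 2^-1 ^+ k.
  elim: k t => [|k IH] t.
    rewrite expr0 mulr1 /h/= /K.
    apply: (expR_derive_bound (X := fun t => X Y0 t - Z0) (D := fun=> F Z0)) => //.
    - by rewrite X0 subrr.
    - move=> s s0; have d1 := dX Y0 s (ge0_gtN1 s s0).
      by apply: is_derive_eq; rewrite subr0.
    move=> s s0; rewrite mulrA [k2 * c]mulrC divfK ?gt_eqF// ler_peMr//.
    by rewrite (le_trans _ (expR_ge1Dx _))// lerDl mulr_ge0// ltW.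
  rewrite /K mulrAC; set cc := c * _.
  apply: (expR_derive_bound (X := fun t => X (Ys k.+1) t - X (Ys k) t)
     (D := fun t => F (h k.+1 t) - F (h k t))) => //.
  - by rewrite !X0 subrr.
  - move=> s s0; have d1 := dX (Ys k.+1) s (ge0_gtN1 s s0).
    have d2 := dX (Ys k) s (ge0_gtN1 s s0).
    by apply: is_derive_eq.
  - by rewrite mulr_ge0// exprn_ge0// invr_ge0.
  move=> s s0; apply: (le_trans (FL _ _)).
  apply: (@le_trans _ _ (L * (K s * 2^-1 ^+ k))); first by rewrite ler_pM2l.
  rewrite /K pos_id// /cc /k2 exprS le_eqVlt; apply/orP; left; apply/eqP.
  by field.
have [Y HY] := geometric_limit hK.
have cK : continuous (fun t => 2 * K t).
  move=> t; apply: cvgM; first exact: cvg_cst.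
  apply: cvgM; first exact: cvg_cst.
  apply: (@continuous_comp _ _ _ (fun t => k2 * pos t) expR).
    by apply: cvgM; [exact: cvg_cst|exact: cpos].
  exact: continuous_expR.
have cY : continuous Y.
  by apply: (locally_uniform_limit_cts cK) HY => k; exact: (svalP (Ys k)).
pose Yl : {Y : R -> 'M[R]_(m, n) | continuous Y} := exist _ Y cY.
have XY t : 0 <= t -> X Yl t = Y t.
  move=> t0; apply/eqP; rewrite -subr_eq0 -normr_le0.
  apply/ler_addgt0Pl => e e0; rewrite addr0.
  have [N HN] := half_pow_small (2 * K t) e0; apply: le_trans (ltW HN).
  rewrite -(subrKA (X (Ys N) t)) (le_trans (ler_normD _ _))//.
  rewrite -mulrA mulr2n mulrDl mul1r lerD//; last first.
    have := HY N.+1 t; rewrite distrC /h/= pos_id// exprS.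
    by move/le_trans; apply; rewrite le_eqVlt; apply/orP; left; apply/eqP; field.
  rewrite /K pos_id// mulrAC; set cc := c * _.
  apply: (expR_derive_bound (X := fun t => X Yl t - X (Ys N) t)
     (D := fun t => F (Y t) - F (h N t))) => //.
  - by rewrite !X0 subrr.
  - move=> s s0; have d1 := dX Yl s (ge0_gtN1 s s0).
    have d2 := dX (Ys N) s (ge0_gtN1 s s0).
    by apply: is_derive_eq.
  - by rewrite mulr_ge0// exprn_ge0// invr_ge0.
  move=> s s0; apply: (le_trans (FL _ _)).
  apply: (@le_trans _ _ (L * (2 * K s * 2^-1 ^+ N))); first by rewrite ler_pM2l.
  rewrite /K pos_id// /cc /k2 le_eqVlt; apply/orP; left; apply/eqP.
  by field.
exists (X Yl) => // t t0; rewrite XY//; exact: dX (ge0_gtN1 t t0).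
Qed.

End PicardLindelof.

(** * Sigmoidal functions *)

Section Sigmoid.
Context {R : realType}.
Implicit Types (S f df : R -> R) (x y r B e : R).

Lemma lipschitz_from_derivative f df r k :
  (forall x : R, is_derive x (1 : R) f (df x)) ->
  (forall x, `|x| <= r -> `|df x| <= k) ->
  forall x y, `|x| <= r -> `|y| <= r -> `|f x - f y| <= k * `|x - y|.
Proof.
move=> dfE dfk.
suff H x y : x <= y -> `|x| <= r -> `|y| <= r -> `|f x - f y| <= k * `|x - y|.
  move=> x y xr yr; have [xy|yx] := leP x y; first exact: H.
  by rewrite distrC [`|x - y|]distrC; apply: H => //; exact: ltW.
move=> xy xr yr; have dE z : z \in `]x, y[%R -> is_derive z (1 : R) f (df z) by [].
have cf : {within `[x, y], continuous f}.
  by apply: continuous_subspaceT => z; exact: is_derive_continuous (dfE z).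
have [c] := MVT_segment xy dE cf; rewrite in_itv/= => /andP[xc cy] fE.
rewrite distrC fE normrM [`|y - x|]distrC ler_wpM2r// dfk//.
move: xr yr; rewrite !ler_norml => /andP[rx _] /andP[_ yr].
by rewrite (le_trans rx xc) (le_trans cy yr).
Qed.

Lemma derive_peano f x a : is_derive x (1 : R) f a -> forall e, 0 < e ->
  exists2 r, 0 < r & forall h, `|h| <= r -> `|f (x + h) - f x - a * h| <= e * `|h|.
Proof.
move=> dfx e e0; have /cvg_ex[l hl] := @ex_derive _ _ _ _ _ _ _ dfx.
have la : l = a.
  by rewrite -(@derive_val _ _ _ _ _ _ _ dfx); apply/esym/cvg_lim.
have /cvgrPdist_le/(_ e e0)[r /= r0 Hr] := hl.
exists (r / 2); first by rewrite divr_gt0.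
move=> h hr; have [->|h0] := eqVneq h 0.
  by rewrite addr0 mulr0 subr0 subrr normr0 mulr0.
have := Hr h; rewrite /ball_/= sub0r normrN => /(_ _ h0).
rewrite (le_lt_trans hr) ?ltr_pdivrMr ?ltr_pMr ?ltr1n// => /(_ isT).
rewrite la /GRing.scale/= mulr1 => H.
rewrite -ler_pdivrMr ?normr_gt0// -normfV -normrM; apply: le_trans H.
rewrite distrC (addrC h x) le_eqVlt; apply/orP; left; apply/eqP; congr `|_|.
by field.
Qed.

Lemma sigm_is_derive S n x : sigmoidal S -> (n < 3)%N ->
  is_derive x (1 : R) (derive1n n S) (derive1n n.+1 S x).
Proof.
move=> hS n3; apply: DeriveDef; first exact: (sigm_derivable hS).
by rewrite derive1nS derive1E.
Qed.

Lemma sigm_ctsn S n : sigmoidal S -> (n < 3)%N -> continuous (derive1n n S).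
Proof. by move=> hS n3 x; exact: is_derive_continuous (sigm_is_derive x hS n3). Qed.

(** S - id has derivative S' - 1, which is small near 0 by continuity. *)
Lemma sigm_strict_diff S : sigmoidal S -> forall e, 0 < e ->
  exists2 r, 0 < r & forall x y, `|x| <= r -> `|y| <= r ->
    `|(S x - S y) - (x - y)| <= e * `|x - y|.
Proof.
move=> hS e e0.
have /cvgrPdist_le/(_ e e0)[r /= r0 Hr] := @sigm_ctsn S 1 hS isT 0.
exists (r / 2); first by rewrite divr_gt0.
move=> x y xr yr; pose g z := S z - z.
have -> : S x - S y - (x - y) = g x - g y by rewrite /g; ring.
apply: (lipschitz_from_derivative (r := r / 2)
  (df := fun z => derive1n 1 S z - 1)) => //.
  move=> z; have := @sigm_is_derive S 0 z hS isT; rewrite derive1n0 => d1.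
  by apply: is_derive_eq.
move=> z zr; rewrite -(sigm_d1 hS) distrC; apply: Hr.
rewrite /ball_/= sub0r normrN (le_lt_trans zr)//.
by rewrite ltr_pdivrMr// ltr_pMr// ltr1n.
Qed.

(** The remainder vanishes at 0 and its derivative S'(x) - 1 - S''(0) x is o(x),
    by differentiability of S' at 0. *)
Lemma sigm_taylor2 S : sigmoidal S -> forall e, 0 < e ->
  exists2 r, 0 < r & forall x, `|x| <= r ->
    `|S x - x - derive1n 2 S 0 / 2 * x ^+ 2| <= e * `|x| ^+ 2.
Proof.
move=> hS e e0; set s2 := derive1n 2 S 0.
have [r r0 Hr] := derive_peano (@sigm_is_derive S 1 0 hS isT) e0.
exists r => // x xr; pose g z := S z - z - s2 / 2 * z ^+ 2.
have g0 : g 0 = 0 by rewrite /g (sigm_0 hS); ring.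
have dg (z : R) : is_derive z (1 : R) g (derive1n 1 S z - 1 - s2 * z).
  have := @sigm_is_derive S 0 z hS isT; rewrite derive1n0 => d1.
  by apply: is_derive_eq; rewrite /GRing.scale/=; field.
have bd (z : R) : `|z| <= `|x| -> `|derive1n 1 S z - 1 - s2 * z| <= e * `|x|.
  move=> zx; have := Hr z (le_trans zx xr).
  rewrite add0r (sigm_d1 hS) => /le_trans; apply.
  by rewrite ler_wpM2l// ltW.
have x0 : `|0 : R| <= `|x| by rewrite normr0.
have := lipschitz_from_derivative dg bd (lexx `|x|) x0.
by rewrite g0 !subr0 -[in X in X -> _]mulrA -[in X in X -> _]expr2.
Qed.

Lemma sigm_lipschitz S : sigmoidal S -> forall B, 0 <= B ->
  exists2 L, 0 < L & forall x y, `|x| <= B -> `|y| <= B ->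
    `|S x - S y| <= L * `|x - y|.
Proof.
move=> hS B B0; have BB : - B <= B by rewrite (le_trans _ B0)// oppr_le0.
have cS : {within `[- B, B], continuous (fun x => `|derive1n 1 S x|)}.
  apply: continuous_subspaceT => x; apply: cvg_norm.
  exact: (@sigm_ctsn S 1 hS isT x).
have [c _ Hc] := EVT_max BB cS.
exists (`|derive1n 1 S c| + 1); first by rewrite ltr_wpDl.
have dS (x : R) : is_derive x (1 : R) S (derive1n 1 S x).
  exact: (@sigm_is_derive S 0 x hS isT).
apply: (lipschitz_from_derivative dS) => x.
by rewrite ler_norml => xB; rewrite ler_wpDr//; apply: Hc; rewrite in_itv.
Qed.

Lemma sigm_abs_bounded S : sigmoidal S -> exists2 k, 0 < k & forall x, `|S x| <= k.
Proof.
move=> hS; have [k1 [k2 [k10 k20 Sk]]] := sigm_bounded hS.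
exists (k1 + k2); first exact: addr_gt0.
move=> x; have /andP[S1 S2] := Sk x; rewrite ler_norml; apply/andP; split.
  by rewrite (le_trans _ S1)// lerN2 lerDl ltW.
by rewrite (le_trans S2)// lerDr ltW.
Qed.

Definition clip B x := Num.max (- B) (Num.min B x).

Lemma clip_bound B x : 0 <= B -> `|clip B x| <= B.
Proof.
move=> B0; rewrite /clip ler_norml le_max lexx/= ge_max ge_min lexx/= andbT.
by rewrite (le_trans _ B0)// oppr_le0.
Qed.

Lemma clip_id B x : `|x| <= B -> clip B x = x.
Proof. by rewrite ler_norml => /andP[Bx xB]; rewrite /clip min_r// max_r. Qed.

Lemma clip_lipschitz B x y : `|clip B x - clip B y| <= `|x - y|.
Proof.
have xy := ler_norm (x - y); have yx := ler_norm (y - x).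
rewrite distrC in yx; rewrite /clip ler_norml.
have [?|?] := leP B x; have [?|?] := leP B y; have [?|?] := leP (- B) B;
  have [?|?] := leP (- B) x; have [?|?] := leP (- B) y;
  by apply/andP; split; lra.
Qed.

End Sigmoid.

(** * The opinion dynamics, column by column *)

Section Projection.
Context {R : realType} {No : nat}.

Lemma mul_proj1perp Na (X : 'M[R]_(Na, No)) i j :
  (X *m proj1perp R No) i j = X i j - No%:R^-1 * \sum_l X i l.
Proof.
rewrite mulmxBr mulmx1 -scalemxAr mulmxA !mxE big_ord1 !mxE mulr1.
congr (_ - _ * _); by apply: eq_bigr => l _; rewrite mxE mulr1.
Qed.

Lemma opinion_spaceP Na (Z : 'M[R]_(Na, No)) :
  opinion_space Z <-> forall i, \sum_j Z i j = 0.
Proof.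
split=> H i; have := H i; rewrite /perp1/=.
  by under eq_bigr do rewrite mxE.
by move=> Hi; rewrite -[RHS]Hi; apply: eq_bigr => j _; rewrite mxE.
Qed.

Lemma proj1perp_id Na (Z : 'M[R]_(Na, No)) : opinion_space Z -> Z *m proj1perp R No = Z.
Proof.
move/opinion_spaceP => H; apply/matrixP => i j.
by rewrite mul_proj1perp H mulr0 subr0.
Qed.

Lemma opinion_space_proj Na (X : 'M[R]_(Na, No)) : opinion_space (X *m proj1perp R No).
Proof.
apply/opinion_spaceP => i; under eq_bigr do rewrite mul_proj1perp.
rewrite sumrB sumr_const card_ord -mulrnAl -[_ *+ No]mulr_natr.
have [No0|No0] := posnP No; last first.
  by rewrite mulVf ?mul1r ?subrr// pnatr_eq0 -lt0n.
rewrite big1 ?mulr0 ?subr0// => j _.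
by have := ltn_ord j; rewrite [X in (_ < X)%N]No0.
Qed.

Lemma opinion_space_mull Na m (X : 'M[R]_(m, Na)) (Z : 'M[R]_(Na, No)) :
  opinion_space Z -> opinion_space (X *m Z).
Proof. by move=> /proj1perp_id <-; rewrite mulmxA; exact: opinion_space_proj. Qed.

End Projection.

Section Columnwise.
Context {R : realType} {n : nat}.
Implicit Types (Gam : 'cV[R]_n -> 'cV[R]_n).

Definition colwise p Gam (Z : 'M[R]_(n, p)) : 'M[R]_(n, p) :=
  \matrix_(i, j) Gam (col j Z) i ord0.

(** Strict differentiability at the fixed value 0, with derivative L: the part of
    C^1 smoothness that the energy and fixed-point estimates use. *)
Definition strict_diff0 Gam (L : 'M[R]_n) : Prop :=
  Gam 0 = 0 /\ forall e, 0 < e -> exists2 r, 0 < r & forall x y,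
    `|x| <= r -> `|y| <= r ->
    `|Gam x - Gam y - L *m (x - y)| <= e * `|x - y|.

(** [picard_lindelof] asks for a globally Lipschitz field.  The bound H is
    uniform in the level B, so solutions of the truncated equation satisfy an a
    priori bound that does not depend on B; a level above it leaves them
    unchanged. *)
Definition truncatable Gam : Prop :=
  exists2 H, 0 < H & forall B, 0 <= B -> exists GB : 'cV[R]_n -> 'cV[R]_n,
    [/\ exists2 L, 0 < L & forall x y, `|GB x - GB y| <= L * `|x - y|,
        forall x, `|GB x| <= H & forall x, `|x| <= B -> GB x = Gam x].

Lemma col_norm_le p (Z : 'M[R]_(n, p)) j : `|col j Z| <= `|Z|.
Proof. by apply: mx_norm_ler => // i k; rewrite mxE ler_mx_entry. Qed.

Lemma colwise_bound p Gam (Z : 'M[R]_(n, p)) b :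
  0 <= b -> (forall j, `|Gam (col j Z)| <= b) -> `|colwise Gam Z| <= b.
Proof.
move=> b0 Gb; apply: mx_norm_ler => // i j; rewrite mxE.
exact: le_trans (ler_mx_entry _ _ _) (Gb j).
Qed.

Lemma colwise_lipschitz p Gam L : 0 < L ->
  (forall x y, `|Gam x - Gam y| <= L * `|x - y|) ->
  forall X Y : 'M[R]_(n, p), `|colwise Gam X - colwise Gam Y| <= L * `|X - Y|.
Proof.
move=> L0 GL X Y; apply: mx_norm_ler => [|i j]; first by rewrite mulr_ge0// ltW.
have := ler_mx_entry (Gam (col j X) - Gam (col j Y)) i ord0.
rewrite !mxE => /le_trans; apply; apply: (le_trans (GL _ _)).
by rewrite ler_pM2l// -raddfB/= col_norm_le.
Qed.

Lemma colwise_strict_diff p Gam L : strict_diff0 Gam L ->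
  forall e, 0 < e -> exists2 r, 0 < r & forall X Y : 'M[R]_(n, p),
    `|X| <= r -> `|Y| <= r ->
    `|colwise Gam X - colwise Gam Y - L *m (X - Y)| <= e * `|X - Y|.
Proof.
move=> [_ GL] e e0; have [r r0 Hr] := GL e e0; exists r => // X Y Xr Yr.
apply: mx_norm_ler => [|i j]; first by rewrite mulr_ge0// ltW.
have := ler_mx_entry
  (Gam (col j X) - Gam (col j Y) - L *m (col j X - col j Y)) i ord0.
have -> : (Gam (col j X) - Gam (col j Y) - L *m (col j X - col j Y)) i ord0 =
  (colwise Gam X - colwise Gam Y - L *m (X - Y)) i j.
  rewrite (_ : L *m _ = col j (L *m (X - Y))); first by rewrite !mxE.
  by rewrite !colE -mulmxBl mulmxA.
move/le_trans; apply; apply: le_trans (Hr _ _ _ _) _.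
- exact: le_trans (col_norm_le _ _) Xr.
- exact: le_trans (col_norm_le _ _) Yr.
by rewrite ler_pM2l// -raddfB/= col_norm_le.
Qed.

Lemma colwise0 p Gam : Gam 0 = 0 -> colwise Gam (0 : 'M[R]_(n, p)) = 0.
Proof. by move=> G0; apply/matrixP => i j; rewrite !mxE raddf0 G0 mxE. Qed.

End Columnwise.

Section Response.
Context {R : realType} {n : nat}.
Variables (alpha beta gamma delta : R) (S1 S2 : R -> R) (A : 'M[R]_n).
Hypotheses (hS1 : sigmoidal S1) (hS2 : sigmoidal S2).

Definition response (x : 'cV[R]_n) : 'cV[R]_n :=
  map_mx S1 ((alpha%:M + gamma *: A) *m x) -
  map_mx S2 ((beta%:M + delta *: A) *m x).

Lemma affine_mul_entry p (a b : R) (Z : 'M[R]_(n, p)) i j :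
  (forall i, A i i = 0) ->
  ((a%:M + b *: A) *m col j Z) i ord0 =
  a * Z i j + b * \sum_(k | k != i) A i k * Z k j.
Proof.
move=> A0; rewrite mulmxDl mul_scalar_mx -scalemxAl !mxE (bigD1 i)//=.
rewrite A0 mul0r add0r; congr (_ + _ * _).
by apply: eq_bigr => k _; rewrite mxE.
Qed.

Lemma response_col p (Z : 'M[R]_(n, p)) i j : (forall i, A i i = 0) ->
  response (col j Z) i ord0 =
  S1 (alpha * Z i j + gamma * \sum_(k | k != i) A i k * Z k j) -
  S2 (beta * Z i j + delta * \sum_(k | k != i) A i k * Z k j).
Proof.
move=> A0; rewrite -!affine_mul_entry// /response.
by set X := _ *m _; set Y := _ *m _; rewrite !mxE.
Qed.

(** F_ij differs from the (i, j) entry of - d Z + u Gam(Z) by u times the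
    sum of the S_2-terms over all options, which is the same for every j and is killed by
    P_0. *)
Lemma opinion_fieldE No d u (Z : 'M[R]_(n, No)) : (forall i, A i i = 0) ->
  opinion_field d alpha beta gamma delta S1 S2 A u Z =
  (- d *: Z + u *: colwise response Z) *m proj1perp R No.
Proof.
move=> A0; rewrite /opinion_field; apply/matrixP => i j.
set W := (X in _ = (X *m _) i j); set F := opinion_F _ _ _ _ _ _ _ _ _ _.
pose c := u * \sum_l
  S2 (beta * Z i l + delta * \sum_(k | k != i) A i k * Z k l).
have FW l : F i l = W i l + c.
  have -> : W i l = - d * Z i l + u * response (col l Z) i ord0.
    by rewrite /W 3!mxE mxE.
  by rewrite response_col// /F mxE /c [X in _ = _ + u * X](bigD1 l)//=; ring.
rewrite !mul_proj1perp FW; under eq_bigr do rewrite FW.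
rewrite big_split/= sumr_const card_ord -[c *+ _]mulr_natl mulrDr mulrA mulVf.
  by rewrite mul1r opprD addrACA subrr addr0.
by rewrite pnatr_eq0 -lt0n (leq_ltn_trans _ (ltn_ord j)).
Qed.

Lemma map_sigm_strict_diff S (P : 'M[R]_n) : sigmoidal S ->
  forall e, 0 < e -> exists2 r, 0 < r & forall x y : 'cV[R]_n,
    `|x| <= r -> `|y| <= r ->
    `|map_mx S (P *m x) - map_mx S (P *m y) - P *m (x - y)| <= e * `|x - y|.
Proof.
move=> hS e e0; pose c := n%:R * `|P| + 1.
have c0 : 0 < c by rewrite ltr_wpDl// mulr_ge0.
have Pc (x : 'cV[R]_n) : `|P *m x| <= c * `|x|.
  by rewrite (le_trans (ler_mx_normM _ _))// ler_wpM2r// lerDl.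
have [r r0 Hr] := sigm_strict_diff hS (divr_gt0 e0 c0).
exists (r / c) => [|x y xr yr]; first exact: divr_gt0.
have Pr (z : 'cV[R]_n) i : `|z| <= r / c -> `|(P *m z) i ord0| <= r.
  move=> zrc; apply: (le_trans (ler_mx_entry _ _ _)); apply: (le_trans (Pc z)).
  by rewrite mulrC -ler_pdivlMr.
apply: mx_norm_ler => [|i j]; first by rewrite mulr_ge0// ltW.
rewrite mulmxBr ord1.
have := Hr ((P *m x) i ord0) ((P *m y) i ord0) (Pr _ _ xr) (Pr _ _ yr).
set X := P *m x; set Y := P *m y; rewrite !mxE => /le_trans; apply.
have := ler_mx_entry (X - Y) i ord0; rewrite !mxE => H.
rewrite mulrAC ler_pdivrMr// -mulrA ler_pM2l// [leRHS]mulrC.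
by rewrite (le_trans H)// -mulmxBr.
Qed.

Lemma response_strict_diff :
  strict_diff0 response ((alpha - beta)%:M + (gamma - delta) *: A).
Proof.
split; first by rewrite /response !mulmx0; apply/matrixP => i j;
  rewrite !mxE (sigm_0 hS1) (sigm_0 hS2) subrr.
move=> e e0; have e2 : 0 < e / 2 by rewrite divr_gt0.
set P := alpha%:M + gamma *: A; set Q := beta%:M + delta *: A.
have -> : (alpha - beta)%:M + (gamma - delta) *: A = P - Q.
  by rewrite raddfB/= scalerBl opprD addrACA.
have [r1 r10 H1] := map_sigm_strict_diff P hS1 e2.
have [r2 r20 H2] := map_sigm_strict_diff Q hS2 e2.
exists (Num.min r1 r2) => [|x y]; first by rewrite lt_min r10.
rewrite !le_min => /andP[x1 x2] /andP[y1 y2].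
rewrite (splitr e) mulrDl mulmxBl /response -/P -/Q.
rewrite (_ : _ - _ = (map_mx S1 (P *m x) - map_mx S1 (P *m y) - P *m (x - y))
  - (map_mx S2 (Q *m x) - map_mx S2 (Q *m y) - Q *m (x - y))); last first.
  by apply/matrixP => i j; rewrite !mxE; ring.
by rewrite (le_trans (ler_normB _ _))// lerD ?H1 ?H2.
Qed.

Lemma map_sigm_truncatable S (P : 'M[R]_n) : sigmoidal S ->
  truncatable (fun x : 'cV[R]_n => map_mx S (P *m x)).
Proof.
move=> hS; pose c := n%:R * `|P| + 1.
have c0 : 0 < c by rewrite ltr_wpDl// mulr_ge0.
have Pc (x : 'cV[R]_n) : `|P *m x| <= c * `|x|.
  by rewrite (le_trans (ler_mx_normM _ _))// ler_wpM2r// lerDl.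
have [k k0 Sk] := sigm_abs_bounded hS; exists k => // B B0.
have cB : 0 <= c * B by rewrite mulr_ge0// ltW.
have [L L0 SL] := sigm_lipschitz hS cB.
exists (fun x => map_mx (S \o clip (c * B)) (P *m x)); split.
- exists (L * c) => [|x y]; first exact: mulr_gt0.
  apply: mx_norm_ler => [|i j]; first by rewrite !mulr_ge0// ltW.
  have := ler_mx_entry (P *m x - P *m y) i j.
  set X := P *m x; set Y := P *m y; rewrite !mxE => XY.
  apply: (le_trans (SL _ _ (clip_bound _ cB) (clip_bound _ cB))).
  rewrite -mulrA ler_pM2l// (le_trans (clip_lipschitz _ _ _))//.
  by rewrite (le_trans XY)// -mulmxBr.
- by move=> x; apply: mx_norm_ler => [|i j]; [exact: ltW|rewrite mxE; exact: Sk].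
move=> x xB; apply/matrixP => i j; rewrite [LHS]mxE [RHS]mxE/= clip_id//.
rewrite (le_trans (ler_mx_entry _ _ _))// (le_trans (Pc x))//.
by rewrite ler_pM2l.
Qed.

Lemma response_truncatable : truncatable response.
Proof.
have [k1 k10 T1] := map_sigm_truncatable (alpha%:M + gamma *: A) hS1.
have [k2 k20 T2] := map_sigm_truncatable (beta%:M + delta *: A) hS2.
exists (k1 + k2) => [|B B0]; first exact: addr_gt0.
have [G1 [[L1 L10 HL1] B1 E1]] := T1 B B0.
have [G2 [[L2 L20 HL2] B2 E2]] := T2 B B0.
exists (fun x => G1 x - G2 x); split.
- exists (L1 + L2) => [|x y]; first exact: addr_gt0.
  rewrite mulrDl opprD addrACA -opprD (le_trans (ler_normB _ _))//.
  by rewrite lerD.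
- by move=> x; rewrite (le_trans (ler_normB _ _))// lerD.
by move=> x xB; rewrite E1// E2.
Qed.

End Response.

(** * Matrices with a dominating real eigenvalue *)

Section EntrywiseProduct.
Context {R : realType}.

Definition dotm m n (X Y : 'M[R]_(m, n)) : R := \sum_i \sum_j X i j * Y i j.

Lemma dotmDr m n (X Y Z : 'M[R]_(m, n)) : dotm X (Y + Z) = dotm X Y + dotm X Z.
Proof.
rewrite /dotm -big_split/=; apply: eq_bigr => i _; rewrite -big_split/=.
by apply: eq_bigr => j _; rewrite mxE mulrDr.
Qed.

Lemma dotmZr m n c (X Y : 'M[R]_(m, n)) : dotm X (c *: Y) = c * dotm X Y.
Proof.
rewrite /dotm big_distrr/=; apply: eq_bigr => i _; rewrite big_distrr/=.
by apply: eq_bigr => j _; rewrite mxE mulrCA.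
Qed.

Lemma dotmZ m n c (X : 'M[R]_(m, n)) : dotm (c *: X) (c *: X) = c ^+ 2 * dotm X X.
Proof.
rewrite /dotm big_distrr/=; apply: eq_bigr => i _; rewrite big_distrr/=.
by apply: eq_bigr => j _; rewrite !mxE; ring.
Qed.

Lemma dotm_ge0 m n (X : 'M[R]_(m, n)) : 0 <= dotm X X.
Proof.
by apply: sumr_ge0 => i _; apply: sumr_ge0 => j _; rewrite -expr2 sqr_ge0.
Qed.

Lemma dotm_bound m n (X Y : 'M[R]_(m, n)) :
  `|dotm X Y| <= (m * n)%:R * (`|X| * `|Y|).
Proof.
rewrite (le_trans (ler_norm_sum _ _ _))//.
rewrite (@le_trans _ _ (\sum_(i < m) \sum_(j < n) `|X| * `|Y|))//.
  apply: ler_sum => i _; apply: (le_trans (ler_norm_sum _ _ _)).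
  by apply: ler_sum => j _; rewrite normrM ler_pM// ler_mx_entry.
by rewrite !sumr_const !card_ord -mulrnA mulnC mulr_natl.
Qed.

Lemma norm_le_dotm m n (X : 'M[R]_(m, n)) : `|X| ^+ 2 <= dotm X X.
Proof.
have [->|X0] := eqVneq X 0; first by rewrite normr0 expr0n/= dotm_ge0.
have [[i j] ->]/= := mx_norm_attained X0.
rewrite -normrX ger0_norm ?sqr_ge0// /dotm (bigD1 i)//= (bigD1 j)//= -expr2.
rewrite -addrA lerDl addr_ge0//; apply: sumr_ge0 => k _.
  by rewrite -expr2 sqr_ge0.
by apply: sumr_ge0 => l _; rewrite -expr2 sqr_ge0.
Qed.

Lemma dotm_cols m n (X Y : 'M[R]_(m, n)) :
  dotm X Y = \sum_j \sum_i (col j X) i ord0 * (col j Y) i ord0.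
Proof.
rewrite /dotm exchange_big/=; apply: eq_bigr => j _.
by apply: eq_bigr => i _; rewrite !mxE.
Qed.

Lemma is_derive_dotm m n p (K : 'M[R]_(p, m)) (Z : R -> 'M[R]_(m, n)) (t : R) D :
  is_derive t (1 : R) Z D ->
  is_derive t (1 : R) (fun s => dotm (K *m Z s) (K *m Z s))
    (2 * dotm (K *m Z t) (K *m D)).
Proof.
move=> dZ.
have dKZ i j : is_derive t (1 : R) (fun s => (K *m Z s) i j) ((K *m D) i j).
  rewrite (_ : (fun s => _) = \sum_k (fun s => K i k * Z s k j)); last first.
    by apply/funext => s; rewrite mxE fct_sumE.
  rewrite mxE; apply: is_derive_sum => k; have dk := is_derive_entry k j dZ.
  by apply: is_derive_eq.
have dij i j : is_derive t (1 : R) (fun s => (K *m Z s) i j * (K *m Z s) i j)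
    (2 * ((K *m Z t) i j * (K *m D) i j)).
  have d1 := dKZ i j.
  by apply: is_derive_eq; rewrite /GRing.scale/=; ring.
rewrite /dotm big_distrr/=.
rewrite (_ : (fun s => _) =
    \sum_i (fun s => \sum_j (K *m Z s) i j * (K *m Z s) i j)); last first.
  by apply/funext => s; rewrite fct_sumE.
apply: is_derive_sum => i; rewrite big_distrr/=.
rewrite (_ : (fun s => _) =
    \sum_j (fun s => (K *m Z s) i j * (K *m Z s) i j)); last first.
  by apply/funext => s; rewrite fct_sumE.
exact: is_derive_sum.
Qed.

Lemma cts_dotm (T : topologicalType) m n p (K : 'M[R]_(p, m)) (Z : T -> 'M[R]_(m, n)) :
  continuous Z -> continuous (fun s => dotm (K *m Z s) (K *m Z s)).
Proof.
move=> cZ; have cKZ i j : continuous (fun s => (K *m Z s) i j).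
  move=> s; rewrite (_ : (fun s => _) = (fun s => \sum_k K i k * Z s k j)); last first.
    by apply/funext => z; rewrite mxE.
  apply: cvg_big => [|k _]; first exact: add_continuous.
  apply: cvgM; first exact: cvg_cst.
  exact: (@cts_entry R T m n Z k j cZ s).
move=> s; rewrite /dotm; apply: cvg_big => [|i _]; first exact: add_continuous.
apply: cvg_big => [|j _]; first exact: add_continuous.
by apply: cvgM; exact: cKZ.
Qed.

End EntrywiseProduct.

(** What energy estimates need of: mu is a simple real eigenvalue of M larger than
    the real parts of all other eigenvalues.  The form |T x|^2 vanishes on the line
    of v and M expands it at a rate at most mu'; together with |w x|^2 it is
    positive definite.  T has its own number of rows because it may list the real
    and imaginary parts of complex coordinates. *)
Record dominated (R : realType) (n p : nat) (M : 'M[R]_n) (mu : R)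
    (v : 'cV[R]_n) (w : 'rV[R]_n) (T : 'M[R]_(p, n)) (mu' : R) : Prop :=
  Dominated {
  dom_wv : w *m v = 1%:M;
  dom_left : w *m M = mu *: w;
  dom_right : M *m v = mu *: v;
  dom_gap : mu' < mu;
  dom_form : forall x : 'cV[R]_n,
    \sum_k (T *m x) k ord0 * (T *m (M *m x)) k ord0 <=
    mu' * \sum_k (T *m x) k ord0 * (T *m x) k ord0;
  dom_inj : forall x : 'cV[R]_n, T *m x = 0 -> w *m x = 0 -> x = 0 }.

Section Dominated.
Context {R : realType} {n p : nat}.
Variables (M : 'M[R]_n) (mu : R) (v : 'cV[R]_n) (w : 'rV[R]_n).
Variables (T : 'M[R]_(p, n)) (mu' : R).
Hypothesis dom : dominated M mu v w T mu'.

Lemma dom_v_neq0 : v != 0.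
Proof.
apply/eqP => v0; have := dom_wv dom; rewrite v0 mulmx0.
by move/matrixP/(_ 0 0)/eqP; rewrite !mxE/= eq_sym oner_eq0.
Qed.

Lemma sum_sqr_eq0 m (x : 'cV[R]_m) : \sum_k x k ord0 * x k ord0 <= 0 -> x = 0.
Proof.
move=> x0; have pos : forall i, true -> 0 <= x i ord0 * x i ord0.
  by move=> i _; rewrite -expr2 sqr_ge0.
have /eqP : \sum_k x k ord0 * x k ord0 = 0.
  by apply/eqP; rewrite eq_le x0 sumr_ge0.
rewrite psumr_eq0// => /allP xi; apply/matrixP => i j; rewrite ord1 mxE.
have := xi i (mem_index_enum _); rewrite /= mulf_eq0 orbb; exact/eqP.
Qed.

(** On such an x the form grows at the rate mu > mu', so it vanishes. *)
Lemma dom_T_eigen (x : 'cV[R]_n) : M *m x = mu *: x -> T *m x = 0.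
Proof.
move=> Mx; apply: sum_sqr_eq0; have := dom_form dom x.
have -> : T *m (M *m x) = mu *: (T *m x) by rewrite Mx scalemxAr.
set y := T *m x; under eq_bigr do rewrite [(mu *: y) _ _]mxE mulrCA.
rewrite -big_distrr/= -subr_le0 -mulrBl pmulr_rle0// subr_gt0.
exact: dom_gap dom.
Qed.

Lemma dom_Tv : T *m v = 0.
Proof. exact: dom_T_eigen (dom_right dom). Qed.

Lemma dom_eigen (x : 'cV[R]_n) : M *m x = mu *: x -> x = v *m (w *m x).
Proof.
move=> Mx; apply/eqP; rewrite -subr_eq0; apply/eqP; apply: (dom_inj dom).
  by rewrite mulmxBr (dom_T_eigen Mx) !mulmxA dom_Tv !mul0mx subrr.
by rewrite mulmxBr !mulmxA (dom_wv dom) mul1mx subrr.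
Qed.

(** Adding the rank-one matrix v w, which acts only on the line of v, makes
    M - mu invertible.  The inverse solves (M - mu) x = y on the kernel of w. *)
Definition resolvent : 'M[R]_n := invmx (M - mu%:M + v *m w).

Lemma dom_unit : M - mu%:M + v *m w \in unitmx.
Proof.
rewrite -unitmx_tr -row_free_unit -kermx_eq0.
set K := kermx _; apply/eqP/row_matrixP => i; rewrite row0; apply: trmx_inj.
rewrite trmx0; set x := (row i K)^T.
have : (M - mu%:M + v *m w) *m x = 0.
  rewrite /x -[X in X *m _]trmxK -trmx_mul -row_mul mulmx_ker row0; exact: trmx0.
rewrite mulmxDl mulmxBl mul_scalar_mx => eq0.
have wx : w *m x = 0.
  move/(congr1 (mulmx w)) : eq0; rewrite mulmx0 mulmxDr mulmxBr mulmxA (dom_left dom).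
  by rewrite -scalemxAr -scalemxAl subrr add0r !mulmxA (dom_wv dom) mul1mx.
move: eq0; rewrite -[v *m w *m x]mulmxA wx mulmx0 addr0 => /eqP.
rewrite subr_eq0 => /eqP Mx.
by rewrite (dom_eigen Mx) wx mulmx0.
Qed.

Lemma resolvent_left : w *m resolvent = w.
Proof.
have {1}-> : w = w *m (M - mu%:M + v *m w).
  rewrite mulmxDr mulmxBr mul_mx_scalar (dom_left dom) subrr add0r mulmxA.
  by rewrite (dom_wv dom) mul1mx.
by rewrite mulmxK// dom_unit.
Qed.

Lemma resolventE : resolvent *m (M - mu%:M) = 1%:M - v *m w.
Proof.
have Bv : resolvent *m v = v.
  have {1}-> : v = (M - mu%:M + v *m w) *m v.
    rewrite mulmxDl mulmxBl mul_scalar_mx (dom_right dom) subrr add0r.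
    by rewrite -mulmxA (dom_wv dom) mulmx1.
  by rewrite mulKmx// dom_unit.
have := mulVmx dom_unit; rewrite mulmxDr -/resolvent mulmxA Bv => <-.
by rewrite addrK.
Qed.

Lemma dom_form_mx q (Z : 'M[R]_(n, q)) :
  dotm (T *m Z) (T *m (M *m Z)) <= mu' * dotm (T *m Z) (T *m Z).
Proof.
rewrite !dotm_cols big_distrr/=; apply: ler_sum => j _.
have cE (K : 'M[R]_(p, n)) (Y : 'M[R]_(n, q)) : col j (K *m Y) = K *m col j Y.
  by rewrite !colE mulmxA.
have -> : col j (T *m (M *m Z)) = T *m (M *m col j Z).
  by rewrite !colE !mulmxA.
by rewrite cE; exact: (dom_form dom).
Qed.

(** By injectivity, the rows of w and T together have a left inverse. *)
Lemma dom_energy_lower q : exists2 c, 0 < c & forall Z : 'M[R]_(n, q),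
  c * `|Z| ^+ 2 <= dotm (w *m Z) (w *m Z) + dotm (T *m Z) (T *m Z).
Proof.
have [B BK] : exists B, B *m col_mx w T = 1%:M.
  apply/row_fullP; rewrite -cokermx_eq0; apply/eqP.
  apply: trmx_inj; apply/row_matrixP => i; rewrite -tr_col trmx0 row0.
  apply: trmx_inj; rewrite trmxK trmx0.
  have KC : col_mx w T *m col i (cokermx (col_mx w T)) = 0.
    by rewrite colE mulmxA mulmx_coker mul0mx.
  rewrite mul_col_mx in KC; have /eqP := KC; rewrite col_mx_eq0.
  by move=> /andP[/eqP wx /eqP Tx]; exact: (dom_inj dom).
pose c := (1 + p)%:R * `|B| + 1.
have c0 : 0 < c by rewrite ltr_wpDl// mulr_ge0.
exists (c ^- 2) => [|Z]; first by rewrite invr_gt0 exprn_gt0.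
rewrite mulrC ler_pdivrMr ?exprn_gt0//.
have -> : dotm (w *m Z) (w *m Z) + dotm (T *m Z) (T *m Z) =
    dotm (col_mx w T *m Z) (col_mx w T *m Z).
  rewrite mul_col_mx /dotm big_split_ord/=; congr (_ + _).
    by apply: eq_bigr => i _; apply: eq_bigr => j _; rewrite col_mxEu.
  by apply: eq_bigr => i _; apply: eq_bigr => j _; rewrite col_mxEd.
set X := col_mx w T *m Z; have ZX : Z = B *m X by rewrite mulmxA BK mul1mx.
have ZcX : `|Z| <= c * `|X|.
  by rewrite [in leLHS]ZX (le_trans (ler_mx_normM _ _))// ler_wpM2r// lerDl.
apply: (@le_trans _ _ ((c * `|X|) ^+ 2)).
  by rewrite ler_pXn2r// nnegrE// mulr_ge0// ltW.
by rewrite exprMn mulrC ler_wpM2r// ?sqr_ge0// norm_le_dotm.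
Qed.

End Dominated.

(** * Stability of the neutral equilibrium below the critical value *)

Section FieldDynamics.
Context {R : realType} {Na No : nat}.
Variables (d a : R) (M : 'M[R]_Na) (Gam : 'cV[R]_Na -> 'cV[R]_Na).
Hypothesis GamL : strict_diff0 Gam (a%:M + M).
Notation P0 := (proj1perp R No).

Definition columnwise_field (u : R) (Z : 'M[R]_(Na, No)) : 'M[R]_(Na, No) :=
  (- d *: Z + u *: colwise Gam Z) *m P0.

Definition remainder (Z : 'M[R]_(Na, No)) : 'M[R]_(Na, No) :=
  (colwise Gam Z - (a%:M + M) *m Z) *m P0.

Lemma columnwise_field_split u Z : opinion_space Z ->
  columnwise_field u Z =
  (- d + u * a) *: Z + u *: (M *m Z) + u *: remainder Z.
Proof.
move=> VZ; have LE : ((a%:M + M) *m Z) *m P0 = a *: Z + M *m Z.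
  by rewrite -mulmxA (proj1perp_id VZ) mulmxDl mul_scalar_mx.
rewrite /columnwise_field /remainder mulmxBl LE mulmxDl -!scalemxAl (proj1perp_id VZ).
set C := colwise Gam Z *m P0; set N := M *m Z.
by apply/matrixP => i j; rewrite !mxE; ring.
Qed.

Lemma remainder_small e : 0 < e ->
  exists2 r, 0 < r & forall Z, `|Z| <= r -> `|remainder Z| <= e * `|Z|.
Proof.
move=> e0; pose c := No%:R * `|P0| + 1.
have c0 : 0 < c by rewrite ltr_wpDl// mulr_ge0.
have [r r0 Hr] := @colwise_strict_diff _ _ No _ _ GamL (e / c) (divr_gt0 e0 c0).
exists r => // Z Zr; have := Hr Z 0 Zr; rewrite normr0 => /(_ (ltW r0)).
rewrite (colwise0 _ GamL.1) !subr0 => H.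
rewrite /remainder (le_trans (ler_mx_normM _ _))// mulrAC.
rewrite (@le_trans _ _ (c * (e / c * `|Z|)))//; last first.
  by rewrite mulrA mulrCA divff ?gt_eqF// mulr1.
by rewrite ler_pM ?lerDl// mulr_ge0.
Qed.

Lemma dotm_mull_bound q (K : 'M[R]_(q, Na)) : exists2 c, 0 < c &
  forall X Y : 'M[R]_(Na, No), `|dotm (K *m X) (K *m Y)| <= c * (`|X| * `|Y|).
Proof.
pose k := Na%:R * `|K|; have k0 : 0 <= k by rewrite mulr_ge0.
exists ((q * No)%:R * (k * k) + 1) => [|X Y].
  by rewrite ltr_wpDl// !mulr_ge0.
rewrite (le_trans (dotm_bound _ _))// mulrDl mul1r ler_wpDr ?mulr_ge0//.
rewrite -mulrA ler_wpM2l// mulrACA ler_pM// ?ler_mx_normM//.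
Qed.

Section Energy.
Context {p : nat}.
Variables (mu : R) (v : 'cV[R]_Na) (w : 'rV[R]_Na) (T : 'M[R]_(p, Na)) (mu' : R).
Hypothesis dom : dominated M mu v w T mu'.
Implicit Types Z : 'M[R]_(Na, No).

Definition main_energy Z := dotm (w *m Z) (w *m Z).
Definition rest_energy Z := dotm (T *m Z) (T *m Z).

(** w is a left eigenvector, so the energy of w Z has an exact linear rate; only
    the superlinear remainder is estimated. *)
Lemma main_energy_rate u e : 0 < u -> 0 < e -> exists2 r, 0 < r &
  forall Z, opinion_space Z -> `|Z| <= r ->
  `|2 * dotm (w *m Z) (w *m columnwise_field u Z) -
    2 * (- d + u * (a + mu)) * main_energy Z| <= e * `|Z| ^+ 2.
Proof.
move=> u0 e0; have [c c0 Hc] := dotm_mull_bound w.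
have uc0 : 0 < 2 * u * c by rewrite !mulr_gt0.
have [r r0 Hr] := remainder_small (divr_gt0 e0 uc0).
exists r => // Z VZ Zr; rewrite (columnwise_field_split u VZ) !mulmxDr.
rewrite -!scalemxAr mulmxA (dom_left dom) -scalemxAl !dotmDr !dotmZr -/(main_energy Z).
set D := dotm _ (w *m remainder Z).
rewrite (_ : _ - _ = 2 * u * D); last by ring.
rewrite normrM (gtr0_norm (mulr_gt0 _ u0))//.
apply: (@le_trans _ _ (2 * u * (c * (`|Z| * (e / (2 * u * c) * `|Z|))))).
  rewrite ler_pM2l ?mulr_gt0// (le_trans (Hc _ _))// ler_pM2l// ler_wpM2l//.
  exact: Hr.
rewrite le_eqVlt; apply/orP; left; apply/eqP; field.
by rewrite !gt_eqF.
Qed.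

Lemma rest_energy_rate u e : 0 < u -> 0 < e -> exists2 r, 0 < r &
  forall Z, opinion_space Z -> `|Z| <= r ->
  2 * dotm (T *m Z) (T *m columnwise_field u Z) <=
    2 * (- d + u * (a + mu')) * rest_energy Z + e * `|Z| ^+ 2.
Proof.
move=> u0 e0; have [c c0 Hc] := dotm_mull_bound T.
have uc0 : 0 < 2 * u * c by rewrite !mulr_gt0.
have [r r0 Hr] := remainder_small (divr_gt0 e0 uc0).
exists r => // Z VZ Zr; rewrite (columnwise_field_split u VZ) !mulmxDr.
rewrite -!scalemxAr !dotmDr !dotmZr -/(rest_energy Z).
set D := dotm _ (T *m remainder Z); set B := dotm _ (T *m (M *m Z)).
have HB : B <= mu' * rest_energy Z := dom_form_mx dom Z.
have HD : 2 * u * D <= e * `|Z| ^+ 2.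
  apply: (@le_trans _ _ (2 * u * (c * (`|Z| * (e / (2 * u * c) * `|Z|))))).
    rewrite ler_pM2l ?mulr_gt0// (le_trans (ler_norm _))// (le_trans (Hc _ _))//.
    by rewrite ler_pM2l// ler_wpM2l//; exact: Hr.
  rewrite le_eqVlt; apply/orP; left; apply/eqP; field.
  by rewrite !gt_eqF.
have uB : 2 * u * B <= 2 * u * (mu' * rest_energy Z) by rewrite ler_pM2l ?mulr_gt0.
apply: le_trans (_ : 2 * (- d + u * a) * rest_energy Z + 2 * u * B + 2 * u * D <= _).
  by rewrite le_eqVlt; apply/orP; left; apply/eqP; ring.
apply: le_trans (lerD (lerD (lexx _) uB) HD) _.
by rewrite le_eqVlt; apply/orP; left; apply/eqP; ring.
Qed.

Lemma solution_energy_cts q (K : 'M[R]_(q, Na)) f (Y : R -> 'M[R]_(Na, No)) :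
  solution f Y ->
  {within `[0, +oo[, continuous (fun t => dotm (K *m Y t) (K *m Y t))}.
Proof.
move=> [_ cY _]; apply/subspace_continuousP => t t0.
have /subspace_continuousP/(_ t t0) := cY => h2.
have := @cts_dotm R _ _ _ _ K (@id 'M[R]_(Na, No)) (fun x => cvg_id) (Y t).
exact: cvg_comp h2.
Qed.

Lemma solution_energy_derive q (K : 'M[R]_(q, Na)) f (Y : R -> 'M[R]_(Na, No))
    (t : R) : solution f Y -> 0 < t ->
  is_derive t (1 : R) (fun t => dotm (K *m Y t) (K *m Y t))
    (2 * dotm (K *m Y t) (K *m f (Y t))).
Proof. by move=> [_ _ dY] t0; apply: is_derive_dotm; exact: dY. Qed.

(** Both energies have negative rates, so their sum E satisfies E' <= sg E near 0.
    A sublevel set of E traps the solution in the ball where this holds, and E is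
    comparable to |Z|^2, which gives the constants. *)
Lemma neutral_stable u : 0 < u -> - d + u * (a + mu) < 0 ->
  locally_exponentially_stable (columnwise_field u).
Proof.
move=> u0; set sg := - d + _ => sg0.
have [c0 c00 Hc0] := dom_energy_lower dom No.
have [cw cw0 Hcw] := dotm_mull_bound w; have [cT cT0 HcT] := dotm_mull_bound T.
pose E Z := main_energy Z + rest_energy Z; pose c1 := cw + cT.
have c10 : 0 < c1 by rewrite addr_gt0.
have Ec1 Z : E Z <= c1 * `|Z| ^+ 2.
  rewrite mulrDl expr2; apply: lerD; apply: le_trans (ler_norm _) _.
    exact: Hcw.
  exact: HcT.
pose e := - sg * c0 / 2.
have e0 : 0 < e by rewrite divr_gt0// mulr_gt0// oppr_gt0.
have [r1 r10 H1] := main_energy_rate u0 e0.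
have [r2 r20 H2] := rest_energy_rate u0 e0.
pose r := Num.min r1 r2; have r0 : 0 < r by rewrite lt_min r10.
have E_ge0 Z : 0 <= E Z by rewrite addr_ge0// dotm_ge0.
have rate Z : opinion_space Z -> `|Z| <= r ->
    2 * dotm (w *m Z) (w *m columnwise_field u Z) +
    2 * dotm (T *m Z) (T *m columnwise_field u Z) <= sg * E Z.
  move=> VZ; rewrite le_min => /andP[Zr1 Zr2].
  have := H1 Z VZ Zr1; rewrite -/sg ler_norml => /andP[_].
  have := H2 Z VZ Zr2; set A1 := 2 * dotm (w *m _) _; set A2 := 2 * dotm (T *m _) _.
  have : (- d + u * (a + mu')) * rest_energy Z <= sg * rest_energy Z.
    rewrite ler_wpM2r ?dotm_ge0// /sg lerD2l ler_pM2l// lerD2l ltW//.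
    exact: dom_gap dom.
  have : e * `|Z| ^+ 2 <= - sg / 2 * E Z.
    have -> : e * `|Z| ^+ 2 = - sg / 2 * (c0 * `|Z| ^+ 2) by rewrite /e; ring.
    by rewrite ler_wpM2l// divr_ge0// oppr_ge0 ltW.
  rewrite /E; set m := main_energy Z; set q := rest_energy Z.
  set ee := e * _; set qq := (- d + _) * q => h1 h2 h3 h4.
  have : 2 * (- d + u * (a + mu')) * q = 2 * qq by rewrite /qq mulrA.
  by move=> h5; lra.
pose r' := Num.sqrt (c0 / c1) * r; pose C := Num.sqrt (c1 / c0).
have q0 : 0 < c0 / c1 by rewrite divr_gt0.
have q1 : 0 < c1 / c0 by rewrite divr_gt0.
exists r', C, (- sg / 2); split.
- by rewrite mulr_gt0// sqrtr_gt0.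
- by rewrite sqrtr_gt0.
- by rewrite divr_gt0// oppr_gt0.
move=> Y solY Y0r.
have cE : {within `[0, +oo[, continuous (fun t => E (Y t))}.
  by apply: within_continuousD; exact: solution_energy_cts solY.
have dE (t : R) : 0 < t -> is_derive t (1 : R) (fun t => E (Y t))
    (2 * dotm (w *m Y t) (w *m columnwise_field u (Y t)) +
     2 * dotm (T *m Y t) (T *m columnwise_field u (Y t))).
  move=> t0; have d1 := solution_energy_derive w solY t0.
  by have d2 := solution_energy_derive T solY t0; exact: is_deriveD.
have small Z : E Z < c0 * r ^+ 2 -> `|Z| <= r.
  move=> EZ; rewrite -(@ler_pXn2r _ 2)// ?nnegrE ?(ltW r0)//.
  by rewrite -(ler_pM2l c00) (le_trans (Hc0 Z))// ltW.
have decay t : 0 <= t -> (forall s, 0 <= s < t -> E (Y s) < c0 * r ^+ 2) ->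
    E (Y t) <= E (Y 0) * expR (sg * t).
  move=> t0 H; apply: (gronwall t0 cE dE) => s /andP[s0 st].
  apply: rate; first by case: solY => VY _ _; exact: VY (ltW s0).
  by apply: small; apply: H; rewrite (ltW s0) st.
have E0 : E (Y 0) < c0 * r ^+ 2.
  apply: (le_lt_trans (Ec1 _)).
  have : `|Y 0| ^+ 2 < r' ^+ 2.
    by rewrite ltr_pXn2r// nnegrE ?mulr_ge0 ?sqrtr_ge0// ltW.
  rewrite /r' exprMn sqr_sqrtr ?ltW// -(ltr_pM2l c10) => /lt_le_trans; apply.
  by rewrite le_eqVlt; apply/orP; left; apply/eqP; field; rewrite gt_eqF.
have trapped t : 0 <= t -> E (Y t) < c0 * r ^+ 2.
  apply: (bootstrap_lt cE) => s s0 H; apply: le_lt_trans E0.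
  apply: (le_trans (decay s s0 H)); rewrite ler_piMr// -expR0 ler_expR.
  by rewrite mulr_le0_ge0// ltW.
move=> t t0.
have Et := decay t t0 (fun s hs => trapped s (andP hs).1).
have rhs0 : 0 <= C * expR (- (- sg / 2) * t) * `|Y 0|.
  by rewrite !mulr_ge0 ?sqrtr_ge0 ?expR_ge0.
rewrite -(@ler_pXn2r _ 2)// ?nnegrE// -(ler_pM2l c00) (le_trans (Hc0 _))//.
apply: (le_trans Et); rewrite !exprMn sqr_sqrtr ?(ltW q1)// -expRM_natl.
apply: (@le_trans _ _ (c1 * `|Y 0| ^+ 2 * expR (sg * t))).
  by rewrite ler_wpM2r ?expR_ge0.
have -> : 2%:R * (- (- sg / 2) * t) = sg * t by field.
by rewrite le_eqVlt; apply/orP; left; apply/eqP; field; rewrite gt_eqF.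
Qed.

End Energy.

End FieldDynamics.

(** * Instability above the critical value *)

Section Instability.
Context {R : realType} {Na No : nat}.
Variables (d a : R) (M : 'M[R]_Na) (Gam : 'cV[R]_Na -> 'cV[R]_Na).
Hypotheses (d0 : 0 < d) (GamL : strict_diff0 Gam (a%:M + M)).
Hypothesis GamT : truncatable Gam.
Notation P0 := (proj1perp R No).
Local Notation field := (columnwise_field d Gam).

(** By [gronwall], phi - h / d is at most its initial value times exp (- d t). *)
Lemma forced_decay (phi dphi : R -> R) (b h T : R) :
  0 <= b -> phi 0 <= b -> 0 <= T -> 0 <= h ->
  {within `[0, +oo[, continuous phi} ->
  (forall t : R, 0 < t -> is_derive t (1 : R) phi (dphi t)) ->
  (forall t, 0 < t < T -> dphi t <= - d * phi t + h) ->
  phi T <= b + h / d.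
Proof.
move=> b0 phi0 T0 h0 cphi dphiE dphih.
have : phi T - h / d <= (phi 0 - h / d) * expR (- d * T).
  apply: (@gronwall _ (fun t => phi t - h / d) dphi _ _ T0).
  - by apply: within_continuousB => //; apply: continuous_subspaceT => t; exact: cvg_cst.
  - move=> t t0; have d1 := dphiE t t0.
    by apply: is_derive_eq; rewrite subr0.
  move=> t /dphih/le_trans; apply.
  by rewrite le_eqVlt; apply/orP; left; apply/eqP; field; rewrite gt_eqF.
rewrite lerBlDr => /le_trans; apply; rewrite lerD2r.
apply: (@le_trans _ _ (b * expR (- d * T))).
  rewrite ler_wpM2r ?expR_ge0// (le_trans _ phi0)// gerDl oppr_le0.
  by rewrite divr_ge0// ltW.
by rewrite ler_piMr// -expR0 ler_expR mulNr oppr_le0 mulr_ge0// ltW.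
Qed.

(** A truncation of Gam makes the field Lipschitz.  The term - d Z and the bound
    on Gam confine the solution to the ball of radius B, inside which the truncated
    field is the given one.  The row sums solve y' = - d y, so they stay zero. *)
Lemma solution_exists u (Z0 : 'M[R]_(Na, No)) : 0 < u -> opinion_space Z0 ->
  exists2 Z, Z 0 = Z0 & solution (field u) Z.
Proof.
move=> u0 VZ0; have [H H0 trunc] := GamT.
pose cP := No%:R * `|P0| + 1; pose h := u * (cP * H).
have cP0 : 0 < cP by rewrite ltr_wpDl// mulr_ge0.
have h0 : 0 < h by rewrite !mulr_gt0.
have PcP (X : 'M[R]_(Na, No)) : `|X *m P0| <= cP * `|X|.
  rewrite (le_trans (ler_mx_normM _ _))// mulrAC ler_wpM2r// ?lerDl//.
pose B := `|Z0| + h / d.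
have B0 : 0 <= B by rewrite addr_ge0// divr_ge0// ltW.
have [GB [[L L0 GBL] GBH GBE]] := trunc B B0.
pose F Z : 'M[R]_(Na, No) := - d *: Z + u *: (colwise GB Z *m P0).
have FL X Y : `|F X - F Y| <= (d + u * (cP * L)) * `|X - Y|.
  have -> : F X - F Y = - d *: (X - Y) + u *: ((colwise GB X - colwise GB Y) *m P0).
    by rewrite /F mulmxBl !scalerBr opprD addrACA.
  rewrite (le_trans (ler_normD _ _))// mulrDl !normrZ normrN !gtr0_norm//.
  rewrite lerD2l -mulrA ler_pM2l// (le_trans (PcP _))// -mulrA ler_pM2l//.
  exact: colwise_lipschitz.
have dL0 : 0 < d + u * (cP * L) by rewrite addr_gt0// !mulr_gt0.
have [Z Z0E dZ] := picard_lindelof Z0 dL0 FL.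
have cZ : {within `[0, +oo[, continuous Z}.
  apply: derivable_within_continuous => t; rewrite in_itv/= andbT => t0.
  exact: (@ex_derive _ _ _ _ _ _ _ (dZ t t0)).
have centry i j : {within `[0, +oo[, continuous (fun t => Z t i j)}.
  apply: derivable_within_continuous => t; rewrite in_itv/= andbT => t0.
  exact: (@ex_derive _ _ _ _ _ _ _ (is_derive_entry i j (dZ t t0))).
have GBh (X : 'M[R]_(Na, No)) i j : `|(u *: (colwise GB X *m P0)) i j| <= h.
  rewrite (le_trans (ler_mx_entry _ _ _))// normrZ gtr0_norm// ler_pM2l//.
  rewrite (le_trans (PcP _))// ler_pM2l//.
  by apply: colwise_bound; [exact: ltW|move=> k; exact: GBH].
have bounded t : 0 <= t -> `|Z t| <= B.
  move=> t0; apply: mx_norm_ler => // i j; rewrite ler_norml lerNl; apply/andP; split.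
    apply: (forced_decay (phi := fun s => - Z s i j) (dphi := fun s => - F (Z s) i j)) => //.
    - by rewrite Z0E (le_trans (ler_norm _))// normrN ler_mx_entry.
    - exact: ltW.
    - by move=> s; apply: continuousN => ?; exact: centry.
    - by move=> s /ltW s0; have d1 := is_derive_entry i j (dZ s s0); exact: is_deriveN.
    move=> s /andP[/ltW s0 _]; rewrite /F mxE opprD [X in - X]mxE mulrN lerD2l.
    by rewrite (le_trans (ler_norm _))// normrN.
  apply: (forced_decay (phi := fun s => Z s i j) (dphi := fun s => F (Z s) i j)) => //.
  - by rewrite Z0E (le_trans (ler_norm _))// ler_mx_entry.
  - exact: ltW.
  - by move=> s /ltW s0; have d1 := is_derive_entry i j (dZ s s0).
  move=> s /andP[/ltW s0 _]; rewrite /F mxE [X in X + _]mxE lerD2l.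
  by rewrite (le_trans (ler_norm _)).
have inV t : 0 <= t -> opinion_space (Z t).
  move=> t0; apply/opinion_spaceP => i.
  pose rs s := \sum_j Z s i j.
  have crs : {within `[0, +oo[, continuous rs}.
    apply/subspace_continuousP => s s0; apply: cvg_big => [|j _]; first exact: add_continuous.
    by have /subspace_continuousP/(_ s s0) := centry i j.
  have drs (s : R) : 0 < s -> is_derive s (1 : R) rs (- d * rs s).
    move=> /ltW s0; rewrite /rs.
    rewrite (_ : (fun s => _) = \sum_j (fun s => Z s i j)); last first.
      by apply/funext => z; rewrite fct_sumE.
    rewrite (_ : - d * _ = \sum_j F (Z s) i j); last first.
      have /opinion_spaceP/(_ i) H2 := opinion_space_proj (colwise GB (Z s)).
      under [RHS]eq_bigr do rewrite /F mxE [X in X + _]mxE [X in _ + X]mxE.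
      by rewrite big_split/= -!big_distrr/= H2 mulr0 addr0.
    by apply: is_derive_sum => j; exact: is_derive_entry (dZ s s0).
  have rs0 : rs 0 = 0 by rewrite /rs Z0E; exact: (opinion_spaceP Z0).1.
  apply/eqP; rewrite eq_le; apply/andP; split.
    have := gronwall (k := - d) t0 crs drs (fun s _ => lexx _).
    by rewrite rs0 mul0r.
  have := @gronwall _ (fun s => - rs s) (fun s => - (- d * rs s)) (- d) t t0.
  rewrite rs0 oppr0 mul0r oppr_le0; apply.
  - by move=> s; apply: continuousN => ?; exact: crs.
  - by move=> s s0; have d1 := drs s s0; exact: is_deriveN.
  - by move=> s _; rewrite mulrN.
exists Z => //; split => // t t0.
have FE : F (Z t) = field u (Z t).
  have tge := ltW t0; rewrite /columnwise_field mulmxDl -!scalemxAl.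
  rewrite (proj1perp_id (inV t tge)) /F; congr (_ + _ *: (_ *m _)).
  apply/matrixP => i j; rewrite !mxE GBE// (le_trans (col_norm_le _ _))//.
  exact: bounded.
by rewrite -FE; exact: dZ (ltW t0).
Qed.

(** Chetaev's argument with W = |w Z|^2 - |T Z|^2.  While Z stays small,
    W' >= kap W for a rate kap > 0 halfway between bounds for those of the two
    energies.  On multiples of v (x) x0, which are as small as one likes, W > 0, so
    W grows exponentially, whereas |W| is bounded as long as Z is. *)
Lemma neutral_unstable p (mu : R) (v : 'cV[R]_Na) (w : 'rV[R]_Na)
    (T : 'M[R]_(p, Na)) (mu' : R) (x0 : 'rV[R]_No) u :
  dominated M mu v w T mu' -> perp1 x0 -> x0 != 0 ->
  0 < u -> 0 < - d + u * (a + mu) -> unstable (field u : _ -> 'M[R]_(Na, No)).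
Proof.
move=> dom x0V x0N0 u0; set sg := - d + _ => sg0.
have [c0 c00 Hc0] := dom_energy_lower dom No.
have [cw cw0 Hcw] := @dotm_mull_bound R Na No _ w.
pose s1 := Num.max (- d + u * (a + mu')) 0.
have s10 : 0 <= s1 by rewrite le_max lexx orbT.
have s1sg : s1 < sg.
  by rewrite gt_max sg0 andbT ltrD2l ltr_pM2l// ltrD2l; exact: dom_gap dom.
(* 2 sg and 2 s1 bound the rates of the two energies; s1 is made nonnegative so
   that kap is positive. *)
pose kap := sg + s1; pose e := (sg - s1) * c0 / 2.
have kap0 : 0 < kap by rewrite ltr_wpDr.
have e0 : 0 < e by rewrite divr_gt0// mulr_gt0// subr_gt0.
have [r1 r10 H1] := main_energy_rate (No := No) d GamL dom u0 e0.
have [r2 r20 H2] := rest_energy_rate (No := No) d GamL dom u0 e0.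
pose r := Num.min r1 r2; have r0 : 0 < r by rewrite lt_min r10.
have rate (Z : 'M[R]_(Na, No)) : opinion_space Z -> `|Z| <= r ->
    kap * (main_energy w Z - rest_energy T Z) <=
    2 * dotm (w *m Z) (w *m field u Z) - 2 * dotm (T *m Z) (T *m field u Z).
  move=> VZ; rewrite le_min => /andP[Zr1 Zr2].
  have := H1 Z VZ Zr1; rewrite -/sg ler_norml => /andP[+ _].
  have := H2 Z VZ Zr2; set A1 := 2 * dotm (w *m _) _; set A2 := 2 * dotm (T *m _) _.
  have : (- d + u * (a + mu')) * rest_energy T Z <= s1 * rest_energy T Z.
    by rewrite ler_wpM2r ?dotm_ge0// le_max lexx.
  have : e * `|Z| ^+ 2 <= (sg - s1) / 2 * (main_energy w Z + rest_energy T Z).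
    have -> : e * `|Z| ^+ 2 = (sg - s1) / 2 * (c0 * `|Z| ^+ 2) by rewrite /e; ring.
    by rewrite ler_wpM2l// divr_ge0// subr_ge0 ltW.
  rewrite /kap; set m := main_energy w Z; set q := rest_energy T Z.
  set ee := e * _; set qq := (- d + _) * q => h1 h2 h3 h4.
  have h5 : 2 * (- d + u * (a + mu')) * q = 2 * qq by rewrite /qq mulrA.
  by lra.
move=> stab; have [rr rr0 Hrr] := stab r r0.
have VX0 : opinion_space (v *m x0).
  apply: opinion_space_mull; apply/opinion_spaceP => i.
  by rewrite ord1; exact: x0V.
have wX0 : w *m (v *m x0) = x0 by rewrite mulmxA (dom_wv dom) mul1mx.
have X0N0 : v *m x0 != 0.
  by apply: contra_neq x0N0 => X00; rewrite -wX0 X00 mulmx0.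
have nX0 : 0 < `|v *m x0| by rewrite normr_gt0.
pose s := rr / 2 / `|v *m x0|; have s0 : 0 < s by rewrite !divr_gt0.
have VZ0 : opinion_space (s *: (v *m x0)).
  by rewrite -mul_scalar_mx; exact: opinion_space_mull.
have [Z Z0E solZ] := solution_exists u0 VZ0.
have Z0r : `|Z 0| < rr.
  rewrite Z0E normrZ gtr0_norm// divfK ?gt_eqF//.
  by rewrite ltr_pdivrMr// ltr_pMr// ltr1n.
have Zr := Hrr Z solZ Z0r.
pose W t := main_energy w (Z t) - rest_energy T (Z t).
have W0 : 0 < W 0.
  rewrite /W Z0E /main_energy /rest_energy -!scalemxAr wX0 mulmxA (dom_Tv dom).
  rewrite mul0mx scaler0 dotmZ [X in _ - X]big1 ?subr0; last first.
    by move=> i _; rewrite big1// => j _; rewrite mxE mul0r.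
  rewrite mulr_gt0 ?exprn_gt0// (lt_le_trans _ (norm_le_dotm _))//.
  by rewrite exprn_gt0// normr_gt0.
have cW : {within `[0, +oo[, continuous (fun t => - W t)}.
  move=> t; apply: continuousN; move: t.
  by apply: within_continuousB; exact: solution_energy_cts solZ.
have dW (t : R) : 0 < t -> is_derive t (1 : R) (fun t => - W t)
    (- (2 * dotm (w *m Z t) (w *m field u (Z t)) -
        2 * dotm (T *m Z t) (T *m field u (Z t)))).
  move=> t0; have d1 := solution_energy_derive w solZ t0.
  have d2 := solution_energy_derive T solZ t0.
  by have d3 := is_deriveB d1 d2; exact: is_deriveN.
apply: (@expR_ub_false _ kap (W 0) (cw * r ^+ 2)) => // t t0.
have := @gronwall _ _ _ kap t t0 cW dW.
rewrite mulNr lerN2 => H; apply: (@le_trans _ _ (W t)).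
  apply: H => z /andP[z0 zt]; rewrite mulrN lerN2; apply: rate.
    by case: solZ => VZ _ _; exact: VZ (ltW z0).
  by apply/ltW/Zr/ltW.
rewrite /W (@le_trans _ _ (main_energy w (Z t)))// ?gerBl ?dotm_ge0//.
rewrite (le_trans (ler_norm _))// (le_trans (Hcw _ _))// ler_pM2l// -expr2.
by rewrite ler_pXn2r// ?nnegrE ?(ltW r0)// ltW// Zr.
Qed.

End Instability.

(** * Equilibria near the critical point *)

Section Bifurcation.
Context {R : realType} {Na No : nat}.
Variables (d a : R) (M : 'M[R]_Na) (Gam : 'cV[R]_Na -> 'cV[R]_Na).
Hypotheses (d0 : 0 < d) (GamL : strict_diff0 Gam (a%:M + M)).
Notation P0 := (proj1perp R No).
Local Notation field := (@columnwise_field R Na No d Gam).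

Lemma mx_linear_bound m n q (K : 'M[R]_(m, n)) : exists2 c, 0 < c &
  forall X : 'M[R]_(n, q), `|K *m X| <= c * `|X|.
Proof.
exists (n%:R * `|K| + 1) => [|X]; first by rewrite ltr_wpDl// mulr_ge0.
by rewrite (le_trans (ler_mx_normM _ _))// ler_wpM2r// lerDl.
Qed.

Lemma columnwise_field_diff u Z : opinion_space Z ->
  'd (field u) (0 : 'M[R]_(Na, No)) Z = (- d + u * a) *: Z + u *: (M *m Z).
Proof.
move=> VZ; pose N : 'M[R]_Na := (- d)%:M + u *: (a%:M + M).
pose J := (mulmxr P0 \o mulmx N)%FUN : {linear 'M[R]_(Na, No) -> 'M[R]_(Na, No)}.
have JE X : J X = (- d *: X + u *: ((a%:M + M) *m X)) *m P0.
  by rewrite /J/= mulmxDl mul_scalar_mx -scalemxAl.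
have [cN cN0 HN] := mx_linear_bound No N.
have cP0 : 0 < No%:R * `|P0| + 1 by rewrite ltr_wpDl// mulr_ge0.
have PX (X : 'M[R]_(Na, No)) : `|X *m P0| <= (No%:R * `|P0| + 1) * `|X|.
  by rewrite (le_trans (ler_mx_normM _ _))// mulrAC ler_wpM2r// lerDl.
have cJ : continuous (J : 'M[R]_(Na, No) -> 'M[R]_(Na, No)).
  apply: (@lipschitz_cts _ _ _ _ ((No%:R * `|P0| + 1) * cN)) => [|X Y].
    exact: mulr_gt0.
  rewrite -raddfB/= (le_trans (PX _))// -mulrA ler_pM2l//.
have -> : 'd (field u) (0 : 'M[R]_(Na, No)) Z = J Z.
  have -> // : 'd (field u) (0 : 'M[R]_(Na, No)) = J :> (_ -> _).
  apply: diff_unique => //; apply/eqaddoP => e e0.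
  have e1 : 0 < e / (`|u| + 1) by rewrite divr_gt0// ltr_wpDl.
  have [r r0 Hr] := remainder_small (No := No) GamL e1.
  apply/nbhs_ballP; exists r => // X; rewrite -ball_normE/= sub0r normrN => Xr.
  have -> : (field u \o shift 0 - (cst (field u 0) + J)) X = u *: remainder a M Gam X.
    rewrite -[LHS]/(field u (X + 0) - (field u 0 + J X)) addr0 JE.
    rewrite /columnwise_field /remainder (colwise0 _ GamL.1).
    rewrite !scaler0 addr0 mul0mx add0r -mulmxBl opprD addrACA subrr add0r.
    by rewrite -scalerBr scalemxAl.
  rewrite normrZ; apply: (@le_trans _ _ (`|u| * (e / (`|u| + 1) * `|X|))).
    by rewrite ler_wpM2l// Hr// ltW.
  rewrite mulrA ler_wpM2r// mulrA ler_pdivrMr ?ltr_wpDl//.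
  by rewrite [leRHS]mulrC ler_wpM2r ?(ltW e0)// lerDl.
rewrite JE mulmxDl -!scalemxAl (proj1perp_id VZ) -mulmxA (proj1perp_id VZ).
rewrite mulmxDl mul_scalar_mx scalerDr scalerA addrA -scalerDl.
by [].
Qed.

Context {p : nat}.
Variables (mu : R) (v : 'cV[R]_Na) (w : 'rV[R]_Na) (T : 'M[R]_(p, Na)) (mu' : R).
Hypothesis dom : dominated M mu v w T mu'.
Hypothesis amu0 : 0 < a + mu.
Let us := d / (a + mu).

Let us0 : 0 < us. Proof. exact: divr_gt0. Qed.
Let dE : d = us * (a + mu). Proof. by rewrite /us divfK// gt_eqF. Qed.

Lemma kernel_at_critical : jacobian_kernel (field us) = tensor_perp1 v.
Proof.
apply/seteqP; split=> [Z [VZ]|_ [x xV <-]].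
  rewrite columnwise_field_diff//.
  have -> : (- d + us * a) *: Z + us *: (M *m Z) = us *: ((M - mu%:M) *m Z).
    rewrite mulmxBl mul_scalar_mx scalerBr scalerA addrC; congr (_ + _).
    by rewrite -scaleNr {1}dE; congr (_ *: _); ring.
  move/eqP; rewrite scaler_eq0 gt_eqF//= => /eqP MZ.
  have ZE : Z = v *m (w *m Z).
    move/(congr1 (mulmx (resolvent M mu v w))) : MZ.
    rewrite mulmx0 mulmxA (resolventE dom) mulmxBl mul1mx => /eqP.
    by rewrite subr_eq0 mulmxA => /eqP.
  exists (w *m Z) => //; have /opinion_spaceP := opinion_space_mull w VZ.
  exact.
have VX : opinion_space (v *m x).
  by apply: opinion_space_mull; apply/opinion_spaceP => i; rewrite ord1; exact: xV.
split=> //; rewrite columnwise_field_diff// mulmxA (dom_right dom) -scalemxAl.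
by rewrite scalerA -scalerDl {1}dE (_ : _ + _ = 0) ?scale0r//; ring.
Qed.

(** For an equilibrium, us (M - mu) Z is the sum of (u - us) (a + M) Z and the
    remainder, both o(|Z|); the resolvent turns this into a bound on
    Z - v (w Z). *)
Lemma equilibria_near_kernel e : 0 < e -> exists2 r, 0 < r &
  forall u Z, opinion_space Z -> `|u - us| <= r -> `|Z| <= r -> field u Z = 0 ->
    `|Z - v *m (w *m Z)| <= e * `|Z|.
Proof.
move=> e0; have [b b0 Hb] := mx_linear_bound No (resolvent M mu v w).
have [c c0 Hc] := mx_linear_bound No (a%:M + M).
pose e1 := e * us / 2 / b.
have e10 : 0 < e1 by rewrite !divr_gt0// mulr_gt0.
have us1 : 0 < us + 1 by rewrite addr_gt0.
have [r1 r10 Hr] := remainder_small (No := No) GamL (divr_gt0 e10 us1).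
exists (Num.min 1 (Num.min r1 (e1 / c))) => [|u Z VZ].
  by rewrite !lt_min ltr01 r10 divr_gt0.
rewrite !le_min => /and3P[u1 _ uc] /and3P[_ Zr _] eq0.
have key : us *: ((M - mu%:M) *m Z) =
    - ((u - us) *: ((a%:M + M) *m Z) + u *: remainder a M Gam Z).
  have := columnwise_field_split d a M Gam u VZ; rewrite eq0.
  rewrite mulmxBl mulmxDl !mul_scalar_mx => /esym/eqP.
  set N := M *m Z; set Q := remainder _ _ _ _ => eq1.
  have -> : us *: (N - mu *: Z) = - ((u - us) *: (a *: Z + N) + u *: Q) +
     ((- d + u * a) *: Z + u *: N + u *: Q).
    by rewrite {1}dE; apply/matrixP => i j; rewrite !mxE; ring.
  by rewrite (eqP eq1) addr0.
have ZE : Z - v *m (w *m Z) = us^-1 *: (resolvent M mu v w *m (us *: ((M - mu%:M) *m Z))).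
  rewrite -scalemxAr scalerA mulVf ?gt_eqF// scale1r [RHS]mulmxA (resolventE dom).
  by rewrite mulmxBl mul1mx mulmxA.
rewrite ZE normrZ gtr0_norm ?invr_gt0// key mulmxN normrN.
rewrite mulrC ler_pdivrMr// (le_trans (Hb _))//.
have u_le : `|u| <= us + 1.
  rewrite -[u](subrK us) (le_trans (ler_normD _ _))// addrC (gtr0_norm us0).
  by rewrite lerD2l.
have h1 : `|(u - us) *: ((a%:M + M) *m Z)| <= e1 * `|Z|.
  rewrite normrZ; apply: (@le_trans _ _ (e1 / c * (c * `|Z|))).
    by rewrite ler_pM.
  by rewrite mulrA divfK// gt_eqF.
have h2 : `|u *: remainder a M Gam Z| <= e1 * `|Z|.
  rewrite normrZ; apply: (@le_trans _ _ ((us + 1) * (e1 / (us + 1) * `|Z|))).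
    by rewrite ler_pM// Hr.
  by rewrite mulrA mulrCA divff ?gt_eqF// mulr1.
apply: (@le_trans _ _ (b * (e1 * `|Z| + e1 * `|Z|))).
  by rewrite ler_pM2l// (le_trans (ler_normD _ _))// lerD.
by rewrite le_eqVlt; apply/orP; left; apply/eqP; rewrite /e1; field; rewrite gt_eqF.
Qed.

End Bifurcation.

Section Branches.
Context {R : realType} {Na No : nat}.
Variables (f : R -> 'M[R]_(Na, No) -> 'M[R]_(Na, No)) (ustar : R).
Variables (us : R -> R) (Zs : R -> 'M[R]_(Na, No)).
Hypothesis br : bifurcation_branch f ustar us Zs.

Lemma branch_near r : 0 < r -> \forall s \near 0^'+,
  [/\ 0 < s < 1, `|us s - ustar| < r & `|Zs s| < r].
Proof.
move=> r0; case: br => -[cu cZ] u0 Z0 _.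
have zero_in : `[0, 1[%classic (0 : R) by rewrite /= in_itv/= lexx ltr01.
have nu : \forall s \near (0 : R), `[0, 1[%classic s -> `|ustar - us s| < r.
  have /subspace_continuousP/(_ 0 zero_in)/cvgrPdist_lt/(_ r r0) := cu.
  by rewrite near_withinE -u0.
have nZ : \forall s \near (0 : R), `[0, 1[%classic s -> `|Zs s| < r.
  have /subspace_continuousP/(_ 0 zero_in)/cvgrPdist_lt/(_ r r0) := cZ.
  rewrite near_withinE; apply: filterS => s sZ /sZ.
  by rewrite /from_subspace/= Z0 sub0r normrN.
near=> s; have s01 : 0 < s < 1.
  by apply/andP; split; near: s; [exact: nbhs_right_gt|exact: nbhs_right_lt].
have s01' : `[0, 1[%classic s by rewrite /= in_itv/=; case/andP: s01 => /ltW -> ->.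
split => //.
  by rewrite distrC; move: s01'; near: s; exact: cvg_within nu.
by move: s01'; near: s; exact: cvg_within nZ.
Unshelve. all: by end_near. Qed.

End Branches.

(** * A branch on which one option is set against all others *)

Section SimpleEigenvalueBranch.
Context {R : realType} {n p : nat}.
Variables (a : R) (M : 'M[R]_n) (N : 'cV[R]_n -> 'cV[R]_n).
Hypothesis NL : strict_diff0 N (a%:M + M).
Variables (mu : R) (v : 'cV[R]_n) (w : 'rV[R]_n) (T : 'M[R]_(p, n)) (mu' : R).
Hypothesis dom : dominated M mu v w T mu'.
Hypothesis amu0 : 0 < a + mu.
Notation L := (a%:M + M).
Notation B := (resolvent M mu v w).

Lemma cts_mulmx m q (K : 'M[R]_(m, n)) (X : R -> 'M[R]_(n, q)) :
  continuous X -> continuous (fun s => K *m X s).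
Proof.
move=> cX t; have [c c0 Hc] := mx_linear_bound q K.
apply: (@continuous_comp _ _ _ X (mulmx K)); first exact: cX.
by apply: (lipschitz_cts c0) => Y Z; rewrite -mulmxBr; exact: Hc.
Qed.

(** Bifurcation from a simple eigenvalue for the eigenvalue problem N y = k y.
    With y = tau (v + z), w z = 0 and k = a + mu + kap, dividing by tau leaves
      L (v + z) + rho(z) = (a + mu + kap) (v + z),   L = a + M,
    where rho is the rescaled superlinear part of N and small.  Pairing with w
    gives kap = w rho, and the complementary part is the fixed-point equation
      z = B (kap z - (1 - v w) rho),   B the resolvent,
    solved by contraction in the unit ball, with continuous dependence on the
    parameter s.  The map tau keeps the amplitude in the range where the strict
    differentiability estimate applies. *)
Lemma bifurcating_curve : exists (tau kap : R -> R) (z : R -> 'cV[R]_n),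
  [/\ [/\ continuous tau, continuous kap & continuous z],
      [/\ tau 0 = 0, kap 0 = 0, z 0 = 0 & forall s, 0 < s -> 0 < tau s] &
      forall s, [/\ `|kap s| <= (a + mu) / 2, w *m z s = 0 &
        N (tau s *: (v + z s)) = (a + mu + kap s) *: (tau s *: (v + z s))]].
Proof.
have [b b0 Hb] := mx_linear_bound 1 B.
have [cw cw0 Hw] := mx_linear_bound 1 w.
have [cL cL0 HL] := mx_linear_bound 1 L.
have [cp cp0 Hp] := mx_linear_bound 1 (1%:M - v *m w).
pose V := `|v| + 1.
have V1 : 1 <= V by rewrite lerDr.
have V0 : 0 < V by rewrite (lt_le_trans _ V1).
(* The three bounds on eps make the fixed-point map a contraction by 1/2 of the
   unit ball, keep |kap| below 1 (hence w z = 0), and keep a + mu + kap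
   positive. *)
pose eps := Num.min (2^-1 / (b * (2 * cw + cp) * V))
  (Num.min (2^-1 / (cw * V)) ((a + mu) / 2 / (cw * V))).
have cpw : 0 < 2 * cw + cp by rewrite addr_gt0// mulr_gt0.
have eps0 : 0 < eps.
  by rewrite !lt_min !divr_gt0 ?mulr_gt0 ?invr_gt0.
have eps1 : b * (2 * cw + cp) * V * eps <= 2^-1.
  rewrite mulrC -ler_pdivlMr; last by rewrite !mulr_gt0.
  by rewrite ge_min lexx.
have eps2 : cw * V * eps <= 2^-1.
  rewrite mulrC -ler_pdivlMr; last by rewrite !mulr_gt0.
  by rewrite !ge_min lexx orbT.
have eps3 : cw * V * eps <= (a + mu) / 2.
  rewrite mulrC -ler_pdivlMr; last by rewrite !mulr_gt0.
  by rewrite !ge_min lexx !orbT.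
have [N0 Ndiff] := NL; have [r r0 Hr] := Ndiff eps eps0.
pose s0 := r / V; have s00 : 0 < s0 by rewrite divr_gt0.
pose tau (s : R) : R := s0 * Num.min `|s| 1.
have tau_ge0 s : 0 <= tau s by rewrite mulr_ge0 ?(ltW s00)// le_min normr_ge0 ler01.
have tau_le s : tau s <= s0 by rewrite ler_piMr ?(ltW s00)// ge_min lexx orbT.
have ctau : continuous tau.
  move=> s; apply: cvgM; first exact: cvg_cst.
  by apply: continuous_min; [exact: cvg_norm|exact: cvg_cst].
have tau0 : tau 0 = 0 by rewrite /tau normr0 min_l ?mulr0.
have tau_gt0 s : 0 < s -> 0 < tau s.
  by move=> sp; rewrite mulr_gt0// lt_min ltr01 normr_gt0 gt_eqF.
(* The inverse of 0 is 0, so rho 0 = 0, which is also its limit at s = 0. *)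
pose rho (s : R) (x : 'cV[R]_n) :=
  (tau s)^-1 *: (N (tau s *: (v + x)) - L *m (tau s *: (v + x))).
have tvx e s (x : 'cV[R]_n) : `|x| <= 1 -> tau s * V <= e ->
    `|tau s *: (v + x)| <= e.
  move=> x1; apply: le_trans; rewrite normrZ ger0_norm// ler_wpM2l//.
  by rewrite (le_trans (ler_normD _ _))// lerD2l.
have tVr s : tau s * V <= r by rewrite -ler_pdivlMr.
have rho_lip s x y : `|x| <= 1 -> `|y| <= 1 ->
    `|rho s x - rho s y| <= eps * `|x - y|.
  move=> x1 y1; have [t0|t0] := eqVneq (tau s) 0.
    by rewrite /rho t0 invr0 !scale0r subrr normr0 mulr_ge0// ltW.
  have tp : 0 < tau s by rewrite lt_neqAle eq_sym t0 tau_ge0.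
  rewrite /rho -scalerBr normrZ gtr0_norm ?invr_gt0// mulrC ler_pdivrMr//.
  have := Hr _ _ (tvx r s x x1 (tVr s)) (tvx r s y y1 (tVr s)).
  set X := tau s *: (v + x); set Y := tau s *: (v + y).
  have XY : `|X - Y| = tau s * `|x - y|.
    by rewrite -scalerBr normrZ gtr0_norm// opprD addrACA subrr add0r.
  rewrite XY mulmxBr => H; set LX := L *m X in H *; set LY := L *m Y in H *.
  rewrite (_ : _ - _ = N X - N Y - (LX - LY)); last first.
    by apply/matrixP => i j; rewrite !mxE; ring.
  by rewrite (le_trans H)// mulrA mulrAC.
have rho_le e r1 s x : (forall x y, `|x| <= r1 -> `|y| <= r1 ->
      `|N x - N y - L *m (x - y)| <= e * `|x - y|) ->
    0 < e -> 0 <= r1 -> tau s * V <= r1 -> `|x| <= 1 -> `|rho s x| <= e * V.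
  move=> He e0 r10 tr x1; have [t0|t0] := eqVneq (tau s) 0.
    by rewrite /rho t0 invr0 !scale0r normr0 mulr_ge0// ltW.
  have tp : 0 < tau s by rewrite lt_neqAle eq_sym t0 tau_ge0.
  rewrite /rho normrZ gtr0_norm ?invr_gt0// mulrC ler_pdivrMr//.
  have := He _ 0 (tvx r1 s x x1 tr); rewrite normr0 N0 !subr0 => /(_ r10).
  move/le_trans; apply; rewrite -mulrA ler_pM2l// [leRHS]mulrC.
  exact: tvx.
have rho_bound s x : `|x| <= 1 -> `|rho s x| <= eps * V.
  by apply: rho_le Hr _ _ _ => //; exact: ltW.
have rho_small e : 0 < e -> exists2 t1, 0 < t1 & forall s x, `|x| <= 1 ->
    tau s <= t1 -> `|rho s x| <= e.
  move=> e0; have [r1 r10 Hr1] := Ndiff _ (divr_gt0 e0 V0).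
  exists (r1 / V) => [|s x x1]; first exact: divr_gt0.
  rewrite ler_pdivlMr// => tr.
  have := rho_le _ _ s x Hr1 (divr_gt0 e0 V0) (ltW r10) tr x1.
  by rewrite divfK// gt_eqF.
have rho_cts (x : R -> 'cV[R]_n) : continuous x -> (forall s, `|x s| <= 1) ->
    continuous (fun s => rho s (x s)).
  move=> cx x1 s; have [t0|t0] := eqVneq (tau s) 0.
    apply/cvgrPdist_le => e e0; have [t1 t10 Ht1] := rho_small e e0.
    have -> : rho s (x s) = 0 by rewrite /rho t0 invr0 !scale0r.
    near=> t; rewrite sub0r normrN Ht1 ?x1//.
    have -> : tau t = `|tau s - tau t| by rewrite t0 sub0r normrN ger0_norm.
    near: t; exact: (cvgrPdist_le _ _).1 (ctau s) _ t10.
  have cX : continuous (fun s => tau s *: (v + x s)).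
    move=> t; apply: cvgZ; first exact: ctau.
    by apply: cvgD; [exact: cvg_cst|exact: cx].
  have cLX : continuous (fun s => L *m (tau s *: (v + x s))).
    exact: cts_mulmx.
  have cNX : continuous (fun s => N (tau s *: (v + x s))).
    move=> t; apply/cvgrPdist_lt => e e0.
    have ee : 0 < e / (eps + cL) by rewrite divr_gt0// addr_gt0.
    near=> u.
    have : `|tau t *: (v + x t) - tau u *: (v + x u)| < e / (eps + cL).
      by near: u; exact: (cvgrPdist_lt _ _).1 (cX t) _ ee.
    have := Hr _ _ (tvx r t (x t) (x1 t) (tVr t)) (tvx r u (x u) (x1 u) (tVr u)).
    set X := tau t *: _; set Y := tau u *: _ => XY XYe.
    rewrite -[X in `|X|](subrK (L *m (X - Y))) (le_lt_trans (ler_normD _ _))//.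
    apply: (@le_lt_trans _ _ ((eps + cL) * `|X - Y|)).
      by rewrite mulrDl lerD// HL.
    by rewrite mulrC -ltr_pdivlMr// addr_gt0.
  apply: cvgZ; first by apply: cvgV => //; exact: ctau.
  by apply: cvgB; [exact: cNX|exact: cLX].
pose kp s x : R := (w *m rho s x) ord0 ord0.
have kp_le s x : `|x| <= 1 -> `|kp s x| <= cw * V * eps.
  move=> x1; rewrite (le_trans (ler_mx_entry _ _ _))// (le_trans (Hw _))//.
  by rewrite -mulrA ler_pM2l// [V * _]mulrC rho_bound.
have kp_lip s x y : `|x| <= 1 -> `|y| <= 1 ->
    `|kp s x - kp s y| <= cw * eps * `|x - y|.
  move=> x1 y1; have -> : kp s x - kp s y = (w *m (rho s x - rho s y)) ord0 ord0.
    by rewrite /kp mulmxBr [in RHS]mxE [X in _ = _ + X]mxE.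
  rewrite (le_trans (ler_mx_entry _ _ _))// (le_trans (Hw _))//.
  by rewrite -mulrA ler_pM2l// rho_lip.
pose Phi s x := B *m (kp s x *: x - (1%:M - v *m w) *m rho s x).
have Phi_bound s x : `|x| <= 1 -> `|Phi s x| <= 1.
  move=> x1; rewrite (le_trans (Hb _))//.
  apply: (@le_trans _ _ (b * (cw * V * eps + cp * (eps * V)))).
    rewrite ler_pM2l// (le_trans (ler_normB _ _))// lerD//.
      by rewrite normrZ -[leRHS]mulr1 ler_pM// kp_le.
    by rewrite (le_trans (Hp _))// ler_pM2l// rho_bound.
  apply: (@le_trans _ _ (b * (2 * cw + cp) * V * eps)); last first.
    by rewrite (le_trans eps1)// invf_le1// ler1n.
  have -> : b * (2 * cw + cp) * V * eps = b * (2 * (cw * V * eps) + cp * (eps * V)).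
    by ring.
  by rewrite ler_pM2l// lerD2r ler_peMl ?ler1n// ltW// !mulr_gt0.
have Phi_lip s x y : `|x| <= 1 -> `|y| <= 1 ->
    `|Phi s x - Phi s y| <= 2^-1 * `|x - y|.
  move=> x1 y1; have -> : Phi s x - Phi s y = B *m (kp s x *: (x - y) +
      (kp s x - kp s y) *: y - (1%:M - v *m w) *m (rho s x - rho s y)).
    rewrite /Phi -mulmxBr; congr (_ *m _); rewrite mulmxBr.
    set X := _ *m rho s x; set Y := _ *m rho s y.
    by apply/matrixP => i j; rewrite !mxE; ring.
  rewrite (le_trans (Hb _))//.
  apply: (@le_trans _ _ (b * (cw * V * eps * `|x - y| + cw * eps * `|x - y| +
     cp * (eps * `|x - y|)))).
    rewrite ler_pM2l// (le_trans (ler_normB _ _))// lerD//.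
      rewrite (le_trans (ler_normD _ _))// lerD//.
        by rewrite normrZ ler_wpM2r// kp_le.
      by rewrite normrZ -[leRHS]mulr1 ler_pM// kp_lip.
    by rewrite (le_trans (Hp _))// ler_pM2l// rho_lip.
  apply: (@le_trans _ _ (b * (2 * cw + cp) * V * eps * `|x - y|)); last first.
    by rewrite ler_wpM2r.
  have -> : b * (cw * V * eps * `|x - y| + cw * eps * `|x - y| +
     cp * (eps * `|x - y|)) = b * (cw * V + cw + cp) * (eps * `|x - y|) by ring.
  rewrite -[b * _ * V * eps * _]mulrA ler_wpM2r ?mulr_ge0 ?(ltW eps0)//.
  rewrite -[b * _ * V]mulrA ler_pM2l//.
  have h1 : cw <= cw * V by rewrite ler_peMr// ltW.
  have h2 : cp <= cp * V by rewrite ler_peMr// ltW.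
  by nra.
pose zs k (s : R) := iter k (Phi s) 0.
have zs1 k s : `|zs k s| <= 1.
  elim: k => [|k IH]; first by rewrite normr0 ler01.
  exact: Phi_bound.
have zsK k s : `|zs k.+1 s - zs k s| <= 1 * 2^-1 ^+ k.
  elim: k => [|k IH]; first by rewrite expr0 mulr1 subr0 zs1.
  apply: (le_trans (Phi_lip s _ _ (zs1 k.+1 s) (zs1 k s))).
  by rewrite exprS mulrCA ler_pM2l ?invr_gt0.
have [z Hz] := geometric_limit zsK.
have z1 s : `|z s| <= 1.
  apply/ler_addgt0Pl => e e0; have [k Hk] := half_pow_small 2 e0.
  rewrite -(subrK (zs k s) (z s)) (le_trans (ler_normD _ _))// lerD//.
  by rewrite (le_trans (Hz k s))// mulr1 ltW.
have kp_cts (x : R -> 'cV[R]_n) : continuous x -> (forall s, `|x s| <= 1) ->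
    continuous (fun s => kp s (x s)).
  move=> cx x1 s; apply: (@cts_entry R _ _ _ (fun s => w *m rho s (x s))).
  by apply: cts_mulmx; exact: rho_cts.
have zs_cts k : continuous (zs k).
  elim: k => [|k IH]; first by move=> s; exact: cvg_cst.
  apply: cts_mulmx => s; apply: cvgB.
    by apply: cvgZ; [exact: (kp_cts _ IH (zs1 k))|exact: IH].
  by apply: cts_mulmx; exact: (rho_cts _ IH (zs1 k)).
have z_cts : continuous z.
  apply: locally_uniform_limit_cts zs_cts Hz => s; exact: cvg_cst.
have zfix s : z s = Phi s (z s).
  apply/eqP; rewrite -subr_eq0 -normr_le0; apply/ler_addgt0Pl => e e0.
  have [k Hk] := half_pow_small 2 e0; rewrite addr0 (le_trans _ (ltW Hk))//.
  rewrite -(subrKA (zs k.+1 s)) (le_trans (ler_normD _ _))//.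
  have h1 := Hz k.+1 s; have h2 := Phi_lip s (zs k s) (z s) (zs1 k s) (z1 s).
  have h3 := Hz k s; rewrite distrC in h3.
  rewrite mulr1 exprS in h1; rewrite mulr1 in h3.
  have h4 : 2^-1 * `|zs k s - z s| <= 2^-1 * (2 * 2^-1 ^+ k).
    by rewrite ler_pM2l// invr_gt0.
  rewrite (splitr (2 * 2^-1 ^+ k)) lerD//.
    by apply: (le_trans h1); rewrite le_eqVlt; apply/orP; left; apply/eqP; field.
  apply: (le_trans h2); apply: (le_trans h4).
  by rewrite le_eqVlt; apply/orP; left; apply/eqP; field.
have rho00 x : rho 0 x = 0 by rewrite /rho tau0 invr0 !scale0r.
have z00 : z 0 = 0.
  by rewrite zfix /Phi /kp rho00 !mulmx0 mxE scale0r subr0 mulmx0.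
exists tau, (fun s => kp s (z s)), z; split.
- by split => //; exact: kp_cts.
- by split => //; rewrite /kp rho00 mulmx0 mxE.
move=> s; have ks := kp_le s (z s) (z1 s); set k := kp s (z s).
have PwE : w *m (1%:M - v *m w) = 0.
  by rewrite mulmxBr mulmx1 mulmxA (dom_wv dom) mul1mx subrr.
(* The fixed-point equation gives w z = k w z, and |k| <= 1/2. *)
have wz : w *m z s = 0.
  have : w *m z s = k *: (w *m z s).
    rewrite {1}zfix /Phi mulmxA (resolvent_left dom) mulmxBr mulmxA PwE mul0mx.
    by rewrite subr0 -scalemxAr.
  move/eqP; rewrite -subr_eq0 -{1}[w *m z s]scale1r -scalerBl scaler_eq0.
  rewrite subr_eq0 => /orP[/eqP k1|/eqP//].
  have := le_trans ks eps2; rewrite -/k -k1 normr1 => h.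
  by exfalso; lra.
split=> //; first exact: le_trans ks eps3.
have Meq : (M - mu%:M) *m z s = k *: z s - (1%:M - v *m w) *m rho s (z s).
  have : (M - mu%:M + v *m w) *m z s = k *: z s - (1%:M - v *m w) *m rho s (z s).
    by rewrite {1}zfix /Phi mulKVmx// (dom_unit dom).
  by rewrite [X in X = _ -> _]mulmxDl -[v *m w *m z s]mulmxA wz mulmx0 addr0.
have wrho : w *m rho s (z s) = k%:M.
  by apply/matrixP => i j; rewrite !ord1 [RHS]mxE eqxx mulr1n.
have core : L *m (v + z s) + rho s (z s) = (a + mu + k) *: (v + z s).
  have Lv : L *m v = (a + mu) *: v.
    by rewrite mulmxDl mul_scalar_mx (dom_right dom) scalerDl.
  have Lz : L *m z s = (a + mu) *: z s + (M - mu%:M) *m z s.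
    rewrite mulmxDl mulmxBl !mul_scalar_mx scalerDl -addrA; congr (_ + _).
    by rewrite addrC subrK.
  rewrite mulmxDr Lv Lz Meq mulmxBl mul1mx -mulmxA wrho mul_mx_scalar.
  set Q := rho s (z s).
  by apply/matrixP => i j; rewrite !mxE; ring.
have [t0|t0] := eqVneq (tau s) 0; first by rewrite t0 !scale0r N0 scaler0.
transitivity (tau s *: ((a + mu + k) *: (v + z s))); last first.
  by apply/matrixP => i j; rewrite !mxE -/k; ring.
rewrite -core [RHS]scalerDr /rho [in RHS]scalerA mulfV// scale1r.
by rewrite [tau s *: (_ *m _)]scalemxAr [RHS]addrC subrK.
Unshelve. all: by end_near. Qed.

End SimpleEigenvalueBranch.

Section SymmetricBranch.
Context {R : realType} {Na No p : nat}.
Variables (d a : R) (M : 'M[R]_Na) (Gam : 'cV[R]_Na -> 'cV[R]_Na).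
Hypotheses (d0 : 0 < d) (GamL : strict_diff0 Gam (a%:M + M)).
Hypothesis No1 : (1 < No)%N.
Variables (mu : R) (v : 'cV[R]_Na) (w : 'rV[R]_Na) (T : 'M[R]_(p, Na)) (mu' : R).
Hypothesis dom : dominated M mu v w T mu'.
Hypothesis amu0 : 0 < a + mu.
Notation P0 := (proj1perp R No).
Local Notation field := (@columnwise_field R Na No d Gam).

Let j0 : 'I_No := Ordinal (ltnW No1).

Definition one_versus_all : 'rV[R]_No := \row_j (No%:R * (j == j0)%:R - 1).

Let No_neq0 : No%:R != 0 :> R.
Proof. by rewrite pnatr_eq0 -lt0n ltnW. Qed.

Lemma one_versus_all_perp1 : perp1 one_versus_all.
Proof.
rewrite /perp1/=; under eq_bigr do rewrite mxE.
rewrite sumrB -big_distrr/= (bigD1 j0)//= big1 ?addr0; last first.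
  by move=> j /negPf ->.
by rewrite mulr1 sumr_const card_ord subrr.
Qed.

Lemma one_versus_all_neq0 : one_versus_all != 0.
Proof.
apply/eqP => /matrixP/(_ ord0 j0)/eqP; rewrite !mxE eqxx mulr1 subr_eq0.
by rewrite (eqr_nat R No 1) gtn_eqF.
Qed.

(** The field acts on states y (x) [one_versus_all] through this map: Gam takes
    only two values on their columns, at (No - 1) y and at - y, and P_0 maps a
    matrix with two kinds of columns to a multiple of the same pattern. *)
Definition reduced (y : 'cV[R]_Na) : 'cV[R]_Na :=
  No%:R^-1 *: (Gam ((No%:R - 1) *: y) - Gam (- y)).

Lemma colwise_reduced (y : 'cV[R]_Na) :
  colwise Gam (y *m one_versus_all) *m P0 = reduced y *m one_versus_all.
Proof.
apply/matrixP => i j; rewrite mul_proj1perp.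
pose g0 := Gam ((No%:R - 1) *: y) i ord0; pose g1 := Gam (- y) i ord0.
have GE l : colwise Gam (y *m one_versus_all) i l = g1 + (l == j0)%:R * (g0 - g1).
  rewrite mxE (_ : col l _ = (No%:R * (l == j0)%:R - 1) *: y); last first.
    by apply/matrixP => k m; rewrite (ord1 m) !mxE big_ord1 !mxE mulrC.
  case: (l == j0); first by rewrite mulr1 mul1r [RHS]addrC subrK.
  by rewrite mulr0 sub0r scaleN1r mul0r addr0.
under eq_bigr do rewrite GE.
rewrite GE big_split/= sumr_const card_ord -big_distrl/= (bigD1 j0)//=.
rewrite big1 ?addr0; last by move=> l /negPf ->.
have redE : reduced y i ord0 = No%:R^-1 * (g0 - g1) by rewrite !mxE.
rewrite [RHS]mxE big_ord1 redE mxE -[g1 *+ No]mulr_natl; field.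
exact: No_neq0.
Qed.

Lemma reduced_strict_diff : strict_diff0 reduced (a%:M + M).
Proof.
have [G0 Gd] := GamL; split.
  by rewrite /reduced scaler0 oppr0 subrr scaler0.
have c0 : 0 <= No%:R - 1 :> R by rewrite subr_ge0 ler1n ltnW.
have N0 : 0 < No%:R :> R by rewrite ltr0n ltnW.
move=> e e0; have [r r0 Hr] := Gd e e0; exists (r / No%:R) => [|x y xr yr].
  exact: divr_gt0.
rewrite ler_pdivlMr// in xr; rewrite ler_pdivlMr// in yr.
have rN (z : 'cV[R]_Na) : `|z| * No%:R <= r -> `|(No%:R - 1) *: z| <= r /\ `|- z| <= r.
  move=> zr; rewrite normrN normrZ ger0_norm//; split; apply: le_trans zr.
    by rewrite mulrC ler_wpM2l// gerBl.
  by rewrite ler_peMr// ler1n ltnW.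
have [x1 x2] := rN x xr; have [y1 y2] := rN y yr.
have H1 := Hr _ _ x1 y1; have H2 := Hr _ _ x2 y2.
have -> : reduced x - reduced y - (a%:M + M) *m (x - y) = No%:R^-1 *:
   ((Gam ((No%:R - 1) *: x) - Gam ((No%:R - 1) *: y) -
      (a%:M + M) *m ((No%:R - 1) *: x - (No%:R - 1) *: y)) -
    (Gam (- x) - Gam (- y) - (a%:M + M) *m (- x - (- y)))).
  have -> : (No%:R - 1) *: x - (No%:R - 1) *: y = (No%:R - 1) *: (x - y).
    by rewrite scalerBr.
  rewrite -[- x - - y]opprD mulmxN -scalemxAr /reduced.
  set X := _ *m (x - y); apply/matrixP => i j; rewrite !mxE; field.
  exact: No_neq0.
rewrite normrZ gtr0_norm ?invr_gt0// mulrC ler_pdivrMr//.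
rewrite (le_trans (ler_normB _ _))// (le_trans (lerD H1 H2))//.
rewrite -scalerBr normrZ ger0_norm// -[- x - - y]opprD normrN.
by rewrite le_eqVlt; apply/orP; left; apply/eqP; ring.
Qed.

(** On such states an equilibrium is a solution of d y = u reduced(y), that is, an
    eigenvalue problem with k = d / u, which [bifurcating_curve] solves. *)
Lemma bifurcation_branch_exists : exists us Zs,
  bifurcation_branch field (d / (a + mu)) us Zs /\
  tangent_to (line (v *m one_versus_all)) Zs.
Proof.
have [tau [kap [z [[ctau ckap cz] [tau0 kap0 z0 taup] H]]]] :=
  bifurcating_curve reduced_strict_diff dom amu0.
set e := one_versus_all.
have e0 : e != 0 := one_versus_all_neq0.
pose us (s : R) := d / (a + mu + kap s).
pose Zs (s : R) := (tau s *: (v + z s)) *m e.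
have ak0 s : 0 < a + mu + kap s.
  have [ks _ _] := H s; have := ler_norm (- kap s).
  rewrite normrN => h; rewrite -[kap s]opprK subr_gt0.
  rewrite (le_lt_trans h)// (le_lt_trans ks)// ltr_pdivrMr// ltr_pMr//.
  by rewrite ltr1n.
have wZ s : w *m Zs s = tau s *: e.
  have [_ wz _] := H s; rewrite /Zs mulmxA -scalemxAr mulmxDr wz addr0.
  by rewrite (dom_wv dom) -scalemxAl mul1mx.
have VZ s : opinion_space (Zs s).
  apply: opinion_space_mull; apply/opinion_spaceP => i; rewrite ord1.
  exact: one_versus_all_perp1.
exists us, Zs; split.
  split.
  - split; apply: continuous_subspaceT; last first.
      apply: cts_mx => i j.
      have -> : (fun s => Zs s i j) = (fun s => (tau s *: (v + z s)) i ord0 * e ord0 j).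
        by apply/funext => s; rewrite /Zs mxE big_ord1.
      have cX : continuous (fun s => tau s *: (v + z s)).
        move=> s; apply: cvgZ; first exact: ctau.
        by apply: cvgD; [exact: cvg_cst|exact: cz].
      move=> s; apply: cvgM; last exact: cvg_cst.
      exact: (@cts_entry R _ _ _ _ i ord0 cX s).
    move=> s; apply: cvgM; first exact: cvg_cst.
    apply: cvgV; first by rewrite gt_eqF.
    by apply: cvgD; [exact: cvg_cst|exact: ckap].
  - by rewrite /us kap0 addr0.
  - by rewrite /Zs tau0 scale0r mul0mx.
  move=> s /andP[s0 _]; have [_ _ eqs] := H s; split; first exact: VZ.
    apply: contraNneq e0 => Z0; have := wZ s; rewrite Z0 mulmx0 => /esym/eqP.
    by rewrite scaler_eq0 gt_eqF//= taup.
  rewrite /columnwise_field mulmxDl -!scalemxAl (proj1perp_id (VZ s)).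
  rewrite colwise_reduced eqs -scalemxAl scalerA /us divfK ?gt_eqF//.
  by rewrite -scalerDl addNr scale0r.
move=> eps eps0.
have [cw cw0 Hw] := mx_linear_bound No w.
near=> s.
exists (tau s *: (v *m e)); first by exists (tau s).
have -> : Zs s - tau s *: (v *m e) = z s *m (w *m Zs s).
  rewrite wZ /Zs -scalemxAr -scalemxAl -scalerBr mulmxDl addrC addKr.
  by [].
rewrite (le_trans (ler_mx_normM _ _))// mul1r.
apply: (@le_trans _ _ (eps / cw * (cw * `|Zs s|))).
  rewrite ler_pM//.
  have -> : `|z s| = `|z 0 - z s| by rewrite z0 sub0r normrN.
  near: s; apply: cvg_within.
  exact: (cvgrPdist_le _ _).1 (cz 0) _ (divr_gt0 eps0 cw0).
by rewrite mulrA divfK// gt_eqF.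
Unshelve. all: by end_near. Qed.

End SymmetricBranch.

(** * Spectral gap of a strongly connected graph *)

Section PerronFrobenius.
Context {R : realType} {n : nat}.
Variables (g : rel 'I_n) (lam : R) (v : 'cV[R]_n).
Hypotheses (g_conn : strongly_connected g) (lam0 : 0 < lam).
Local Notation A := (adjacency R g).
Hypotheses (Av : A *m v = lam *: v) (v0 : forall i, 0 < v i ord0).
Hypothesis lamE : eigenvalue A lam.

(** The entrywise absolute value x of a left eigenvector satisfies
    x A >= lam x.  Pairing with the positive v makes both sides equal, so x is a
    left eigenvector, and positivity of an entry spreads along the edges. *)
Lemma positive_left_eigenvector : exists w : 'rV[R]_n,
  [/\ w *m A = lam *: w, w *m v = 1%:M & forall i, 0 < w ord0 i].
Proof.
have /eigenvalueP[w0 w0A w0N0] := lamE.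
pose x : 'rV[R]_n := \row_j `|w0 ord0 j|.
have x_ge0 j : 0 <= x ord0 j by rewrite mxE.
have A_ge0 i k : 0 <= A i k by rewrite mxE ler0n.
pose del k := (x *m A) ord0 k - lam * x ord0 k.
have del0 k : 0 <= del k.
  rewrite subr_ge0 [x ord0 k]mxE -(gtr0_norm lam0) -normrM.
  have -> : lam * w0 ord0 k = (w0 *m A) ord0 k by rewrite w0A mxE.
  rewrite mxE (le_trans (ler_norm_sum _ _ _))// mxE; apply: ler_sum => i _.
  by rewrite normrM [x _ _]mxE (ger0_norm (A_ge0 _ _)).
have : \sum_k del k * v k ord0 = 0.
  have -> : \sum_k del k * v k ord0 = ((x *m A - lam *: x) *m v) ord0 ord0.
    by rewrite [RHS]mxE; apply: eq_bigr => k _; rewrite /del !mxE.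
  by rewrite mulmxBl -mulmxA Av -scalemxAr -scalemxAl subrr mxE.
move/eqP; rewrite psumr_eq0 => [/allP delv|k _]; last by rewrite mulr_ge0// ltW.
have xA : x *m A = lam *: x.
  apply/matrixP => i k; rewrite ord1 [RHS]mxE; apply/eqP; rewrite -subr_eq0.
  by have := delv k (mem_index_enum _); rewrite /= mulf_eq0 (gt_eqF (v0 k)) orbF.
have [j xj] : exists j, 0 < x ord0 j.
  move: w0N0; apply: contra_neqP => /forallNP H; apply/matrixP => i j.
  apply/eqP; rewrite ord1 [X in _ == X]mxE -normr_le0 leNgt; apply/negP.
  by have := H j; rewrite mxE.
have step i k : 0 < x ord0 i -> g i k -> 0 < x ord0 k.
  move=> xi gik; have : (x *m A) ord0 k = lam * x ord0 k by rewrite xA mxE.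
  rewrite mxE (bigD1 i)//= [A i k]mxE gik mulr1 => H.
  rewrite -(pmulr_rgt0 _ lam0) -H ltr_wpDr//; apply: sumr_ge0 => l _.
  by rewrite mulr_ge0.
have xp k : 0 < x ord0 k.
  have /connectP[s] := g_conn j k.
  elim: s j xj => [|a s IH] j xj /=; first by move=> _ ->.
  by case/andP => gja; apply: IH; exact: step gja.
have xv : 0 < (x *m v) ord0 ord0.
  rewrite mxE (bigD1 j)//= ltr_wpDr ?mulr_gt0//.
  by apply: sumr_ge0 => l _; rewrite mulr_ge0// ltW.
exists (((x *m v) ord0 ord0)^-1 *: x); split.
- by rewrite -scalemxAl xA !scalerA mulrC.
- rewrite -scalemxAl; apply/matrixP => i k; rewrite !ord1 [LHS]mxE [RHS]mxE eqxx.
  by rewrite mulVf ?gt_eqF.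
- by move=> i; rewrite mxE mulr_gt0// invr_gt0.
Qed.

(** The energy bounds the increment of y along each edge by e = sqrt (D / b0).
    Two vertices are joined by a path with fewer than n edges, so all increments
    are at most n e; so are all values, y having mean zero. *)
Lemma dirichlet_poincare (b : 'I_n -> 'I_n -> R) (pi : 'I_n -> R) (b0 : R) :
  0 < b0 -> (forall i k, 0 <= b i k) -> (forall i k, g i k -> b0 <= b i k) ->
  (forall i, 0 <= pi i) -> \sum_i pi i = 1 ->
  forall y : 'I_n -> R, \sum_i pi i * y i = 0 ->
  b0 / n%:R ^+ 2 * (\sum_i pi i * y i ^+ 2) <=
    \sum_i \sum_k b i k * (y i - y k) ^+ 2.
Proof.
move=> b00 b_ge0 bg pi0 pi1 y piy; set D := \sum_i _.
have D0 : 0 <= D.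
  apply: sumr_ge0 => i _; apply: sumr_ge0 => k _.
  by rewrite mulr_ge0// sqr_ge0.
pose e := Num.sqrt (D / b0).
have e0 : 0 <= e by rewrite sqrtr_ge0.
have e2 : e ^+ 2 = D / b0 by rewrite sqr_sqrtr// divr_ge0// ltW.
have edge i k : g i k -> `|y i - y k| <= e.
  move=> gik; rewrite -(@ler_pXn2r _ 2)// ?nnegrE// e2 ler_pdivlMr//.
  rewrite -normrX ger0_norm ?sqr_ge0//.
  apply: (@le_trans _ _ (b i k * (y i - y k) ^+ 2)).
    by rewrite mulrC ler_wpM2r ?sqr_ge0// bg.
  rewrite /D (bigD1 i)//= (bigD1 k)//= -addrA lerDl addr_ge0//.
    by apply: sumr_ge0 => l _; rewrite mulr_ge0// sqr_ge0.
  apply: sumr_ge0 => l _; apply: sumr_ge0 => m _.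
  by rewrite mulr_ge0// sqr_ge0.
have along s i : path g i s -> `|y i - y (last i s)| <= (size s)%:R * e.
  elim: s i => [|k s IH] i /=; first by rewrite subrr normr0 mul0r.
  case/andP => gik ps; rewrite -(subrKA (y k)) (le_trans (ler_normD _ _))//.
  by rewrite -natr1 mulrDl mul1r addrC lerD ?edge ?IH.
have diam i k : `|y i - y k| <= n%:R * e.
  have /connectP[s ps ->] := g_conn i k.
  case/shortenP: ps => s' ps' us' _; apply: (le_trans (along _ _ ps')).
  rewrite ler_wpM2r// ler_nat; have := card_uniqP us'; rewrite /= => sE.
  rewrite -ltnS -sE; apply: (leq_trans (max_card _)).
  by rewrite card_ord.
have wavg (f : 'I_n -> R) c : (forall i, f i <= c) -> \sum_i pi i * f i <= c.
  move=> fc; apply: (@le_trans _ _ (\sum_i pi i * c)).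
    by apply: ler_sum => i _; rewrite ler_wpM2l.
  by rewrite -big_distrl/= pi1 mul1r.
have yle i : `|y i| <= n%:R * e.
  have -> : y i = \sum_k pi k * (y i - y k).
    under eq_bigr do rewrite mulrBr.
    by rewrite sumrB -big_distrl/= pi1 mul1r piy subr0.
  rewrite (le_trans (ler_norm_sum _ _ _))//.
  under eq_bigr do rewrite normrM (ger0_norm (pi0 _)).
  by apply: wavg => k; exact: diam.
have [n0|n0] := posnP n.
  by rewrite /D !big1 ?mulr0// => i; have := ltn_ord i; rewrite [X in (_ < X)%N]n0.
have nn : 0 < n%:R ^+ 2 :> R by rewrite exprn_gt0// ltr0n.
apply: (@le_trans _ _ (b0 / n%:R ^+ 2 * (n%:R * e) ^+ 2)).
  rewrite ler_wpM2l ?divr_ge0 ?(ltW b00) ?(ltW nn)//.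
  by apply: wavg => k; rewrite -real_normK ?num_real// ler_pXn2r// nnegrE mulr_ge0.
rewrite exprMn e2 le_eqVlt; apply/orP; left; apply/eqP; field.
by rewrite (gt_eqF b00) pnatr_eq0 -lt0n n0.
Qed.

(** For c = x - v (w x) put y_i = c_i / v_i, pi_i = w_i v_i and
    b_ik = w_i A_ik v_k.  With T = diag (sqrt (w_i / v_i)) (1 - v w) the form
    |T x|^2 is the sum of the pi_i y_i^2 and its polarization at (x, A x) the sum
    of the b_ik y_i y_k.  The row and column sums of b are lam pi, so the latter is
    lam |T x|^2 minus half the Dirichlet form of b, and w c = 0 says that y has
    mean zero. *)
Lemma perron_dominated : exists (w : 'rV[R]_n) (T : 'M[R]_n) (mu' : R),
  dominated A lam v w T mu' /\ forall i, 0 < w ord0 i.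
Proof.
have [w [wA wv w0]] := positive_left_eigenvector.
have [mw mw0 Hmw] := pos_lower_bound w0.
have [mv mv0 Hmv] := pos_lower_bound v0.
pose b0 := mw * mv; have b00 : 0 < b0 by rewrite mulr_gt0.
pose q : 'rV[R]_n := \row_i Num.sqrt (w ord0 i / v i ord0).
have q0 i : 0 < w ord0 i / v i ord0 by rewrite divr_gt0.
pose Pi : 'M[R]_n := 1%:M - v *m w.
pose T := diag_mx q *m Pi.
pose eta := b0 / n%:R ^+ 2 / 2.
exists w, T, (lam - eta); split => //; split => //.
- have n0 : (0 < n)%N.
    have /eigenvalueP[z _] := lamE; apply: contra_neqT.
    rewrite -eqn0Ngt => /eqP n0; apply/matrixP => i j.
    by have := ltn_ord j; rewrite [X in (_ < X)%N]n0.
  by rewrite ltrBlDr ltrDl !divr_gt0// exprn_gt0// ltr0n.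
- move=> x; pose c := Pi *m x; pose y i := c i ord0 / v i ord0.
  have wc : w *m c = 0.
    by rewrite mulmxA mulmxBr mulmx1 mulmxA wv mul1mx subrr mul0mx.
  have TxE k : (T *m x) k ord0 = q ord0 k * c k ord0.
    by rewrite /T -mulmxA mul_diag_mx mxE.
  have PiA : Pi *m A = A *m Pi.
    rewrite mulmxBl mulmxBr mul1mx mulmx1 -mulmxA wA mulmxA Av.
    by rewrite -scalemxAr -scalemxAl.
  have TAxE k : (T *m (A *m x)) k ord0 = q ord0 k * (A *m c) k ord0.
    by rewrite /T -!mulmxA [Pi *m (A *m x)]mulmxA PiA -mulmxA mul_diag_mx mxE.
  have qq k : q ord0 k * q ord0 k = w ord0 k / v k ord0.
    by rewrite -expr2 mxE sqr_sqrtr// ltW.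
  have cE k : c k ord0 = v k ord0 * y k by rewrite /y mulrC divfK// gt_eqF.
  pose pi i := w ord0 i * v i ord0; pose b i k := w ord0 i * A i k * v k ord0.
  have form0 : \sum_k (T *m x) k ord0 * (T *m x) k ord0 = \sum_i pi i * y i ^+ 2.
    apply: eq_bigr => k _; rewrite TxE mulrACA qq cE /pi.
    by field; rewrite gt_eqF.
  have form1 : \sum_k (T *m x) k ord0 * (T *m (A *m x)) k ord0 =
      \sum_i \sum_k b i k * (y i * y k).
    apply: eq_bigr => i _; rewrite TxE TAxE mulrACA qq [(A *m c) _ _]mxE !big_distrr/=.
    apply: eq_bigr => k _; rewrite !cE /b.
    by field; rewrite gt_eqF.
  have brow i : \sum_k b i k = lam * pi i.
    have := congr1 (fun X : 'cV[R]_n => X i ord0) Av; rewrite mxE [in RHS]mxE => H.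
    by rewrite /pi mulrCA -H big_distrr/=; apply: eq_bigr => k _; rewrite /b mulrA.
  have bcol k : \sum_i b i k = lam * pi k.
    have := congr1 (fun X : 'rV[R]_n => X ord0 k) wA; rewrite mxE [in RHS]mxE => H.
    by rewrite /pi mulrA -H big_distrl/=.
  have piy : \sum_i pi i * y i = 0.
    have := congr1 (fun X : 'M[R]_1 => X ord0 ord0) wc; rewrite mxE [in RHS]mxE => H.
    by rewrite -[RHS]H; apply: eq_bigr => k _; rewrite cE mulrA.
  have pi1 : \sum_i pi i = 1.
    have := congr1 (fun X : 'M[R]_1 => X ord0 ord0) wv; rewrite mxE [in RHS]mxE eqxx.
    exact.
  have b_ge0 i k : 0 <= b i k.
    by rewrite !mulr_ge0 ?(ltW (w0 _)) ?(ltW (v0 _))// mxE ler0n.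
  have bg i k : g i k -> b0 <= b i k.
    by move=> gik; rewrite /b [A i k]mxE gik mulr1 ler_pM ?(ltW mw0) ?(ltW mv0).
  have pi_ge0 i : 0 <= pi i by rewrite mulr_ge0 ?(ltW (w0 _)) ?(ltW (v0 _)).
  have := dirichlet_poincare b00 b_ge0 bg pi_ge0 pi1 piy.
  have -> : \sum_i \sum_k b i k * (y i - y k) ^+ 2 =
      2 * (lam * \sum_i pi i * y i ^+ 2) - 2 * \sum_i \sum_k b i k * (y i * y k).
    have -> : \sum_i \sum_k b i k * (y i - y k) ^+ 2 =
        \sum_i \sum_k b i k * y i ^+ 2 + \sum_i \sum_k b i k * y k ^+ 2 -
        2 * \sum_i \sum_k b i k * (y i * y k).
      rewrite -big_split/= big_distrr/= -sumrB; apply: eq_bigr => i _.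
      rewrite -big_split/= big_distrr/= -sumrB; apply: eq_bigr => k _; ring.
    congr (_ - _); rewrite mulr2n mulrDl mul1r; congr (_ + _).
      rewrite big_distrr/=; apply: eq_bigr => i _.
      by rewrite -big_distrl/= brow mulrA.
    rewrite exchange_big/= big_distrr/=; apply: eq_bigr => i _.
    by rewrite -big_distrl/= bcol mulrA.
  rewrite form0 form1 /eta; set P := \sum_i pi i * _; set Q := \sum_i \sum_k _.
  set bb := b0 / _ => H.
  by rewrite mulrBl; nra.
move=> x Tx wx; have Px : Pi *m x = 0.
  apply/matrixP => i j; rewrite ord1 [RHS]mxE.
  have := congr1 (fun X : 'cV[R]_n => X i ord0) Tx.
  rewrite /T -mulmxA mul_diag_mx mxE [in RHS]mxE => /eqP.
  rewrite mulf_eq0 [q _ _]mxE sqrtr_eq0 leNgt q0/= => /eqP; exact.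
by move: Px; rewrite mulmxBl mul1mx -mulmxA wx mulmx0 subr0.
Qed.

End PerronFrobenius.

(** * Spectral gap at a simple dominant eigenvalue *)

Section SimpleEigenvalue.
Context {F : fieldType}.

(** Write A - lam = L pid_r U with L, U invertible, r the rank, and t = X - lam.
    Then X - A = L (t G - pid_r) U with G = L^-1 U^-1, and the last n - r rows of
    t G - pid_r are divisible by t. *)
Lemma geometric_le_algebraic n (A : 'M[F]_n) (lam : F) :
  (('X - lam%:P) ^+ (n - \rank (A - lam%:M)) %| char_poly A)%R.
Proof.
set N := A - lam%:M; set r := \rank N; set t := 'X - lam%:P.
pose Lc := map_mx polyC (col_ebase N); pose Uc := map_mx polyC (row_ebase N).
have Lu : Lc \in unitmx by rewrite map_unitmx col_ebase_unit.
have Uu : Uc \in unitmx by rewrite map_unitmx row_ebase_unit.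
pose G := invmx Lc *m invmx Uc.
pose dg : 'rV[{poly F}]_n := \row_i (if (i < r)%N then 1 else t).
pose K := \matrix_(i, j) (if (i < r)%N then t * G i j - (i == j)%:R else G i j).
have cpE : char_poly_mx A = Lc *m (diag_mx dg *m K) *m Uc.
  have -> : diag_mx dg *m K = t *: G - pid_mx r.
    apply/matrixP => i j; rewrite mul_diag_mx !mxE; case: ltnP => ir.
      by rewrite mul1r andbT.
    by rewrite andbF subr0.
  rewrite mulmxBr mulmxBl -scalemxAr -scalemxAl /G mulmxA mulmxV// mul1mx.
  rewrite mulVmx// scalemx1.
  rewrite (_ : Lc *m pid_mx r *m Uc = map_mx polyC N); last first.
    by rewrite -[in RHS](mulmx_ebase N) !map_mxM map_pid_mx.
  rewrite /char_poly_mx /N /t map_mxB map_scalar_mx/= raddfB/= opprB addrA.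
  by rewrite subrK.
rewrite /char_poly cpE !det_mulmx det_diag.
rewrite dvdp_mulr// dvdp_mull// dvdp_mulr//.
rewrite (bigID (fun i : 'I_n => (i < r)%N))/= big1 ?mul1r; last first.
  by move=> i ir; rewrite mxE ir.
rewrite (eq_bigr (fun=> t)); last by move=> i /negPf ir; rewrite mxE ir.
rewrite prodr_const dvdp_exp2l//.
have -> : #|[pred i : 'I_n | ~~ (i < r)%N]| = (n - r)%N; last by [].
have := cardC [pred i : 'I_n | (i < r)%N]; rewrite card_ord.
have -> : #|[pred i : 'I_n | (i < r)%N]| = r.
  rewrite -sum1_card -(big_ord_widen n (fun=> 1%N)) ?sum_nat_const ?card_ord ?muln1//.
  exact: rank_leq_row.
move=> cardE; apply/eqP; rewrite -(eqn_add2l r) subnKC ?rank_leq_row//.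
by rewrite -[X in _ == X]cardE.
Qed.

(** Let q be the cofactor of X - lam in the characteristic polynomial.  By
    Cayley-Hamilton the columns of q(A) are eigenvectors, hence multiples of v, and
    z q(A) = q(lam) z is nonzero since lam is simple; z v = 0 would make it
    vanish. *)
Lemma simple_pairing n (A : 'M[F]_n) (lam : F) (z : 'rV[F]_n) (v : 'cV[F]_n) :
  mup lam (char_poly A) = 1%N -> z *m A = lam *: z -> z != 0 ->
  A *m v = lam *: v -> v != 0 -> z *m v != 0.
Proof.
case: n A z v => [|n] A z v simple zA z0 Av v0.
  by rewrite [v]flatmx0 eqxx in v0.
set N := A - lam%:M.
have cp0 : char_poly A != 0 by rewrite monic_neq0// char_poly_monic.
have Nv : N *m v = 0 by rewrite mulmxBl Av mul_scalar_mx subrr.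
have rk : (n.+1 - \rank N <= 1)%N.
  by rewrite -simple mup_geq//; exact: geometric_le_algebraic.
have [q qE] : exists q, char_poly A = q * ('X - lam%:P).
  by apply/dvdpP; rewrite XsubC_dvd// simple.
have q0 : q.[lam] != 0.
  apply/negP => /eqP q0; have : ('X - lam%:P) ^+ 2 %| char_poly A.
    by rewrite qE expr2 dvdp_mul// dvdp_XsubCl; apply/rootP.
  by rewrite -mup_geq// simple.
pose E := horner_mx A q.
have NE : N *m E = 0.
  have := Cayley_Hamilton A.
  by rewrite qE mulrC rmorphM rmorphB/= horner_mx_X horner_mx_C.
have zE : z *m E = q.[lam] *: z.
  have /factor_theorem[s sE] : root (q - q.[lam]%:P) lam.
    by rewrite rootE !hornerE subrr.
  have -> : E = N *m horner_mx A s + q.[lam]%:M.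
    rewrite /E -{1}(subrK q.[lam]%:P q) sE mulrC rmorphD rmorphM rmorphB/=.
    by rewrite horner_mx_X !horner_mx_C.
  rewrite mulmxDr mulmxA mulmxBr zA mul_mx_scalar subrr mul0mx add0r.
  by rewrite mul_mx_scalar.
have sub : (E^T <= v^T)%MS.
  have vK : (v^T <= kermx N^T)%MS by apply/sub_kermxP; rewrite -trmx_mul Nv trmx0.
  have EK : (E^T <= kermx N^T)%MS by apply/sub_kermxP; rewrite -trmx_mul NE trmx0.
  have : (v^T == kermx N^T)%MS.
    rewrite -(geq_leqif (mxrank_leqif_eq vK)) mxrank_ker !mxrank_tr.
    apply: (leq_trans rk); rewrite lt0n mxrank_eq0.
    exact: v0.
  by move/eqmxP => vE; rewrite vE.
have [D ED] := submxP sub.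
apply: contraNneq z0 => zv.
have : z *m E = 0.
  by rewrite -[E]trmxK ED trmx_mul trmxK mulmxA zv mul0mx.
by rewrite zE => /eqP; rewrite scaler_eq0 (negPf q0).
Qed.

End SimpleEigenvalue.

Section ComplexDecomposition.
Context {R : realType}.
Local Notation C := R[i].
Local Notation toC := (map_mx (real_complex R)).

Definition cmx m n (X Y : 'M[R]_(m, n)) : 'M[C]_(m, n) := toC X + 'i%C *: toC Y.

Lemma cmxE m n (P : 'M[C]_(m, n)) :
  P = cmx (map_mx (@complex.Re R) P) (map_mx (@complex.Im R) P).
Proof. by apply/matrixP => i j; rewrite !mxE -complexE. Qed.

Lemma cmx_inj m n (X Y X' Y' : 'M[R]_(m, n)) :
  cmx X Y = cmx X' Y' -> X = X' /\ Y = Y'.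
Proof.
move=> /matrixP H; split; apply/matrixP => i j; have := H i j; rewrite !mxE.
  by move/(congr1 (@complex.Re R)); rewrite /= !(mul0r, mul1r, mulr0, subr0, addr0).
by move/(congr1 (@complex.Im R)); rewrite /= !(mul0r, mul1r, mulr0, subr0, add0r, addr0).
Qed.

Lemma cmxM m n p (X Y : 'M[R]_(m, n)) (X' Y' : 'M[R]_(n, p)) :
  cmx X Y *m cmx X' Y' = cmx (X *m X' - Y *m Y') (X *m Y' + Y *m X').
Proof.
rewrite /cmx map_mxB map_mxD !map_mxM mulmxDl !mulmxDr -!scalemxAl -!scalemxAr.
rewrite scalerA scalerDr.
have -> : 'i%C * 'i%C = -1 :> C by rewrite -expr2 sqr_i.
by rewrite scaleN1r -!addrA; congr (_ + _); rewrite addrCA addrC -!addrA addrCA.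
Qed.

Lemma cmx_real m n (X : 'M[R]_(m, n)) : cmx X 0 = toC X.
Proof. by rewrite /cmx map_mx0 scaler0 addr0. Qed.

End ComplexDecomposition.

Section LyapunovForm.
Context {R : realType} {n : nat}.
Variables (M : 'M[R]_n) (mu : R).
Hypothesis n0 : (0 < n)%N.
Hypothesis spec : forall xi : R[i], complex_eigenvalue M xi -> complex.Re xi < mu.

(** The real and imaginary parts of P M = T P for a complex Schur form T, which is
    lower triangular in the convention used here. *)
Lemma real_schur_form : exists PR PI TR TI : 'M[R]_n,
  [/\ PR *m M = TR *m PR - TI *m PI, PI *m M = TR *m PI + TI *m PR,
      forall i j : 'I_n, (i < j)%N -> TR i j = 0 /\ TI i j = 0,
      forall i, TR i i < mu &
      forall x : 'cV[R]_n, PR *m x = 0 -> PI *m x = 0 -> x = 0].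
Proof.
set MC := map_mx (real_complex R) M.
have [P Punitary Ptrig] := Schur MC n0.
have Pu : P \in unitmx := unitarymx_unit Punitary.
pose Tr := conjmx P MC; have {}Ptrig : is_trig_mx Tr := Ptrig.
have PM : P *m MC = Tr *m P by rewrite /Tr conjumx// mulmxKV.
pose PR := map_mx (@complex.Re R) P; pose PI := map_mx (@complex.Im R) P.
pose TR := map_mx (@complex.Re R) Tr; pose TI := map_mx (@complex.Im R) Tr.
exists PR, PI, TR, TI.
have [eqR eqI] : PR *m M = TR *m PR - TI *m PI /\ PI *m M = TR *m PI + TI *m PR.
  apply: cmx_inj; rewrite -cmxM -!cmxE -PM [in RHS](cmxE P) /MC -cmx_real cmxM.
  by rewrite !mulmx0 subr0 add0r.
split => //.
- move=> i j ij; have T0 : Tr i j = 0 by move/is_trig_mxP : Ptrig; exact.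
  by split; rewrite mxE T0.
- move=> i; rewrite mxE; apply: spec; rewrite /complex_eigenvalue -/MC.
  apply: (eigenvalue_conjmx (V := P)).
  + exact: stablemx_unit.
  + by rewrite row_free_unit.
  rewrite -/Tr -topredE/= eigenvalue_root_char char_poly_trig// (bigD1 i)//=.
  by rewrite rootM root_XsubC eqxx.
move=> x xR xI.
have : P *m map_mx (real_complex R) x = 0.
  by rewrite (cmxE P) -cmx_real cmxM -/PR -/PI xR xI !mulmx0 subr0 addr0 cmx_real map_mx0.
move/(congr1 (mulmx (invmx P))); rewrite mulKmx// mulmx0 => /matrixP xC.
by apply/matrixP => i j; have := xC i j; rewrite !mxE => /(congr1 (@complex.Re R)).
Qed.

(** Apply P to a real x and scale the i-th coordinate by del^i: this multiplies
    the entries of T below the diagonal by at most del, while the real parts of the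
    diagonal entries stay at distance m from mu.  For small del the off-diagonal
    part costs at most half of that gap. *)
Lemma lyapunov_form : exists (K : 'M[R]_(n + n, n)) (mu' : R), [/\ mu' < mu,
  forall x : 'cV[R]_n, \sum_k (K *m x) k ord0 * (K *m (M *m x)) k ord0 <=
    mu' * \sum_k (K *m x) k ord0 * (K *m x) k ord0 &
  forall x : 'cV[R]_n, K *m x = 0 -> x = 0].
Proof.
have [PR [PI [TR [TI [eqR eqI trig diag inj]]]]] := real_schur_form.
have gap i : 0 < mu - TR i i by rewrite subr_gt0.
have [m m0 Hm] := pos_lower_bound gap.
pose c := `|TR| + `|TI|; have c0 : 0 <= c by rewrite addr_ge0.
pose del := Num.min 1 (m / 2 / (n.*2%:R * c + 1)).
have den0 : 0 < n.*2%:R * c + 1 by rewrite ltr_wpDl// mulr_ge0.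
have del0 : 0 < del by rewrite lt_min ltr01 !divr_gt0.
have del1 : del <= 1 by rewrite ge_min lexx.
have delm : n.*2%:R * c * del <= m / 2.
  apply: (@le_trans _ _ ((n.*2%:R * c + 1) * del)).
    by rewrite ler_wpM2r ?(ltW del0)// lerDl.
  by rewrite mulrC -ler_pdivlMr// ge_min lexx orbT.
pose dl : 'rV[R]_n := \row_i del ^+ i.
have dl0 i : 0 < dl ord0 i by rewrite mxE exprn_gt0.
pose K := col_mx (diag_mx dl *m PR) (diag_mx dl *m PI).
exists K, (mu - m / 2); split.
- by rewrite ltrBlDr ltrDl divr_gt0.
- move=> x; pose al i := dl ord0 i * (PR *m x) i ord0.
  pose be i := dl ord0 i * (PI *m x) i ord0.
  pose sg i j := dl ord0 i / dl ord0 j.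
  have KE (z : 'cV[R]_n) f : \sum_k (K *m z) k ord0 * f k =
      \sum_i (dl ord0 i * (PR *m z) i ord0 * f (lshift n i) +
              dl ord0 i * (PI *m z) i ord0 * f (rshift n i)).
    rewrite big_split_ord/= -big_split/=; apply: eq_bigr => i _.
    by rewrite /K mul_col_mx col_mxEu col_mxEd -!mulmxA !mul_diag_mx !mxE.
  have dlE i j : dl ord0 i = sg i j * dl ord0 j by rewrite /sg divfK// gt_eqF.
  have subE (X X' : 'cV[R]_n) i : (X - X') i ord0 = X i ord0 - X' i ord0.
    by rewrite !mxE.
  have addE (X X' : 'cV[R]_n) i : (X + X') i ord0 = X i ord0 + X' i ord0.
    by rewrite !mxE.
  have mulE (X : 'M[R]_n) (z : 'cV[R]_n) i :
      (X *m z) i ord0 = \sum_j X i j * z j ord0 by rewrite !mxE.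
  have RE1 i : (K *m (M *m x)) (lshift n i) ord0 =
      \sum_j sg i j * (TR i j * al j - TI i j * be j).
    rewrite /K mul_col_mx col_mxEu -mulmxA mul_diag_mx mxE mulmxA eqR.
    rewrite mulmxBl -!mulmxA subE !mulE.
    rewrite -sumrB big_distrr/=; apply: eq_bigr => j _.
    by rewrite (dlE i j) /al /be; ring.
  have RE2 i : (K *m (M *m x)) (rshift n i) ord0 =
      \sum_j sg i j * (TR i j * be j + TI i j * al j).
    rewrite /K mul_col_mx col_mxEd -mulmxA mul_diag_mx mxE mulmxA eqI.
    rewrite mulmxDl -!mulmxA addE !mulE.
    rewrite -big_split/= big_distrr/=; apply: eq_bigr => j _.
    by rewrite (dlE i j) /al /be; ring.
  pose Y i := al i ^+ 2 + be i ^+ 2.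
  have Y0 i : 0 <= Y i by rewrite addr_ge0 ?sqr_ge0.
  have E0 i : (K *m x) (lshift n i) ord0 = al i.
    by rewrite /K mul_col_mx col_mxEu -mulmxA mul_diag_mx mxE.
  have E1 i : (K *m x) (rshift n i) ord0 = be i.
    by rewrite /K mul_col_mx col_mxEd -mulmxA mul_diag_mx mxE.
  rewrite !KE.
  rewrite (eq_bigr (fun i => \sum_j sg i j * (TR i j * (al i * al j + be i * be j) +
      TI i j * (be i * al j - al i * be j)))); last first.
    move=> i _; rewrite RE1 RE2 !big_distrr/= -big_split/=; apply: eq_bigr => j _.
    by rewrite -/(al i) -/(be i); ring.
  rewrite [X in _ * X](eq_bigr Y); last first.
    by move=> i _; rewrite E0 E1 -/(al i) -/(be i) /Y; ring.
  have sq (s t : R) : `|s * t| <= s ^+ 2 / 2 + t ^+ 2 / 2.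
    have p1 := sqr_ge0 (s - t); have p2 := sqr_ge0 (s + t).
    rewrite sqrrB in p1; rewrite sqrrD in p2.
    by rewrite ler_norml; apply/andP; split; lra.
  have cross (r s t w : R) : `|r * s + t * w| <= r ^+ 2 + t ^+ 2 + (s ^+ 2 + w ^+ 2).
    have h1 := sq r s; have h2 := sq t w.
    have := sqr_ge0 r; have := sqr_ge0 s; have := sqr_ge0 t; have := sqr_ge0 w.
    by have := ler_normD (r * s) (t * w); lra.
  have dc0 : 0 <= del * c by rewrite mulr_ge0// ltW.
  have bound i j : sg i j * (TR i j * (al i * al j + be i * be j) +
      TI i j * (be i * al j - al i * be j)) <=
      (j == i)%:R * ((mu - m) * Y i) + del * c * (Y i + Y j).
    have rest0 : 0 <= del * c * (Y i + Y j) by rewrite mulr_ge0// addr_ge0.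
    have [ij|ji|/val_inj ij] := ltngtP i j.
    - have [-> ->] := trig i j ij; rewrite !mul0r addr0 mulr0.
      by rewrite -val_eqE gtn_eqF// mul0r add0r.
    - rewrite -val_eqE ltn_eqF// mul0r add0r.
      have sg0 : 0 <= sg i j by rewrite divr_ge0// ltW.
      have sgd : sg i j <= del.
        rewrite /sg !mxE ler_pdivrMr ?exprn_gt0// -(subnKC ji) exprD exprSr.
        rewrite [leRHS]mulrC -[leRHS]mulr1 ler_wpM2l//.
          by rewrite mulr_ge0 ?exprn_ge0 ?(ltW del0).
        by rewrite exprn_ile1// ltW.
      have h1 : TR i j * (al i * al j + be i * be j) <= `|TR| * (Y i + Y j).
        by rewrite (le_trans (ler_norm _))// normrM ler_pM// ?ler_mx_entry.
      have h2 : TI i j * (be i * al j - al i * be j) <= `|TI| * (Y i + Y j).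
        rewrite (le_trans (ler_norm _))// normrM ler_pM// ?ler_mx_entry//.
        have := cross (be i) (al j) (- al i) (be j); rewrite sqrrN mulNr.
        by rewrite [be i ^+ 2 + _]addrC.
      apply: (@le_trans _ _ (sg i j * (c * (Y i + Y j)))).
        by rewrite ler_wpM2l// /c mulrDl lerD.
      by rewrite -[leRHS]mulrA ler_wpM2r// mulr_ge0// addr_ge0.
    rewrite -ij in rest0 *; rewrite eqxx mul1r /sg divff ?gt_eqF// mul1r.
    rewrite (_ : TR i i * _ + _ = TR i i * Y i); last by rewrite /Y; ring.
    rewrite ler_wpDr //.
    by rewrite ler_wpM2r// lerBrDr -lerBrDl.
  apply: (@le_trans _ _ (\sum_i \sum_j ((j == i)%:R * ((mu - m) * Y i) +
      del * c * (Y i + Y j)))).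
    by apply: ler_sum => i _; apply: ler_sum => j _.
  set S := \sum_i Y i.
  have S0 : 0 <= S by apply: sumr_ge0 => i _.
  rewrite (_ : \sum_i _ = (mu - m) * S + n.*2%:R * c * del * S).
    by rewrite -mulrDl ler_wpM2r//; lra.
  rewrite (eq_bigr (fun i => (mu - m) * Y i + (del * c * n%:R * Y i + del * c * S))).
    rewrite !big_split/= -!big_distrr/= -/S sumr_const card_ord -addnn natrD.
    by rewrite -[_ *+ n]mulr_natl; ring.
  move=> i _; rewrite big_split/= -big_distrl/= (bigD1 i)//= big1 ?addr0; last first.
    by move=> j /negPf ->.
  rewrite eqxx mul1r -big_distrr/= big_split/= sumr_const card_ord -/S.
  by rewrite -[_ *+ n]mulr_natl; ring.
move=> x; rewrite /K mul_col_mx => /eqP; rewrite col_mx_eq0.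
have dlu : diag_mx dl \in unitmx.
  rewrite unitmxE det_diag unitfE; apply/prodf_neq0 => i _.
  by rewrite gt_eqF.
move=> /andP[/eqP h1 /eqP h2]; apply: inj.
  by rewrite -(mulKmx dlu (PR *m x)) [diag_mx dl *m _]mulmxA h1 mulmx0.
by rewrite -(mulKmx dlu (PI *m x)) [diag_mx dl *m _]mulmxA h2 mulmx0.
Qed.

End LyapunovForm.

Section SpectralDominated.
Context {R : realType} {n : nat}.
Variables (M : 'M[R]_n) (mu : R) (v : 'cV[R]_n).
Hypotheses (Mv : M *m v = mu *: v) (v0 : v != 0).
Hypothesis muE : eigenvalue M mu.
Hypothesis pairing : forall z : 'rV[R]_n,
  z *m M = mu *: z -> z != 0 -> z *m v != 0.
Hypothesis spec : forall xi : R[i], complex_eigenvalue M xi ->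
  xi != real_complex R mu -> complex.Re xi < mu.

(** Deflation: M - v w has v as eigenvector for mu - 1 and otherwise the eigenvalues
    of M other than mu, so it has a Lyapunov form; composed with the projection
    1 - v w, on whose image M and M - v w agree, that form serves for M. *)
Lemma spectral_dominated : exists (w : 'rV[R]_n) (T : 'M[R]_(n + n, n)) (mu' : R),
  dominated M mu v w T mu'.
Proof.
have n0 : (0 < n)%N.
  rewrite lt0n; apply: contra_neq v0 => n0.
  by apply/matrixP => i; have := ltn_ord i; rewrite [X in (_ < X)%N]n0.
have /eigenvalueP[z zM z0] := muE; have zv := pairing zM z0.
have zv0 : (z *m v) ord0 ord0 != 0.
  apply: contraNneq zv => zv0; apply/eqP/matrixP => i j.
  by rewrite !ord1 zv0 mxE.
pose w := ((z *m v) ord0 ord0)^-1 *: z.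
have wv : w *m v = 1%:M.
  rewrite -scalemxAl; apply/matrixP => i j.
  by rewrite !ord1 [LHS]mxE mulVf// [RHS]mxE eqxx.
have wM : w *m M = mu *: w by rewrite -scalemxAl zM !scalerA mulrC.
pose M' := M - v *m w.
have M'v : M' *m v = (mu - 1) *: v.
  by rewrite mulmxBl Mv -mulmxA wv mulmx1 scalerBl scale1r.
have spec' xi : complex_eigenvalue M' xi -> complex.Re xi < mu.
  pose toC k m := map_mx (real_complex R) : 'M[R]_(k, m) -> 'M[R[i]]_(k, m).
  move=> /eigenvalueP[y yM' y0].
  have yv : (real_complex R (mu - 1) - xi) *: (y *m toC _ _ v) = 0.
    have e1 : y *m toC _ _ M' *m toC _ _ v = xi *: (y *m toC _ _ v).
      by rewrite /toC yM' scalemxAl.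
    rewrite scalerBl -e1 -[y *m _ *m _]mulmxA /toC -map_mxM M'v map_mxZ.
    by rewrite -scalemxAr subrr.
  move/eqP: yv; rewrite scaler_eq0 subr_eq0 => /orP[/eqP <-|/eqP yv].
    by rewrite /= ltrBlDr ltrDl ltr01.
  have yM : y *m toC _ _ M = xi *: y.
    rewrite -yM' /M' map_mxB mulmxBr map_mxM mulmxA.
    by rewrite [y *m _ *m _](_ : _ = 0) ?subr0// yv mul0mx.
  apply: spec; first by apply/eigenvalueP; exists y.
  (* Were xi = mu, the real and imaginary parts of y would be left eigenvectors
     for mu orthogonal to v. *)
  apply: contraNneq y0 => xiE; move: yM yv; rewrite xiE /toC (cmxE y).
  set yr := map_mx _ y; set yi := map_mx _ y; rewrite -!cmx_real !cmxM.
  have -> : real_complex R mu *: cmx yr yi = cmx (mu *: yr) (mu *: yi).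
    by rewrite /cmx !map_mxZ scalerDr scalerA mulrC -scalerA.
  rewrite !mulmx0 !subr0 !add0r => /cmx_inj[rM iM].
  rewrite -[0](_ : cmx 0 0 = 0); last by rewrite cmx_real map_mx0.
  move=> /cmx_inj[rv iv].
  have zero (y' : 'rV[R]_n) : y' *m M = mu *: y' -> y' *m v = 0 -> y' = 0.
    move=> y'M y'v; apply/eqP; apply: contraT => y'0.
    by have := pairing y'M y'0; rewrite y'v eqxx.
  by rewrite (zero yr rM rv) (zero yi iM iv) cmx_real map_mx0.
have [K [mu' [mu'mu form inj]]] := lyapunov_form n0 spec'.
pose Pi : 'M[R]_n := 1%:M - v *m w.
have wPi : w *m Pi = 0 by rewrite mulmxBr mulmx1 mulmxA wv mul1mx subrr.
have M'Pi : M' *m Pi = M *m Pi.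
  by rewrite mulmxBl -[v *m w *m Pi]mulmxA wPi mulmx0 subr0.
have PiM : Pi *m M = M' *m Pi.
  rewrite M'Pi mulmxBl mulmxBr mul1mx mulmx1 -mulmxA wM mulmxA Mv.
  by rewrite -scalemxAr -scalemxAl.
exists w, (K *m Pi), mu'; split => //.
  move=> x; have := form (Pi *m x).
  by rewrite !mulmxA -[K *m Pi *m M]mulmxA PiM !mulmxA.
move=> x; rewrite -mulmxA => /inj; rewrite mulmxBl mul1mx -mulmxA => Px wx.
by move: Px; rewrite wx mulmx0 subr0.
Qed.

End SpectralDominated.

Lemma dominated_scale (R : realType) n p (A : 'M[R]_n) lam v w (T : 'M[R]_(p, n))
    lam' (c : R) : 0 < c -> dominated A lam v w T lam' ->
  dominated (c *: A) (c * lam) v w T (c * lam').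
Proof.
move=> c0 dom; split.
- exact: dom_wv dom.
- by rewrite -scalemxAr (dom_left dom) scalerA.
- by rewrite -scalemxAl (dom_right dom) scalerA.
- by rewrite ltr_pM2l//; exact: dom_gap dom.
- move=> x; have -> : T *m (c *: A *m x) = c *: (T *m (A *m x)).
    by rewrite -scalemxAl -scalemxAr.
  set y := T *m x; set z := T *m (A *m x).
  under eq_bigr do rewrite [(c *: z) _ _]mxE mulrCA.
  rewrite -big_distrr/= -mulrA ler_pM2l//; exact: (dom_form dom).
- exact: dom_inj dom.
Qed.

(** * The opinion-forming bifurcation and disagreement *)

Section OpinionForming.
Context {R : realType} {Na No p : nat}.
Variables (d a : R) (M : 'M[R]_Na) (Gam : 'cV[R]_Na -> 'cV[R]_Na).
Hypotheses (d0 : 0 < d) (GamL : strict_diff0 Gam (a%:M + M)).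
Hypotheses (GamT : truncatable Gam) (No1 : (1 < No)%N).
Variables (mu : R) (v : 'cV[R]_Na) (w : 'rV[R]_Na) (T : 'M[R]_(p, Na)) (mu' : R).
Hypothesis dom : dominated M mu v w T mu'.
Hypothesis amu0 : 0 < a + mu.
Local Notation field := (@columnwise_field R Na No d Gam).
Let us := d / (a + mu).

(** The kernel at ustar contains a nonzero v (x) x only if the growth rate
    - d + ustar (a + mu) is zero, which determines ustar. *)
Lemma opinion_forming_bifurcation_iff ustar :
  opinion_forming_bifurcation field v ustar <-> ustar = us.
Proof.
have e0 := @one_versus_all_neq0 R No No1.
split=> [[_ _ ker _ _]|->].
  have : jacobian_kernel (field ustar) (v *m @one_versus_all R No No1).
    by rewrite ker; exists (@one_versus_all R No No1) => //; exact: one_versus_all_perp1.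
  move=> [Vve]; rewrite (columnwise_field_diff d GamL)// mulmxA (dom_right dom).
  rewrite -scalemxAl scalerA -scalerDl => /eqP.
  rewrite scaler_eq0 => /orP[|/eqP ve]; last first.
    move: e0; have := congr1 (mulmx w) ve.
    by rewrite mulmx0 mulmxA (dom_wv dom) mul1mx => ->; rewrite eqxx.
  rewrite -addrA -mulrDr addrC subr_eq0 => /eqP dE.
  by rewrite /us -dE mulfK// gt_eqF.
have us0 : 0 < us by rewrite divr_gt0.
have kerE := kernel_at_critical (No := No) d0 GamL dom amu0.
split=> [u /andP[u0 uus]|u uus||us' Zs br|].
- apply: (neutral_stable (No := No) GamL dom u0).
  by rewrite addrC subr_lt0 -ltr_pdivlMr.
- have u0 : 0 < u := lt_trans us0 uus.
  apply: (neutral_unstable d0 GamL GamT dom (@one_versus_all_perp1 R No No1) e0 u0).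
  by rewrite addrC subr_gt0 -ltr_pdivrMr.
- exact: kerE.
- move=> e e0'; have [r r0 Hr] := equilibria_near_kernel (No := No) d0 GamL dom amu0 e0'.
  have := branch_near br r0; apply: filterS => s [s01 ur Zr].
  case: br => _ _ _ /(_ s s01)[VZ _ eqZ].
  exists (v *m (w *m Zs s)); last by apply: (Hr (us' s)) => //; exact: ltW.
  rewrite kerE; exists (w *m Zs s) => //.
  by have /opinion_spaceP := opinion_space_mull w VZ; exact.
have [us' [Zs [br tan]]] := bifurcation_branch_exists d GamL No1 dom amu0.
by exists us', Zs, (@one_versus_all R No No1); split => //; exact: one_versus_all_perp1.
Qed.

Lemma kernel_part_large Z e : 0 < e -> e <= 2^-1 ->
  `|Z - v *m (w *m Z)| <= e * `|Z| -> `|Z : 'M[R]_(Na, No)| <= 2 * (`|v| * `|w *m Z|).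
Proof.
move=> e0 e2 H.
have h1 : `|v *m (w *m Z)| <= `|v| * `|w *m Z|.
  by rewrite (le_trans (ler_mx_normM _ _))// mul1r.
have h2 : `|Z| <= `|Z - v *m (w *m Z)| + `|v *m (w *m Z)|.
  by rewrite -[X in `|X| <= _](subrK (v *m (w *m Z))) ler_normD.
have h3 : e * `|Z| <= 2^-1 * `|Z| by rewrite ler_wpM2r.
by lra.
Qed.

(** In the column j where |(w Z)_j| = |w Z|, the entries of v (w Z) at two agents
    with opposite signs in v exceed the error e |Z| <= 2 e |v| |w Z|. *)
Lemma disagreement_near_kernel : mixed_sign v -> exists2 r, 0 < r &
  forall u Z, opinion_space Z -> `|u - us| <= r -> `|Z| <= r -> field u Z = 0 ->
    Z != 0 -> disagreement Z.
Proof.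
move=> [[i vi] [k vk]].
have v0 : 0 < `|v| by rewrite normr_gt0 (dom_v_neq0 dom).
pose m := Num.min (v i ord0) (- v k ord0).
have m0 : 0 < m by rewrite lt_min vi oppr_gt0.
pose e := Num.min 2^-1 (m / (4 * `|v|)).
have e0 : 0 < e by rewrite lt_min invr_gt0 ltr0n divr_gt0// mulr_gt0.
have e2 : e <= 2^-1 by rewrite ge_min lexx.
have em : 4 * `|v| * e <= m.
  by rewrite mulrC -ler_pdivlMr ?mulr_gt0// ge_min lexx orbT.
have [r r0 Hr] := equilibria_near_kernel (No := No) d0 GamL dom amu0 e0.
exists r => // u Z VZ ur Zr eqZ Z0; have near := Hr u Z VZ ur Zr eqZ.
have large := kernel_part_large e0 e2 near.
have x0 : w *m Z != 0.
  apply: contraNneq Z0 => x0; move: large.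
  by rewrite x0 normr0 !mulr0 normr_le0.
have [[j' j] /= xj] := mx_norm_attained x0; rewrite ord1 in xj.
have X0 : 0 < `|w *m Z| by rewrite normr_gt0.
have ZE l : `|Z l j - v l ord0 * (w *m Z) ord0 j| < m * `|w *m Z|.
  have -> : Z l j - v l ord0 * (w *m Z) ord0 j = (Z - v *m (w *m Z)) l j.
    rewrite [RHS]mxE; congr (_ + _); rewrite [RHS]mxE; congr (- _).
    by rewrite [RHS]mxE big_ord1.
  rewrite (le_lt_trans (ler_mx_entry _ _ _))// (le_lt_trans near)//.
  apply: (@le_lt_trans _ _ (e * (2 * (`|v| * `|w *m Z|)))).
    by rewrite ler_wpM2l// ltW.
  have -> : e * (2 * (`|v| * `|w *m Z|)) = 4 * `|v| * e / 2 * `|w *m Z| by field.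
  rewrite ltr_pM2r// ltr_pdivrMr// (le_lt_trans em)// ltr_pMr// ltr1n//.
have mi : m <= v i ord0 by rewrite ge_min lexx.
have mk : m <= - v k ord0 by rewrite ge_min lexx orbT.
have := ZE i; have := ZE k; rewrite !ltr_norml => /andP[k1 k2] /andP[i1 i2].
exists i, k, j; split.
  by apply: contraTneq vi => ->; rewrite -leNgt ltW.
have hi : m * `|w *m Z| <= v i ord0 * `|w *m Z| by rewrite ler_pM2r.
have hk : m * `|w *m Z| <= - v k ord0 * `|w *m Z| by rewrite ler_pM2r.
move: k1 k2 i1 i2 hi hk; rewrite xj; set x := (w *m Z) ord0 j.
have [xp|xn] := leP 0 x.
  rewrite (ger0_norm xp) => k1 k2 i1 i2 hi hk.
  have Zi : 0 < Z i j by lra.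
  have Zk : Z k j < 0 by lra.
  by rewrite gtr0_sg// ltr0_sg// => /eqP; rewrite -subr_eq0 opprK; move/eqP; lra.
rewrite (ltr0_norm xn) => k1 k2 i1 i2 hi hk.
have Zi : Z i j < 0 by lra.
have Zk : 0 < Z k j by lra.
by rewrite ltr0_sg// gtr0_sg// => /eqP; rewrite -subr_eq0; move/eqP; lra.
Qed.

End OpinionForming.

(** * Second-order terms and agreement *)

Section SecondOrder.
Context {R : realType} {n : nat}.

(** Since P z is pi (w z) v up to a small multiple of b, the squares of the two
    differ by a small multiple of b^2.  The estimate is in terms of a bound b for
    the norm of the whole state, of which z will be one column: the error of a
    column is controlled by the state, not by the column itself. *)
Lemma map_sigm_second_order (S : R -> R) (P : 'M[R]_n) (v : 'cV[R]_n)
    (w : 'rV[R]_n) (pi : R) :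
  sigmoidal S -> P *m v = pi *: v ->
  forall e, 0 < e -> exists r eta, [/\ 0 < r, 0 < eta &
    forall (z : 'cV[R]_n) b i, b <= r -> `|z| <= b ->
    `|z - v *m (w *m z)| <= eta * b ->
    `|S ((P *m z) i ord0) - (P *m z) i ord0 -
      derive1n 2 S 0 / 2 * (pi * (w *m z) ord0 ord0 * v i ord0) ^+ 2| <=
    e * b ^+ 2].
Proof.
move=> hS Pv e e0; set s2 := derive1n 2 S 0 / 2.
have [c c0 Hc] := mx_linear_bound 1 P.
have [cw cw0 Hw] := mx_linear_bound 1 w.
pose V := `|v| + 1; have V0 : 0 < V by rewrite ltr_wpDl.
have e1 : 0 < e / 2 / c ^+ 2 by rewrite !divr_gt0// exprn_gt0.
have [r r0 Hr] := sigm_taylor2 hS e1.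
pose k := `|s2| * (c * (c + c * (V * cw))) + 1.
have k0 : 0 < k.
  by rewrite ltr_wpDl// !mulr_ge0 ?addr_ge0 ?mulr_ge0// ltW.
exists (r / c), (e / 2 / k); split; [exact: divr_gt0|by rewrite !divr_gt0|].
move=> z b i br zb Wb; have b0 : 0 <= b by exact: le_trans zb.
set x := (w *m z) ord0 ord0; set W := z - v *m (w *m z) in Wb *.
have xE : w *m z = x%:M.
  by apply/matrixP => i' j'; rewrite !ord1 [RHS]mxE eqxx mulr1n.
have zE : z = x *: v + W by rewrite /W xE mul_mx_scalar addrC subrK.
set t := (P *m z) i ord0.
have tE : t = pi * x * v i ord0 + (P *m W) i ord0.
  rewrite /t {1}zE mulmxDr -scalemxAr Pv scalerA mxE [X in X + _]mxE.
  by rewrite [x * pi]mulrC.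
have tc : `|t| <= c * b.
  by rewrite (le_trans (ler_mx_entry _ _ _))// (le_trans (Hc _))// ler_pM2l.
have Wc : `|(P *m W) i ord0| <= c * (e / 2 / k * b).
  by rewrite (le_trans (ler_mx_entry _ _ _))// (le_trans (Hc _))// ler_pM2l.
have uc : `|pi * x * v i ord0| <= c * (V * cw) * b.
  have -> : pi * x * v i ord0 = (P *m (x *: v)) i ord0.
    by rewrite -scalemxAr Pv scalerA [x * pi]mulrC mxE.
  rewrite (le_trans (ler_mx_entry _ _ _))// (le_trans (Hc _))//.
  rewrite -mulrA ler_pM2l// normrZ mulrC -mulrA ler_pM// ?lerDl//.
  rewrite (le_trans (ler_mx_entry _ _ _))// (le_trans (Hw _))//.
  by rewrite ler_pM2l.
set q := pi * x * v i ord0 in tE uc *.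
have -> : S t - t - s2 * q ^+ 2 =
    (S t - t - s2 * t ^+ 2) + s2 * ((P *m W) i ord0 * (t + q)).
  by rewrite tE; ring.
rewrite (le_trans (ler_normD _ _))// (splitr e) mulrDl lerD//.
  have tr : `|t| <= r.
    by rewrite (le_trans tc)// mulrC -ler_pdivlMr.
  rewrite (le_trans (Hr _ tr))//.
  apply: (@le_trans _ _ (e / 2 / c ^+ 2 * (c * b) ^+ 2)).
    by rewrite ler_pM2l// ler_pXn2r// nnegrE// mulr_ge0// ltW.
  by rewrite le_eqVlt; apply/orP; left; apply/eqP; field; rewrite gt_eqF.
rewrite normrM [`|_ * (t + q)|]normrM.
apply: (@le_trans _ _ (`|s2| * (c * (e / 2 / k * b) * (c * b + c * (V * cw) * b)))).
  rewrite ler_wpM2l// ler_pM// (le_trans (ler_normD _ _))// lerD//.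
have -> : `|s2| * (c * (e / 2 / k * b) * (c * b + c * (V * cw) * b)) =
    `|s2| * (c * (c + c * (V * cw))) / k * (e / 2 * b ^+ 2).
  by field; rewrite gt_eqF.
rewrite ler_piMl ?mulr_ge0 ?divr_ge0 ?sqr_ge0 ?(ltW e0)//.
by rewrite ler_pdivrMr// mul1r lerDl.
Qed.

Variables (alpha beta gamma delta : R) (S1 S2 : R -> R) (A : 'M[R]_n).
Hypotheses (hS1 : sigmoidal S1) (hS2 : sigmoidal S2).
Variables (lam : R) (v : 'cV[R]_n) (w : 'rV[R]_n).
Hypotheses (Av : A *m v = lam *: v) (wA : w *m A = lam *: w).
Hypothesis w0 : forall i, 0 < w ord0 i.
Let Gam := response alpha beta gamma delta S1 S2 A.

Definition quadratic_coefficient : R :=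
  ((alpha + gamma * lam) ^+ 2 * derive1n 2 S1 0 -
   (beta + delta * lam) ^+ 2 * derive1n 2 S2 0) / 2 *
  \sum_i w ord0 i * v i ord0 ^+ 2.

(** The part z - v (w z) is only small compared with b, not O(b^2), yet it
    contributes nothing at first order: w is a left eigenvector of the linear part
    of Gam, so pairing that part with w leaves a multiple of w z. *)
Lemma response_second_order e : 0 < e -> exists r eta, [/\ 0 < r, 0 < eta &
  forall (z : 'cV[R]_n) b, b <= r -> `|z| <= b ->
    `|z - v *m (w *m z)| <= eta * b ->
    `|(w *m Gam z) ord0 ord0 -
      (alpha - beta + lam * (gamma - delta)) * (w *m z) ord0 ord0 -
      quadratic_coefficient * (w *m z) ord0 ord0 ^+ 2| <= e * b ^+ 2].
Proof.
move=> e0; pose P := alpha%:M + gamma *: A; pose Q := beta%:M + delta *: A.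
have Pv : P *m v = (alpha + gamma * lam) *: v.
  by rewrite mulmxDl mul_scalar_mx -scalemxAl Av scalerA -scalerDl.
have Qv : Q *m v = (beta + delta * lam) *: v.
  by rewrite mulmxDl mul_scalar_mx -scalemxAl Av scalerA -scalerDl.
pose sw := \sum_i w ord0 i + 1.
have sw0 : 0 < sw by rewrite ltr_wpDl// sumr_ge0// => i _; exact: ltW.
have e1 : 0 < e / 2 / sw by rewrite !divr_gt0.
have [r1 [eta1 [r10 eta10 H1]]] := map_sigm_second_order w hS1 Pv e1.
have [r2 [eta2 [r20 eta20 H2]]] := map_sigm_second_order w hS2 Qv e1.
exists (Num.min r1 r2), (Num.min eta1 eta2); split.
- by rewrite lt_min r10.
- by rewrite lt_min eta10.
move=> z b; rewrite le_min => /andP[b1 b2] zb Wb.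
have b0 : 0 <= b by exact: le_trans zb.
have m1 : Num.min eta1 eta2 <= eta1 by rewrite ge_min lexx.
have m2 : Num.min eta1 eta2 <= eta2 by rewrite ge_min lexx orbT.
have W1 := le_trans Wb (ler_wpM2r b0 m1).
have W2 := le_trans Wb (ler_wpM2r b0 m2).
set x := (w *m z) ord0 ord0.
pose err1 i := S1 ((P *m z) i ord0) - (P *m z) i ord0 -
  derive1n 2 S1 0 / 2 * ((alpha + gamma * lam) * x * v i ord0) ^+ 2.
pose err2 i := S2 ((Q *m z) i ord0) - (Q *m z) i ord0 -
  derive1n 2 S2 0 / 2 * ((beta + delta * lam) * x * v i ord0) ^+ 2.
have lin : \sum_i w ord0 i * ((P *m z) i ord0 - (Q *m z) i ord0) =
    (alpha - beta + lam * (gamma - delta)) * x.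
  have wPQ : w *m (P *m z - Q *m z) =
      (alpha - beta + lam * (gamma - delta)) *: (w *m z).
    rewrite -mulmxBl mulmxA /P /Q opprD addrACA -raddfB/= -scalerBl mulmxDr.
    rewrite mul_mx_scalar -scalemxAr wA scalerA -scalerDl [_ * lam]mulrC.
    by rewrite -scalemxAl.
  have := congr1 (fun X : 'M[R]_1 => X ord0 ord0) wPQ.
  rewrite mxE [in RHS]mxE -/x => <-; apply: eq_bigr => i _.
  by set X := P *m z; set Y := Q *m z; rewrite !mxE.
have -> : (w *m Gam z) ord0 ord0 - (alpha - beta + lam * (gamma - delta)) * x -
    quadratic_coefficient * x ^+ 2 = \sum_i w ord0 i * (err1 i - err2 i).
  have -> : (w *m Gam z) ord0 ord0 =
      \sum_i w ord0 i * (S1 ((P *m z) i ord0) - S2 ((Q *m z) i ord0)).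
    rewrite mxE; apply: eq_bigr => i _; rewrite /Gam /response -/P -/Q.
    by set X := P *m z; set Y := Q *m z; rewrite !mxE.
  rewrite -lin -sumrB.
  have -> : quadratic_coefficient * x ^+ 2 = \sum_i
      ((alpha + gamma * lam) ^+ 2 * derive1n 2 S1 0 -
       (beta + delta * lam) ^+ 2 * derive1n 2 S2 0) / 2 *
      (w ord0 i * v i ord0 ^+ 2) * x ^+ 2.
    by rewrite -big_distrl/= -big_distrr.
  rewrite -sumrB; apply: eq_bigr => i _; rewrite /err1 /err2.
  set p := (P *m z) i ord0; set q := (Q *m z) i ord0.
  move: (derive1n 2 S1 0) (derive1n 2 S2 0) (S1 p) (S2 q) => s1 s2 y1 y2.
  by move: p q (x) (v i ord0) (w ord0 i) (alpha + _) (beta + _) => *; field.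
rewrite (le_trans (ler_norm_sum _ _ _))//.
apply: (@le_trans _ _ (\sum_i w ord0 i * (e / sw * b ^+ 2))).
  apply: ler_sum => i _; rewrite normrM gtr0_norm// ler_pM2l//.
  have := H1 z b i b1 zb W1; have := H2 z b i b2 zb W2.
  rewrite -/x -/(err1 i) -/(err2 i) => h2 h1.
  rewrite (le_trans (ler_normB _ _))// (le_trans (lerD h1 h2))//.
  by rewrite le_eqVlt; apply/orP; left; apply/eqP; field; rewrite gt_eqF.
rewrite -big_distrl/= mulrA ler_wpM2r ?sqr_ge0// mulrCA ler_piMr ?(ltW e0)//.
by rewrite ler_pdivrMr// mul1r lerDl.
Qed.

End SecondOrder.

Section Agreement.
Context {R : realType} {Na No p : nat}.
Variables (d a : R) (M : 'M[R]_Na) (Gam : 'cV[R]_Na -> 'cV[R]_Na).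
Hypotheses (d0 : 0 < d) (GamL : strict_diff0 Gam (a%:M + M)).
Hypothesis No1 : (1 < No)%N.
Variables (mu : R) (v : 'cV[R]_Na) (w : 'rV[R]_Na) (T : 'M[R]_(p, Na)) (mu' : R).
Hypothesis dom : dominated M mu v w T mu'.
Hypothesis amu0 : 0 < a + mu.
Variable q : R.
Hypotheses (q0 : q != 0) (v0 : forall i, 0 < v i ord0).
Hypothesis second_order : forall e, 0 < e ->
  exists r eta, [/\ 0 < r, 0 < eta & forall (z : 'cV[R]_Na) b,
    b <= r -> `|z| <= b -> `|z - v *m (w *m z)| <= eta * b ->
    `|(w *m Gam z) ord0 ord0 - (a + mu) * (w *m z) ord0 ord0 -
      q * (w *m z) ord0 ord0 ^+ 2| <= e * b ^+ 2].
Local Notation field := (@columnwise_field R Na No d Gam).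
Let us := d / (a + mu).

(** The equilibrium equation paired with w; the mean over options comes from
    P_0. *)
Lemma reduced_equation u Z : opinion_space Z -> field u Z = 0 ->
  forall j, let h l := (w *m Gam (col l Z)) ord0 ord0 in
    u * (h j - No%:R^-1 * \sum_l h l) = d * (w *m Z) ord0 j.
Proof.
move=> VZ eqZ j h.
have hE l : (w *m colwise Gam Z) ord0 l = h l.
  by rewrite mxE /h mxE; apply: eq_bigr => i _; rewrite mxE.
have : w *m field u Z = 0 by rewrite eqZ mulmx0.
rewrite /columnwise_field mulmxDl -!scalemxAl (proj1perp_id VZ) mulmxDr.
rewrite -!scalemxAr mulmxA => /matrixP/(_ ord0 j); rewrite [RHS]mxE.
have combE (X Y : 'rV[R]_No) :
  (- d *: X + u *: Y) ord0 j = - d * X ord0 j + u * Y ord0 j by rewrite !mxE.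
rewrite combE mul_proj1perp; under eq_bigr do rewrite hE.
by rewrite hE mulNr => /eqP; rewrite addrC subr_eq0 => /eqP.
Qed.

(** With x = w Z and D = - d + u (a + mu), the reduced equation reads
    D x_j + u q (x_j^2 - m2) = o(|x|^2), m2 being the mean of the x_l^2.  At the
    largest component it gives |D| <= u (|q| + kap) |x|.  At any j it then gives
    |q| (m2 - x_j^2) <= (|q| + kap) |x| |x_j| + kap |x|^2, and as
    m2 >= |x|^2 / No, the component x_j cannot be small. *)
Lemma components_comparable : exists2 e, 0 < e & exists2 r, 0 < r &
  forall u Z, opinion_space Z -> `|u - us| <= r -> `|Z| <= r -> field u Z = 0 ->
    `|Z - v *m (w *m Z)| <= e * `|Z| ->
    forall j, `|w *m Z| <= 6 * No%:R * `|(w *m Z) ord0 j|.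
Proof.
have us0 : 0 < us by rewrite divr_gt0.
have V0 : 0 < `|v| by rewrite normr_gt0 (dom_v_neq0 dom).
have N0 : 0 < No%:R :> R by rewrite ltr0n ltnW.
have aq0 : 0 < `|q| by rewrite normr_gt0.
(* kap |x|^2, the bound for the second-order error, is half of the lower bound
   |q| |x|^2 / No for |q| m2. *)
pose kap := `|q| / (2 * No%:R); have kap0 : 0 < kap by rewrite divr_gt0// mulr_gt0.
pose e := kap / (8 * `|v| ^+ 2).
have e0 : 0 < e by rewrite divr_gt0// mulr_gt0// exprn_gt0.
have [r [eta [r0 eta0 H]]] := second_order e0.
have e10 : 0 < Num.min 2^-1 eta by rewrite lt_min invr_gt0 ltr0n.
exists (Num.min 2^-1 eta) => //; exists (Num.min r (us / 2)).
  by rewrite lt_min r0 divr_gt0.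
move=> u Z VZ; rewrite !le_min => /andP[_ u_us] /andP[Zr _] eqZ near.
have half : Num.min 2^-1 eta <= 2^-1 by rewrite ge_min lexx.
have large := kernel_part_large e10 half near.
have u0 : 0 < u.
  have := ler_norm (us - u); rewrite distrC => h.
  by lra.
pose x j := (w *m Z) ord0 j; pose X := `|w *m Z|.
have xX j : `|x j| <= X by exact: ler_mx_entry.
have X_ge0 : 0 <= X by rewrite /X.
pose h l := (w *m Gam (col l Z)) ord0 ord0.
pose rho l := h l - (a + mu) * x l - q * x l ^+ 2.
have xE j : (w *m col j Z) ord0 ord0 = x j.
  by rewrite /x !mxE; apply: eq_bigr => i _; rewrite mxE.
have rho_le l : `|rho l| <= kap / 2 * X ^+ 2.
  have colE' : col l Z - v *m (w *m col l Z) = col l (Z - v *m (w *m Z)).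
    by rewrite !colE mulmxBl !mulmxA.
  have := H (col l Z) `|Z| Zr (col_norm_le Z l).
  rewrite colE' xE -/(h l) -/(rho l) => /(_ _)/le_trans; apply.
    rewrite (le_trans (col_norm_le _ _))// (le_trans near)// ler_wpM2r//.
    by rewrite ge_min lexx orbT.
  apply: (@le_trans _ _ (e * (2 * (`|v| * X)) ^+ 2)).
    by rewrite ler_pM2l// ler_pXn2r// nnegrE ?mulr_ge0.
  by rewrite le_eqVlt; apply/orP; left; apply/eqP; rewrite /e; field; rewrite gt_eqF.
have sumx : \sum_j x j = 0.
  by have /opinion_spaceP := opinion_space_mull w VZ; exact.
pose m2 := No%:R^-1 * \sum_j x j ^+ 2; pose rb := No%:R^-1 * \sum_j rho j.
pose D := - d + u * (a + mu).
have mean (f : 'I_No -> R) c : (forall j, f j <= c) -> No%:R^-1 * \sum_j f j <= c.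
  move=> fc; rewrite mulrC ler_pdivrMr// mulr_natr -[No in leRHS]card_ord -sumr_const.
  by apply: ler_sum => j _.
have eqj j : D * x j + u * q * (x j ^+ 2 - m2) + u * (rho j - rb) = 0.
  have eq1 : u * (h j - No%:R^-1 * \sum_l h l) = d * x j.
    exact: reduced_equation VZ eqZ j.
  have hs : \sum_l h l = q * \sum_l x l ^+ 2 + \sum_l rho l.
    rewrite (eq_bigr (fun l => (a + mu) * x l + (q * x l ^+ 2 + rho l))).
      by rewrite !big_split/= -!big_distrr/= sumx mulr0 add0r.
    by move=> l _; rewrite /rho; ring.
  rewrite hs in eq1; rewrite /D /m2 /rb.
  transitivity (u * (h j - No%:R^-1 * (q * \sum_l x l ^+ 2 + \sum_l rho l)) - d * x j).
    by rewrite /rho; ring.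
  by rewrite eq1 subrr.
have rrb j : `|rho j - rb| <= kap * X ^+ 2.
  have b1 : `|rb| <= kap / 2 * X ^+ 2.
    rewrite /rb normrM gtr0_norm ?invr_gt0//.
    rewrite (le_trans (ler_wpM2l _ (ler_norm_sum _ _ _))) ?invr_ge0 ?(ltW N0)//.
    exact: mean.
  rewrite (le_trans (ler_normB _ _))// (le_trans (lerD (rho_le j) b1))//.
  by rewrite -mulrDl -mulrDl; lra.
have m2_le : m2 <= X ^+ 2.
  apply: mean => j; rewrite -real_normK ?num_real//.
  by rewrite ler_pXn2r// nnegrE.
have m2_ge j : No%:R^-1 * x j ^+ 2 <= m2.
  rewrite ler_pM2l ?invr_gt0// (bigD1 j)//= lerDl sumr_ge0// => i _.
  exact: sqr_ge0.
move=> j.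
have [x0|x0] := eqVneq (w *m Z) 0.
  by rewrite x0 normr0 mulr_ge0// mulr_ge0// ltW.
have Xp : 0 < X by rewrite normr_gt0.
have [[j' jm] /= xm] := mx_norm_attained x0; rewrite ord1 in xm.
have {}xm : X = `|x jm| := xm.
have Dle : `|D| <= u * (`|q| + kap) * X.
  rewrite -(ler_pM2r Xp) {1}xm -normrM.
  have -> : D * x jm = - (u * q * (x jm ^+ 2 - m2) + u * (rho jm - rb)).
    by apply/eqP; rewrite -subr_eq0 opprK addrA eqj.
  rewrite normrN (le_trans (ler_normD _ _))//.
  have -> : u * (`|q| + kap) * X * X = u * `|q| * X ^+ 2 + u * (kap * X ^+ 2) by ring.
  rewrite lerD// normrM ?normrM (gtr0_norm u0); last by rewrite ler_pM2l.
  rewrite ler_pM2l ?mulr_gt0//.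
  have := m2_le; have := m2_ge jm; have xm2 : x jm ^+ 2 = X ^+ 2.
    by rewrite xm real_normK// num_real.
  rewrite xm2 => g1 g2; rewrite ger0_norm ?subr_ge0// gerBl.
  by rewrite (le_trans _ g1)// mulr_ge0 ?sqr_ge0// invr_ge0 ltW.
have final : `|q| * (No%:R^-1 * X ^+ 2 - x j ^+ 2) <=
    (`|q| + kap) * X * `|x j| + kap * X ^+ 2.
  have t1 : u * `|q| * (m2 - x j ^+ 2) <= u * ((`|q| + kap) * X * `|x j| + kap * X ^+ 2).
    apply: (@le_trans _ _ `|u * q * (x j ^+ 2 - m2)|).
      rewrite normrM normrM (gtr0_norm u0) ler_pM2l ?mulr_gt0// distrC.
      exact: ler_norm.
    have -> : u * q * (x j ^+ 2 - m2) = - (D * x j + u * (rho j - rb)).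
      by apply/eqP; rewrite -subr_eq0 opprK addrCA addrA eqj.
    rewrite normrN (le_trans (ler_normD _ _))// [leRHS]mulrDr lerD//.
      by rewrite normrM !mulrA ler_wpM2r// mulrA.
    by rewrite normrM (gtr0_norm u0) ler_pM2l.
  have t2 : No%:R^-1 * X ^+ 2 <= m2.
    have := m2_ge jm; have -> : x jm ^+ 2 = X ^+ 2.
      by rewrite xm real_normK// num_real.
    exact.
  rewrite -mulrA ler_pM2l// in t1.
  by rewrite (le_trans _ t1)// ler_pM2l// lerD2r.
have xj2 : x j ^+ 2 <= X * `|x j|.
  by rewrite -real_normK ?num_real// expr2 ler_wpM2r.
rewrite -/X -/(x j).
have kq : kap <= `|q|.
  rewrite /kap ler_pdivrMr ?mulr_gt0// ler_peMr//.
  have : 1 <= No%:R :> R by rewrite ler1n ltnW.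
  by lra.
have qN : `|q| * (No%:R^-1 * X ^+ 2) = 2 * kap * X ^+ 2.
  by rewrite /kap; field; rewrite gt_eqF.
have s1 : kap * X ^+ 2 <= 3 * `|q| * (X * `|x j|).
  have s2 : `|q| * x j ^+ 2 <= `|q| * (X * `|x j|) by rewrite ler_pM2l.
  have s3 : kap * (X * `|x j|) <= `|q| * (X * `|x j|).
    by rewrite ler_wpM2r// mulr_ge0.
  rewrite mulrBr qN in final.
  have -> : 3 * `|q| * (X * `|x j|) =
    `|q| * (X * `|x j|) + `|q| * (X * `|x j|) + `|q| * (X * `|x j|) by ring.
  have f2 : (`|q| + kap) * X * `|x j| = `|q| * (X * `|x j|) + kap * (X * `|x j|) by ring.
  rewrite f2 in final.
  by lra.
rewrite -(ler_pM2l Xp) -(ler_pM2l kap0).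
have -> : kap * (X * X) = kap * X ^+ 2 by rewrite expr2.
have -> : kap * (X * (6 * No%:R * `|x j|)) = 3 * `|q| * (X * `|x j|).
  by rewrite /kap; field; rewrite gt_eqF.
exact: s1.
Qed.

(** Every x_j dominates the distance of Z to v (x) x, so the entries of column j all
    have the sign of x_j; if one x_j vanishes then so does Z. *)
Lemma agreement_near_kernel : exists2 r, 0 < r &
  forall u Z, opinion_space Z -> `|u - us| <= r -> `|Z| <= r -> field u Z = 0 ->
    agreement Z.
Proof.
have [e1 e10 [r1 r10 H1]] := components_comparable.
have [m m0 Hm] := pos_lower_bound v0.
have V0 : 0 < `|v| by rewrite normr_gt0 (dom_v_neq0 dom).
have N0 : 0 < No%:R :> R by rewrite ltr0n ltnW.
pose e := Num.min 2^-1 (Num.min e1 (m / (24 * No%:R * `|v|))).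
have e0 : 0 < e by rewrite !lt_min invr_gt0 ltr0n e10 divr_gt0// !mulr_gt0.
have e2 : e <= 2^-1 by rewrite ge_min lexx.
have ee1 : e <= e1 by rewrite !ge_min lexx orbT.
have em : 24 * No%:R * `|v| * e <= m.
  by rewrite mulrC -ler_pdivlMr ?mulr_gt0// !ge_min lexx !orbT.
have [r2 r20 H2] := equilibria_near_kernel (No := No) d0 GamL dom amu0 e0.
exists (Num.min r1 r2) => [|u Z VZ]; first by rewrite lt_min r10.
rewrite !le_min => /andP[u1 u2] /andP[Z1 Z2] eqZ.
have near := H2 u Z VZ u2 Z2 eqZ.
have near1 : `|Z - v *m (w *m Z)| <= e1 * `|Z|.
  by rewrite (le_trans near)// ler_wpM2r.
have comp := H1 u Z VZ u1 Z1 eqZ near1.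
have large := kernel_part_large e0 e2 near.
move=> i k j; suff H l : Num.sg (Z l j) = Num.sg ((w *m Z) ord0 j) by rewrite !H.
have [xj|xj] := eqVneq ((w *m Z) ord0 j) 0.
  have := comp j; rewrite xj normr0 mulr0 normr_le0 => /eqP x0.
  by move: large; rewrite x0 normr0 !mulr0 normr_le0 => /eqP ->; rewrite mxE.
have xp : 0 < `|(w *m Z) ord0 j| by rewrite normr_gt0.
rewrite -[RHS]mul1r -(gtr0_sg (v0 l)) -sgrM; apply: sgr_close.
have -> : Z l j - v l ord0 * (w *m Z) ord0 j = (Z - v *m (w *m Z)) l j.
  rewrite [RHS]mxE; congr (_ + _); rewrite [RHS]mxE; congr (- _).
  by rewrite [RHS]mxE big_ord1.
rewrite normrM (gtr0_norm (v0 l)) (le_lt_trans (ler_mx_entry _ _ _))//.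
rewrite (le_lt_trans near)//.
apply: (@le_lt_trans _ _ (e * (2 * (`|v| * (6 * No%:R * `|(w *m Z) ord0 j|))))).
  by rewrite ler_pM2l// (le_trans large)// ler_pM2l// ler_pM2l//; exact: comp.
have -> : e * (2 * (`|v| * (6 * No%:R * `|(w *m Z) ord0 j|))) =
  24 * No%:R * `|v| * e / 2 * `|(w *m Z) ord0 j| by field.
rewrite ltr_pM2r// ltr_pdivrMr// (le_lt_trans em)//.
by rewrite (le_lt_trans (Hm l))// ltr_pMr// ltr1n.
Qed.

End Agreement.

Section TangentAgreement.
Context {R : realType} {Na No : nat}.
Variables (v : 'cV[R]_Na) (x : 'rV[R]_No).
Hypotheses (v0 : forall i, 0 < v i ord0) (x0 : forall j, x ord0 j != 0).

(** Entries of c v (x) x are at least m |c| in absolute value, with m > 0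
    independent of s; the error is a smaller multiple of |c|. *)
Lemma tangent_line_agreement (Zs : R -> 'M[R]_(Na, No)) :
  tangent_to (line (v *m x)) Zs -> \forall s \near 0^'+, agreement (Zs s).
Proof.
move=> tan; have vx0 (ij : 'I_Na * 'I_No) : 0 < v ij.1 ord0 * `|x ord0 ij.2|.
  by rewrite mulr_gt0// normr_gt0.
have [m m0 Hm] := pos_lower_bound vx0.
pose k := `|v *m x| + 1; have k0 : 0 < k by rewrite ltr_wpDl.
pose e := Num.min 2^-1 (m / (4 * k)).
have e0 : 0 < e by rewrite lt_min invr_gt0 ltr0n divr_gt0// mulr_gt0.
have e2 : e <= 2^-1 by rewrite ge_min lexx.
have em : 4 * k * e <= m.
  by rewrite mulrC -ler_pdivlMr ?mulr_gt0// ge_min lexx orbT.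
apply: filterS (tan e e0) => s [_ [c _ <-]]; set Z := Zs s => near.
have large : `|Z| <= 2 * (`|c| * k).
  have h1 : `|c *: (v *m x)| <= `|c| * k by rewrite normrZ ler_wpM2l// lerDl.
  have h2 : `|Z| <= `|Z - c *: (v *m x)| + `|c *: (v *m x)|.
    by rewrite -[X in `|X| <= _](subrK (c *: (v *m x))) ler_normD.
  have h3 : e * `|Z| <= 2^-1 * `|Z| by rewrite ler_wpM2r.
  by lra.
move=> i i' j; suff H l : Num.sg (Z l j) = Num.sg (c * x ord0 j) by rewrite !H.
have [c0|c0] := eqVneq c 0.
  move: large; rewrite c0 normr0 mul0r mulr0 normr_le0 => /eqP ->.
  by rewrite mxE mul0r.
rewrite -[RHS]mul1r -(gtr0_sg (v0 l)) -sgrM; apply: sgr_close.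
have -> : Z l j - v l ord0 * (c * x ord0 j) = (Z - c *: (v *m x)) l j.
  by rewrite [RHS]mxE; congr (_ + _); rewrite !mxE big_ord1; ring.
rewrite (le_lt_trans (ler_mx_entry _ _ _))// (le_lt_trans near)//.
apply: (@le_lt_trans _ _ (e * (2 * (`|c| * k)))); first by rewrite ler_pM2l.
have -> : e * (2 * (`|c| * k)) = 4 * k * e / 2 * `|c| by field.
rewrite !normrM (gtr0_norm (v0 l)) mulrCA mulrC ltr_pM2l ?normr_gt0//.
rewrite ltr_pdivrMr// (le_lt_trans em)// (le_lt_trans (Hm (l, j)))//=.
by rewrite ltr_pMr ?ltr1n// mulr_gt0// normr_gt0.
Qed.

End TangentAgreement.

Section CompetitiveSpectrum.
Context {R : realType} {n : nat}.
Variables (A : 'M[R]_n) (lam : R) (v : 'cV[R]_n).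
Hypotheses (Av : right_eigenvector A lam v) (simple : simple_eigenvalue A lam).
Hypothesis smallest : smallest_real_part A lam.
Hypothesis strict : forall xi : R[i], complex_eigenvalue A xi ->
  xi != real_complex R lam -> complex.Re xi != lam.

(** The smallest real part for A is the largest one for - A, and the Jacobian
    involves (delta - gamma) (- A). *)
Lemma opposite_dominated : exists (w : 'rV[R]_n) (T : 'M[R]_(n + n, n)) (mu' : R),
  dominated (- A) (- lam) v w T mu'.
Proof.
have [v0 Av'] := Av; have [/eigenvalueP[z zA z0] small] := smallest.
have NAv : (- A) *m v = - lam *: v by rewrite mulNmx Av' scaleNr.
have NAE : eigenvalue (- A) (- lam).
  by apply/eigenvalueP; exists z => //; rewrite mulmxN zA scaleNr.
have pairing (y : 'rV[R]_n) : y *m (- A) = - lam *: y -> y != 0 -> y *m v != 0.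
  move=> yA y0; apply: (simple_pairing simple _ y0 Av' v0).
  by apply: oppr_inj; rewrite -mulmxN yA scaleNr.
apply: (spectral_dominated NAv v0 NAE pairing).
move=> xi /eigenvalueP[y yA y0] xin.
have eigA : complex_eigenvalue A (- xi).
  apply/eigenvalueP; exists y => //; apply: oppr_inj.
  by rewrite -mulmxN -map_mxN yA scaleNr opprK.
have ReN : complex.Re (- xi) = - complex.Re xi by case: (xi).
have h1 := small _ eigA.
have h2 : complex.Re (- xi) != lam.
  apply: (strict eigA); apply: contra_neq xin => xiE.
  by rewrite [RHS]rmorphN -[LHS]opprK xiE.
rewrite ReN in h1 h2.
by rewrite ltrNr lt_neqAle eq_sym h2.
Qed.

End CompetitiveSpectrum.

(** * Cooperative and competitive agents *)

Theorem mainTheorem2 (R : realType) (Na No : nat)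
    (d alpha beta gamma delta : R) (S1 S2 : R -> R)
    (g : rel 'I_Na) (lmax lmin : R) (vmax vmin : 'cV[R]_Na) :
  (1 < No)%N ->
  0 < d ->
  sigmoidal S1 -> sigmoidal S2 ->
  irreflexive g -> strongly_connected g ->
  let A := adjacency R g in
  let f := @opinion_field R Na No d alpha beta gamma delta S1 S2 A in
  let u_a := d / (alpha - beta + lmax * (gamma - delta)) in
  let u_d := d / (alpha - beta + lmin * (gamma - delta)) in
  0 < lmax -> largest_real_part A lmax ->
  right_eigenvector A lmax vmax -> (forall i, 0 < vmax i ord0) ->
  lmin < 0 -> smallest_real_part A lmin ->
  right_eigenvector A lmin vmin ->
  simple_eigenvalue A lmin ->
  (forall xi : R[i], complex_eigenvalue A xi ->
     xi != real_complex R lmin -> complex.Re xi != lmin) ->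
  (0 < gamma - delta -> 0 < alpha - beta + lmax * (gamma - delta) ->
    [/\ forall ustar, opinion_forming_bifurcation f vmax ustar <-> ustar = u_a,
        quadratically_nondegenerate alpha beta gamma delta S1 S2 lmax ->
          branches_made_of f u_a (@agreement R Na No) &
        forall us Zs (vax : 'rV[R]_No), bifurcation_branch f u_a us Zs ->
          perp1 vax -> (forall j, vax ord0 j != 0) ->
          tangent_to (line (vmax *m vax)) Zs ->
          \forall s \near 0^'+, agreement (Zs s)])
  /\
  (gamma - delta < 0 -> 0 < alpha - beta + lmin * (gamma - delta) ->
    (forall ustar, opinion_forming_bifurcation f vmin ustar <-> ustar = u_d) /\
    (mixed_sign vmin -> branches_made_of f u_d (@disagreement R Na No))).
Proof.
move=> No1 d0 hS1 hS2 girr gconn A f u_a u_d lmax0 lmaxP [_ Avmax] vmax_gt0.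
move=> lmin0 lminP vminP simple strict.
have A0 i : A i i = 0 by rewrite mxE girr.
set Gam := response alpha beta gamma delta S1 S2 A.
have fE : f = @columnwise_field R Na No d Gam.
  by apply/funext => u; apply/funext => Z; exact: opinion_fieldE.
have GamL : strict_diff0 Gam ((alpha - beta)%:M + (gamma - delta) *: A).
  exact: response_strict_diff.
have GamT : truncatable Gam by exact: response_truncatable.
split=> [gd0 crit0|gd0 crit0].
  have [w [T [mu' [domA w_gt0]]]] := perron_dominated gconn lmax0 Avmax vmax_gt0 lmaxP.1.
  have dom := dominated_scale gd0 domA.
  rewrite mulrC in crit0; rewrite /u_a [lmax * _]mulrC fE; split.
  - move=> ustar.
    exact: (opinion_forming_bifurcation_iff d0 GamL GamT No1 dom crit0 ustar).
  - move=> nondeg.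
    have q0 : quadratic_coefficient alpha beta gamma delta S1 S2 lmax vmax w != 0.
      have [[i i'] _] := mx_norm_attained (dom_v_neq0 domA).
      rewrite /quadratic_coefficient !mulf_neq0 ?invr_neq0 ?subr_eq0 ?pnatr_eq0//.
      rewrite gt_eqF// (bigD1 i)//= ltr_wpDr ?mulr_gt0 ?exprn_gt0//.
      by apply: sumr_ge0 => k _; rewrite mulr_ge0 ?sqr_ge0 ?(ltW (w_gt0 k)).
    have second := response_second_order alpha beta gamma delta hS1 hS2
      Avmax (dom_left domA) w_gt0.
    rewrite [lmax * _]mulrC in second.
    have [r r0 Hr] := agreement_near_kernel d0 GamL No1 dom crit0 q0 vmax_gt0 second.
    exists r => // us Zs [_ _ _ br] s s01 us_r Zs_r.
    have [VZ _ eqZ] := br s s01.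
    by apply: Hr eqZ => //; exact: ltW.
  - move=> us Zs vax _ _ vax0; exact: tangent_line_agreement.
have [w [T [mu' domA]]] := opposite_dominated vminP simple lminP strict.
have dg0 : 0 < delta - gamma by rewrite subr_gt0 -subr_lt0.
have := dominated_scale dg0 domA.
rewrite scalerN -scaleNr mulrN -mulNr opprB => dom.
rewrite mulrC in crit0; rewrite /u_d [lmin * _]mulrC fE; split.
  move=> ustar.
  exact: (opinion_forming_bifurcation_iff d0 GamL GamT No1 dom crit0 ustar).
move=> mixed.
have [r r0 Hr] := disagreement_near_kernel (No := No) d0 GamL dom crit0 mixed.
exists r => // us Zs [_ _ _ br] s s01 us_r Zs_r.
have [VZ Z0 eqZ] := br s s01.
by apply: Hr eqZ Z0 => //; exact: ltW.
Qed.
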